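(* Let $\underline{n} = (n_1,\dots,n_d)$ be a $d$-tuple of positive integers and $\underline{u} = (u_1,\dots,u_d) \in (\overline{K}[t])^d$ with $\|u_i\|_\infty < |\theta|_\infty^{n_i q/(q-1)}$ for each $i$. If $\tilde{\pi}, L_{u_1,n_1}(\theta),\dots,L_{u_d,n_d}(\theta)$ are algebraically independent over $\overline{K}$, then $$\operatorname{tr.deg}_{\overline{K}} \overline{K}\big(\tilde{\pi}, L_{\underline{u}_{ij},\underline{n}_{ij}}(\theta) \;\big|\; (i,j) \in I_d\big) = 1 + \# I_d = 1 + \frac{d(d+1)}{2}.$$
   Context: Let $\mathbb{F}_q$ be the finite field with $q$ elements, $K = \mathbb{F}_q(\theta)$, $K_\infty = \mathbb{F}_q((\theta^{-1}))$ with absolute value $|\cdot|_\infty$ ($|\theta|_\infty>1$), $\mathbb{C}_\infty$ the completion of an algebraic closure of $K_\infty$, $\overline{K}$ the algebraic closure of $K$ in $\mathbb{C}_\infty$, and $t$ a variable independent of $\theta$. Fixing a $(q-1)$-st root of $-\theta$, $\tilde{\pi} = (-\theta)^{q/(q-1)} \prod_{i=1}^\infty (1-\theta^{1-q^i})^{-1}$. For $u = \sum_j \alpha_j t^j \in \overline{K}[t]$, $\|u\|_\infty = \max_j |\alpha_j|_\infty$ and $u^{(i)} = \sum_j \alpha_j^{q^i} t^j$. For positive integers $m_1,\dots,m_s$ and $v_1,\dots,v_s \in \overline{K}[t]$ with $\|v_k\|_\infty < |\theta|_\infty^{m_k q/(q-1)}$, set $$L_{(v_1,\dots,v_s),(m_1,\dots,m_s)}(t)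 = \sum_{i_1 > \cdots > i_s \geq 0} \frac{v_1^{(i_1)}\cdots v_s^{(i_s)}}{P_{i_1}(t)^{m_1}\cdots P_{i_s}(t)^{m_s}},\quad P_0=1,\ P_i(t) = (t-\theta^q)(t-\theta^{q^2})\cdots(t-\theta^{q^i}),$$ which converges on $|t|_\infty < |\theta|_\infty^q$; $L_{\cdot,\cdot}(\theta)$ is its value at $t = \theta$. For $s=1$ write $L_{v,m}$. Let $I_d = \{(i,j) \in \mathbb{Z}^2 \mid 1 \leq j < i \leq d+1\}$ and, for $(i,j) \in I_d$, $\underline{n}_{ij} = (n_j, n_{j+1},\dots,n_{i-1})$ and $\underline{u}_{ij} = (u_j,u_{j+1},\dots,u_{i-1})$. *)

(* Defs.v *)
From HB Require Import structures.
From mathcomp Require Import all_boot all_order all_algebra all_field.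
From mathcomp Require Import mpoly.
Set Implicit Arguments. Unset Strict Implicit. Unset Printing Implicit Defensive.
Import Order.TTheory GRing.Theory Num.Theory.
Local Open Scope ring_scope.

Section Defs.
Variables (C : closedFieldType) (R : realFieldType) (abs : C -> R).

Definition nonarch_abs : Prop :=
  (forall x, 0 <= abs x) /\ (forall x, abs x = 0 <-> x = 0) /\
  (forall x y, abs (x * y) = abs x * abs y) /\
  (forall x y, abs (x + y) <= Num.max (abs x) (abs y)).

Definition converges_to (s : nat -> C) (l : C) : Prop :=
  forall eps : R, 0 < eps -> exists N, forall m, (N <= m)%N -> abs (s m - l) < eps.

Definition complete_abs : Prop :=
  forall s : nat -> C,
    (forall eps : R, 0 < eps -> exists N, forall m k, (N <= m)%N -> (N <= k)%N ->
        abs (s m - s k) < eps) ->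
    exists l, converges_to s l.

Definition in_Fq (q : nat) (c : C) : Prop := c ^+ q = c.

Definition in_K (q : nat) (th : C) (x : C) : Prop :=
  exists a b : {poly C}, (forall i, in_Fq q a`_i) /\ (forall i, in_Fq q b`_i) /\
    b.[th] != 0 /\ x = a.[th] / b.[th].

Definition in_Kbar (q : nat) (th : C) (x : C) : Prop :=
  exists P : {poly C}, P != 0 /\ (forall i, in_K q th P`_i) /\ root P x.

Definition alg_indep (F : C -> Prop) (s : seq C) : Prop :=
  forall P : {mpoly C[size s]}, (forall m, F (P@_m)) ->
    P.@[fun i : 'I_(size s) => s`_i] = 0 -> P = 0.

Definition in_gen_field (F : C -> Prop) (s : seq C) (x : C) : Prop :=
  exists P Q : {mpoly C[size s]}, (forall m, F (P@_m)) /\ (forall m, F (Q@_m)) /\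
    Q.@[fun i : 'I_(size s) => s`_i] != 0 /\
    x = P.@[fun i : 'I_(size s) => s`_i] / Q.@[fun i : 'I_(size s) => s`_i].

Definition trdeg_eq (F : C -> Prop) (s : seq C) (n : nat) : Prop :=
  (exists t : seq C, size t = n /\ (forall y, y \in t -> in_gen_field F s y) /\
     alg_indep F t) /\
  (forall t : seq C, (forall y, y \in t -> in_gen_field F s y) -> alg_indep F t ->
     (size t <= n)%N).

Definition frob_eval (q : nat) (th : C) (i : nat) (v : {poly C}) : C :=
  (map_poly (fun a : C => a ^+ (q ^ i)) v).[th].

Definition Pth (q : nat) (th : C) (i : nat) : C :=
  \prod_(1 <= k < i.+1) (th - th ^+ (q ^ k)).

Definition decreasing_ff (s N : nat) (f : {ffun 'I_s -> 'I_N}) : bool :=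
  [forall k1 : 'I_s, forall k2 : 'I_s, (nat_of_ord k1 < nat_of_ord k2)%N ==>
     (nat_of_ord (f k2) < nat_of_ord (f k1))%N].

Definition L_partial (q : nat) (th : C) (vs : seq {poly C}) (ms : seq nat) (N : nat) : C :=
  \sum_(f : {ffun 'I_(size vs) -> 'I_N} | decreasing_ff f)
    \prod_(k < size vs)
      (frob_eval q th (f k) vs`_k / Pth q th (f k) ^+ (nth 0%N ms k)).

Definition IsL (q : nat) (th : C) (vs : seq {poly C}) (ms : seq nat) (x : C) : Prop :=
  size ms = size vs /\ converges_to (L_partial q th vs ms) x.

(* pt = zeta^q prod_{i>=1} (1 - theta^{1-q^i})^{-1}, where zeta^{q-1} = -theta *)
Definition IsPiTilde (q : nat) (th zeta pt : C) : Prop :=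
  converges_to (fun N => zeta ^+ q *
     \prod_(1 <= i < N.+1) (1 - th / th ^+ (q ^ i))^-1) pt.

End Defs.

Definition Idset (d : nat) : {set 'I_(d.+2) * 'I_(d.+2)} :=
  [set ij | (0 < nat_of_ord ij.2)%N && (nat_of_ord ij.2 < nat_of_ord ij.1)%N].

Definition subseq_ij {T : Type} (f : nat -> T) (i j : nat) : seq T :=
  [seq f k | k <- iota j (i - j)].

(* Main.v *)
Require Import Defs.
From HB Require Import structures.
From mathcomp Require Import all_boot all_order all_algebra all_field.
From mathcomp Require Import mpoly.
From mathcomp Require Import boolp.
From mathcomp Require Import ring zify.
Set Implicit Arguments. Unset Strict Implicit. Unset Printing Implicit Defensive.
Import Order.TTheory GRing.Theory Num.Theory.
Local Open Scope ring_scope.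

(* Idea.  Put tau f = f^(1) (coefficients raised to the power q) and Om = zeta^-q prod_(i >= 1) (1 - t / theta^(q^i)),
   so that Om = (t - theta^q) tau(Om) and Om(theta) = 1 / pt.  With f_k = u_k Om^(n_k), the series
   Y_ij = sum_(i1 > .. > is >= 0) prod_k tau^(i_k)(f_(j+k-1)) satisfy Y_ij = tau Y_ij + f_(i-1) tau Y_(i-1,j) and
   Y_ij(theta) = Om(theta)^(n_j + .. + n_(i-1)) L_ij(theta).
   - An Ostrowski-type argument shows that an algebraic relation over Kbar(t) between Om and the Y_ij forces one
     between Om and the Y_(k+1,k) only: a minimal relation is semi-invariant under the Frobenius substitution,
     hence under lower unitriangular translations up to a term fixed by them, and the translations
     by 1 + x E_ij with i - j >= 2 are commutators, so that X_ij with i - j >= 2 cannot occur.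
   - Om and the Y_(k+1,k) satisfy no relation, by specialisation at theta and the hypothesis.
   - A relation over Kbar between the values at theta is a linear relation between values of monomials; by the
     Anderson-Brownawell-Papanikolas criterion it lifts to a relation between the functions themselves. *)

(** * Power series *)

(** The criterion is applied to all monomials in Om and the Y_ij up to a given degree. The
    functional equations are homogeneous when Om has degree 1 and Y_ij degree n_j + .. + n_(i-1), so
    finitely many monomials form a stable system; graded by i - j instead, the system is triangular
    with powers of t - theta^q on the diagonal, which makes theta^q its only possible singular
    point. Relations are compared by weight in the i - j, then by the number of monomials of top
    weight, because the Frobenius substitution only rescales such monomials and the translations fix
    them. The fixed term arises because a quotient of convergent series that is invariant under
    Frobenius is rational over Fq. Two obstacles shape the analysis. The absolute value takes values
    in an arbitrary ordered field, so |x| < 1 does not by itself force x^n to zero: cofinality of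
    the powers of |theta| is drawn from the product for pt, and decay of powers from algebraicity.
    The coefficients of Om and Y_ij are not assumed algebraic, so heights are only measured on
    polynomials, and a coefficient of the auxiliary function is handled as a root of an additive
    polynomial. *)

Section PowerSeries.
Variable R : comNzRingType.

Definition pser := nat -> R.
HB.instance Definition _ := gen_eqMixin pser.
HB.instance Definition _ := gen_choiceMixin pser.

Implicit Types f g h : pser.

Definition ps_add f g : pser := fun i => f i + g i.
Definition ps_opp f : pser := fun i => - f i.
Definition ps_zero : pser := fun=> 0.
Definition ps_one : pser := fun i => (i == 0%N)%:R.
Definition ps_mul f g : pser := fun n => \sum_(i < n.+1) f i * g (n - i)%N.

Lemma ps_addA : associative ps_add.
Proof. by move=> f g h; apply/funext=> i; exact: addrA. Qed.
Lemma ps_addC : commutative ps_add.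
Proof. by move=> f g; apply/funext=> i; exact: addrC. Qed.
Lemma ps_add0 : left_id ps_zero ps_add.
Proof. by move=> f; apply/funext=> i; exact: add0r. Qed.
Lemma ps_addN : left_inverse ps_zero ps_opp ps_add.
Proof. by move=> f; apply/funext=> i; exact: addNr. Qed.
HB.instance Definition _ := GRing.isZmodule.Build pser ps_addA ps_addC ps_add0 ps_addN.

Let trunc n f : {poly R} := \poly_(i < n.+1) f i.

Let coef_trunc n f i : (i <= n)%N -> (trunc n f)`_i = f i.
Proof. by move=> le_in; rewrite coef_poly ltnS le_in. Qed.

(** A coefficient of a product depends on finitely many coefficients of the factors, so the ring
    axioms for series are inherited from [{poly R}] by truncation. *)
Let coef_mul_trunc n (p r : {poly R}) f g :
  (forall i, (i <= n)%N -> p`_i = f i) -> (forall i, (i <= n)%N -> r`_i = g i) ->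
  forall k, (k <= n)%N -> (p * r)`_k = ps_mul f g k.
Proof.
move=> Hp Hr k le_kn; rewrite coefM; apply: eq_bigr => i _.
by rewrite Hp ?Hr // ?(leq_trans (leq_subr _ _)) // (leq_trans _ le_kn) // -ltnS.
Qed.

Lemma ps_mulA : associative ps_mul.
Proof.
move=> f g h; apply/funext=> n.
rewrite -(@coef_mul_trunc n (trunc n f) (trunc n g * trunc n h)) //; first last.
- by move=> i le_in; apply: (@coef_mul_trunc n) => // j; exact: coef_trunc.
- by move=> i; exact: coef_trunc.
rewrite mulrA (@coef_mul_trunc n _ _ (ps_mul f g) h) //; last by move=> i; exact: coef_trunc.
by move=> i le_in; apply: (@coef_mul_trunc n) => // j; exact: coef_trunc.
Qed.

Lemma ps_mulC : commutative ps_mul.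
Proof.
move=> f g; apply/funext=> n.
rewrite -(@coef_mul_trunc n (trunc n f) (trunc n g)) // 1?mulrC;
  [apply: (@coef_mul_trunc n) | ..] => // i; exact: coef_trunc.
Qed.

Lemma ps_mul1 : left_id ps_one ps_mul.
Proof.
move=> f; apply/funext=> n; rewrite /ps_mul big_ord_recl /ps_one eqxx mul1r subn0.
by rewrite big1 ?addr0 // => i _; rewrite mul0r.
Qed.

Lemma ps_mulDl : left_distributive ps_mul ps_add.
Proof.
move=> f g h; apply/funext=> n; rewrite /ps_mul /ps_add -big_split /=.
by apply: eq_bigr => i _; rewrite mulrDl.
Qed.

Lemma ps_one_neq0 : ps_one != 0.
Proof. by apply/eqP => /(congr1 (fun f => f 0%N)) /eqP; rewrite /ps_one /= oner_eq0. Qed.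

HB.instance Definition _ :=
  GRing.Zmodule_isComNzRing.Build pser ps_mulA ps_mulC ps_mul1 ps_mulDl ps_one_neq0.

Lemma psD f g i : (f + g) i = f i + g i. Proof. by []. Qed.
Lemma psN f i : (- f) i = - f i. Proof. by []. Qed.
Lemma psB f g i : (f - g) i = f i - g i. Proof. by []. Qed.
Lemma ps0 i : (0 : pser) i = 0. Proof. by []. Qed.
Lemma psM f g n : (f * g) n = \sum_(i < n.+1) f i * g (n - i)%N. Proof. by []. Qed.
Lemma ps_sum (I : Type) (r : seq I) (P : pred I) (F : I -> pser) n :
  (\sum_(i <- r | P i) F i) n = \sum_(i <- r | P i) F i n.
Proof. by apply: (big_morph (fun f : pser => f n)). Qed.

Definition of_poly (p : {poly R}) : pser := fun i => p`_i.

Lemma of_poly_is_zmod_morphism : zmod_morphism of_poly.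
Proof. by move=> p r; apply/funext=> i; rewrite /of_poly coefB. Qed.
HB.instance Definition _ :=
  GRing.isZmodMorphism.Build {poly R} pser of_poly of_poly_is_zmod_morphism.
Lemma of_poly_is_monoid_morphism : monoid_morphism of_poly.
Proof.
split; first by apply/funext=> i; rewrite /of_poly coef1.
by move=> p r; apply/funext=> i; rewrite /of_poly coefM.
Qed.
HB.instance Definition _ :=
  GRing.isMonoidMorphism.Build {poly R} pser of_poly of_poly_is_monoid_morphism.

Lemma of_poly_inj : injective of_poly.
Proof. by move=> p r eq_pr; apply/polyP => i; rewrite -[p`_i]/(of_poly p i) eq_pr. Qed.

Lemma psCM c f i : (of_poly c%:P * f) i = c * f i.
Proof.
rewrite psM big_ord_recl subn0 /of_poly coefC /= big1 ?addr0 // => j _.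
by rewrite coefC mul0r.
Qed.

Lemma psXM f i : (of_poly 'X * f) i = if i is j.+1 then f j else 0.
Proof.
rewrite psM /of_poly; case: i => [|i]; first by rewrite big_ord1 coefX mul0r.
rewrite 2!big_ord_recl !coefX /= mul0r add0r mul1r subSS subn0 big1 ?addr0 // => j _.
by rewrite coefX mul0r.
Qed.

Lemma psXnM k f i : (of_poly 'X^k * f) i = if (i < k)%N then 0 else f (i - k)%N.
Proof.
elim: k i => [|k IHk] i; first by rewrite expr0 rmorph1 mul1r subn0.
rewrite exprS rmorphM -mulrA psXM; case: i => [|i]; first by [].
by rewrite IHk ltnS subSS.
Qed.

End PowerSeries.

Definition ps_map (R : comNzRingType) (phi : R -> R) (f : pser R) : pser R := fun i => phi (f i).

Section PsMap.
Variables (R : comNzRingType) (phi : {rmorphism R -> R}).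

Lemma ps_map_is_zmod_morphism : zmod_morphism (ps_map phi).
Proof. by move=> f g; apply/funext=> i; exact: rmorphB. Qed.
HB.instance Definition _ :=
  GRing.isZmodMorphism.Build (pser R) (pser R) (ps_map phi) ps_map_is_zmod_morphism.
Lemma ps_map_is_monoid_morphism : monoid_morphism (ps_map phi).
Proof.
split; first by apply/funext=> i; exact: rmorph_nat.
move=> f g; apply/funext=> n; rewrite /ps_map !psM rmorph_sum.
by apply: eq_bigr => i _; rewrite rmorphM.
Qed.
HB.instance Definition _ :=
  GRing.isMonoidMorphism.Build (pser R) (pser R) (ps_map phi) ps_map_is_monoid_morphism.

Lemma ps_map_of_poly (p : {poly R}) : ps_map phi (of_poly p) = of_poly (map_poly phi p).
Proof. by apply/funext=> i; rewrite /ps_map /of_poly coef_map. Qed.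

End PsMap.

Section PsDomain.
Variable R : idomainType.

Lemma ps_order (f : pser R) : f != 0 -> exists k, f k != 0 /\ forall i, (i < k)%N -> f i = 0.
Proof.
move=> nz_f; have ex_nz : exists k, f k != 0.
  apply/not_existsP => f0; case/eqP: nz_f; apply/funext => k.
  by apply/eqP/negPn/negP; exact: f0.
exists (ex_minn ex_nz); case: ex_minnP => k nz_k min_k; split=> // i lt_ik.
by apply/eqP/negPn/negP => /min_k; rewrite leqNgt lt_ik.
Qed.

(** Lowest terms multiply. Besides excluding zero divisors, this reads the lowest coefficient of the
    auxiliary function off its factorisation, and off the recurrence between its twists. *)
Lemma ps_lowM (f g : pser R) a b :
  (forall i, (i < a)%N -> f i = 0) -> (forall i, (i < b)%N -> g i = 0) ->
  (f * g) (a + b)%N = f a * g b /\ (forall i, (i < a + b)%N -> (f * g) i = 0).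
Proof.
move=> f0 g0; split.
  have lta : (a < (a + b).+1)%N by rewrite ltnS leq_addr.
  rewrite psM (bigD1 (Ordinal lta)) //= addKn big1 ?addr0 // => i ne_ia.
  case: (ltngtP i a) => [/f0 -> | lt_ai | eq_ia]; first by rewrite mul0r.
    rewrite g0 ?mulr0 //; move: (ltn_ord i) lt_ai; lia.
  by case/eqP: ne_ia; apply/val_inj.
move=> i lt_i; rewrite psM big1 // => j _.
case: (ltnP j a) => [/f0 -> | le_aj]; first by rewrite mul0r.
rewrite g0 ?mulr0 //; move: (ltn_ord j) le_aj lt_i; lia.
Qed.

Lemma ps_mulf_eq0 (f g : pser R) : f * g = 0 -> f = 0 \/ g = 0.
Proof.
have [-> | /ps_order[a [nz_a f0]]] := eqVneq f 0; first by left.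
have [-> | /ps_order[b [nz_b g0]]] := eqVneq g 0; first by right.
have [fg_ab _] := ps_lowM f0 g0.
by move/(congr1 (fun h => h (a + b)%N)) => /eqP; rewrite fg_ab ps0 mulf_eq0 (negPf nz_a) (negPf nz_b).
Qed.

Lemma ps_mulfI (f g h : pser R) : f != 0 -> f * g = f * h -> g = h.
Proof.
move=> nz_f /eqP; rewrite -subr_eq0 -mulrBr => /eqP /ps_mulf_eq0 [f0 | /eqP].
  by rewrite f0 eqxx in nz_f.
by rewrite subr_eq0 => /eqP.
Qed.

Lemma ps_expf_neq0 (f : pser R) n : f != 0 -> f ^+ n != 0.
Proof.
move=> nz_f; elim: n => [|n IHn]; first by rewrite expr0 oner_neq0.
by apply/eqP; rewrite exprS => /ps_mulf_eq0 [] /eqP; rewrite ?(negPf nz_f) ?(negPf IHn).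
Qed.

Lemma ps_map_inj (phi : {rmorphism R -> R}) : injective phi -> injective (ps_map phi).
Proof. by move=> inj f g eq_fg; apply/funext => i; apply: inj; exact: (congr1 (fun h => h i) eq_fg). Qed.

End PsDomain.

Lemma of_poly_neq0 (R : comNzRingType) (p : {poly R}) : p != 0 -> of_poly p != 0.
Proof. by apply: contra_neq => p0; apply: (@of_poly_inj R); rewrite p0 rmorph0. Qed.

(** * Powers of the Frobenius endomorphism *)

Section Frobenius.
Variables (R : comNzRingType) (p e : nat).
Definition frob of p \in [pchar R] := fun x : R => x ^+ (p ^ e).
Variable chR : p \in [pchar R].

Lemma frob_is_zmod_morphism : zmod_morphism (frob chR).
Proof.
move=> x y; apply/eqP; rewrite eq_sym subr_eq -[X in X == _](congr1 (frob chR) (subrK y x)) eq_sym.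
by apply/eqP/esym/exprDn_pchar; rewrite pnatX (pnatE _ (pcharf_prime chR)) chR.
Qed.
HB.instance Definition _ := GRing.isZmodMorphism.Build R R (frob chR) frob_is_zmod_morphism.
Lemma frob_is_monoid_morphism : monoid_morphism (frob chR).
Proof. by split=> [|x y]; rewrite /frob ?expr1n ?exprMn. Qed.
HB.instance Definition _ := GRing.isMonoidMorphism.Build R R (frob chR) frob_is_monoid_morphism.
End Frobenius.

(** * Convergence over an ultrametric field *)

Section Ultrametric.
Variables (C : closedFieldType) (R : realFieldType) (abs : C -> R).
Hypothesis Habs : nonarch_abs abs.
Implicit Types f g h : pser C.

Lemma abs_ge0 x : 0 <= abs x. Proof. by case: Habs. Qed.
Lemma abs_eq0 x : (abs x == 0) = (x == 0).
Proof. by case: Habs => _ [H _]; apply/eqP/eqP => /H. Qed.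
Lemma absM x y : abs (x * y) = abs x * abs y. Proof. by case: Habs => _ [_ []]. Qed.
Lemma absD x y : abs (x + y) <= Num.max (abs x) (abs y). Proof. by case: Habs => _ [_ []]. Qed.
Lemma abs_gt0 x : (0 < abs x) = (x != 0).
Proof. by rewrite lt_def abs_eq0 abs_ge0 andbT. Qed.
Lemma abs0 : abs 0 = 0. Proof. by apply/eqP; rewrite abs_eq0. Qed.
Lemma abs1 : abs 1 = 1.
Proof.
have nz1 : abs 1 != 0 by rewrite abs_eq0 oner_eq0.
by apply: (mulfI nz1); rewrite -absM !mulr1.
Qed.
Lemma absX x n : abs (x ^+ n) = abs x ^+ n.
Proof. by elim: n => [|n IHn]; rewrite ?expr0 ?abs1 // !exprS absM IHn. Qed.
Lemma absN x : abs (- x) = abs x.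
Proof.
have abs_sqr1 : abs (-1) ^+ 2 == 1 ^+ 2 by rewrite -absX sqrrN expr1n expr1n abs1.
have absN1 : abs (-1) = 1.
  by apply/eqP; rewrite -(eqrXn2 (n := 2)) ?abs_ge0.
by rewrite -mulN1r absM absN1 mul1r.
Qed.
Lemma absV x : abs x^-1 = (abs x)^-1.
Proof.
have [-> | nz_x] := eqVneq x 0; first by rewrite invr0 abs0 invr0.
have nz_ax : abs x != 0 by rewrite abs_eq0.
by apply: (mulfI nz_ax); rewrite -absM !mulfV // abs1.
Qed.
Lemma abs_prod (I : Type) (r : seq I) (P : pred I) (F : I -> C) :
  abs (\prod_(i <- r | P i) F i) = \prod_(i <- r | P i) abs (F i).
Proof. exact: (big_morph abs absM abs1). Qed.

Lemma absD_le x y B : abs x <= B -> abs y <= B -> abs (x + y) <= B.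
Proof. by move=> Hx Hy; apply: le_trans (absD x y) _; rewrite ge_max Hx. Qed.
Lemma absD_lt x y B : abs x < B -> abs y < B -> abs (x + y) < B.
Proof. by move=> Hx Hy; apply: le_lt_trans (absD x y) _; rewrite gt_max Hx. Qed.
Lemma absB_lt x y B : abs x < B -> abs y < B -> abs (x - y) < B.
Proof. by move=> Hx Hy; apply: absD_lt; rewrite ?absN. Qed.
Lemma abs_sum_le (I : eqType) (r : seq I) (P : pred I) (F : I -> C) B : 0 <= B ->
  (forall i, i \in r -> P i -> abs (F i) <= B) -> abs (\sum_(i <- r | P i) F i) <= B.
Proof.
move=> ge0B le_FB; rewrite big_seq_cond; elim/big_rec: _ => [|i x /andP[ri Pi] IH].
  by rewrite abs0.
by apply: absD_le IH; apply: le_FB.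
Qed.
Lemma abs_sum_lt (I : eqType) (r : seq I) (P : pred I) (F : I -> C) B : 0 < B ->
  (forall i, i \in r -> P i -> abs (F i) < B) -> abs (\sum_(i <- r | P i) F i) < B.
Proof.
move=> ge0B le_FB; rewrite big_seq_cond; elim/big_rec: _ => [|i x /andP[ri Pi] IH].
  by rewrite abs0.
by apply: absD_lt IH; apply: le_FB.
Qed.
Lemma absD_eq x y : abs y < abs x -> abs (x + y) = abs x.
Proof.
move=> lt_yx; apply/le_anti; rewrite absD_le // ?(ltW lt_yx) //=.
rewrite leNgt; apply/negP => lt_xyx.
by have := absB_lt lt_xyx lt_yx; rewrite addrK ltxx.
Qed.

Notation cvg := (converges_to abs).

Lemma cvg_unique s l l' : cvg s l -> cvg s l' -> l = l'.
Proof.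
move=> Hl Hl'; apply/eqP; rewrite -subr_eq0 -abs_eq0; apply/contraT => nz.
have eps_gt0 : 0 < abs (l - l') by rewrite lt_def nz abs_ge0.
have [N HN] := Hl _ eps_gt0; have [N' HN'] := Hl' _ eps_gt0.
have := absB_lt (HN' _ (leq_maxr N N')) (HN _ (leq_maxl N N')).
by rewrite opprB addrC addrA subrK ltxx.
Qed.

Lemma cvg_ext s s' l : (forall n, s n = s' n) -> cvg s l -> cvg s' l.
Proof. by move=> eq_s Hs eps /Hs [N HN]; exists N => m /HN; rewrite eq_s. Qed.

Lemma cvg_mulc c s l : cvg s l -> cvg (fun n => c * s n) (c * l).
Proof.
move=> Hs eps eps_gt0; have [-> | nz_c] := eqVneq c 0.
  by exists 0%N => m _; rewrite !mul0r subr0 abs0.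
have c_gt0 : 0 < abs c by rewrite abs_gt0.
have [N HN] := Hs _ (divr_gt0 eps_gt0 c_gt0).
by exists N => m /HN; rewrite -mulrBr absM ltr_pdivlMr // mulrC.
Qed.

Lemma cvg_neq0_inv s l : l != 0 -> cvg s l -> cvg (fun n => (s n)^-1) l^-1.
Proof.
move=> nz_l Hs eps eps_gt0.
have l_gt0 : 0 < abs l by rewrite abs_gt0.
have [N HN] := Hs _ l_gt0; have [N' HN'] := Hs _ (mulr_gt0 eps_gt0 (mulr_gt0 l_gt0 l_gt0)).
exists (maxn N N') => m; rewrite geq_max => /andP[/HN lt_m /HN' lt_m'].
have eq_abs : abs (s m) = abs l by rewrite -[s m](subrK l) addrC absD_eq.
have nz_s : s m != 0 by rewrite -abs_gt0 eq_abs.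
have -> : (s m)^-1 - l^-1 = - (s m - l) / (s m * l).
  by field; rewrite nz_l nz_s.
rewrite absM absN absV absM eq_abs ltr_pdivrMr //; exact: mulr_gt0.
Qed.

(** The Tate algebra of the closed disc of radius [r]; [bnd] bounds the Gauss norm attached to the
    same disc. *)
Definition conv (r : R) (f : pser C) : Prop :=
  forall eps, 0 < eps -> exists N, forall i, (N <= i)%N -> abs (f i) * r ^+ i < eps.
Definition bnd (r : R) (f : pser C) (B : R) : Prop := forall i, abs (f i) * r ^+ i <= B.

Section Radius.
Variable r : R.
Hypothesis r_gt0 : 0 < r.
Let rX_gt0 i : 0 < r ^+ i. Proof. exact: exprn_gt0. Qed.
Let rX_ge0 i : 0 <= r ^+ i. Proof. exact: exprn_ge0 (ltW r_gt0). Qed.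

Lemma max_bound (F : nat -> R) N : exists2 B, 0 < B & forall i, (i < N)%N -> F i <= B.
Proof.
elim: N => [|N [B B_gt0 HB]]; first by exists 1.
exists (Num.max B (F N)); first by rewrite lt_max B_gt0.
by move=> i; rewrite ltnS leq_eqVlt le_max => /predU1P[-> | /HB ->] //; rewrite lexx orbT.
Qed.

Lemma conv_bnd f : conv r f -> exists2 B, 0 < B & bnd r f B.
Proof.
case/(_ 1 ltr01) => N HN; have [B B_gt0 HB] := max_bound (fun i => abs (f i) * r ^+ i) N.
exists (Num.max B 1); first by rewrite lt_max B_gt0.
by move=> i; rewrite le_max; case: (ltnP i N) => [/HB -> // | /HN /ltW ->]; rewrite orbT.
Qed.

Lemma convD f g : conv r f -> conv r g -> conv r (f + g).
Proof.
move=> Hf Hg eps eps_gt0; have [N HN] := Hf _ eps_gt0; have [N' HN'] := Hg _ eps_gt0.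
exists (maxn N N') => i; rewrite geq_max => /andP[/HN lt_i /HN' lt_i'].
by rewrite -ltr_pdivlMr //; apply: absD_lt; rewrite ltr_pdivlMr.
Qed.
Lemma convN f : conv r f -> conv r (- f).
Proof. by move=> Hf eps /Hf [N HN]; exists N => i /HN; rewrite psN absN. Qed.
Lemma convB f g : conv r f -> conv r g -> conv r (f - g).
Proof. by move=> Hf Hg; apply: convD => //; apply: convN. Qed.

Lemma psM_bnd f g A B n : (forall i j, (i + j = n)%N ->
    abs (f i) * r ^+ i * (abs (g j) * r ^+ j) <= A * B) -> 0 <= A * B ->
  abs ((f * g) n) * r ^+ n <= A * B.
Proof.
move=> HAB AB_ge0; rewrite -ler_pdivlMr // psM; apply: abs_sum_le => [|i _ _].
  by rewrite divr_ge0.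
have le_in : (i <= n)%N by rewrite -ltnS.
by rewrite ler_pdivlMr // absM -[in r ^+ n](subnKC le_in) exprD mulrACA; apply: HAB; rewrite subnKC.
Qed.

Lemma bndM f g A B : 0 <= A -> 0 <= B -> bnd r f A -> bnd r g B -> bnd r (f * g) (A * B).
Proof.
move=> A_ge0 B_ge0 Hf Hg n; apply: psM_bnd; last exact: mulr_ge0.
by move=> i j _; apply: ler_pM => //; rewrite mulr_ge0 ?abs_ge0.
Qed.
Lemma bndD f g A : bnd r f A -> bnd r g A -> bnd r (f + g) A.
Proof. by move=> Hf Hg i; rewrite -ler_pdivlMr //; apply: absD_le; rewrite ler_pdivlMr. Qed.
Lemma bnd_sum (I : eqType) (s : seq I) (F : I -> pser C) A : 0 <= A ->
  (forall i, i \in s -> bnd r (F i) A) -> bnd r (\sum_(i <- s) F i) A.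
Proof.
move=> A_ge0 HF; rewrite big_seq; elim/big_rec: _ => [i | i x s_i IH].
  by rewrite ps0 abs0 mul0r.
by apply: bndD IH; apply: HF.
Qed.
Lemma bndX f A n : 0 <= A -> bnd r f A -> bnd r (f ^+ n) (A ^+ n).
Proof.
move=> A_ge0 Hf; elim: n => [|n IHn]; last by rewrite !exprS; apply: bndM; rewrite ?exprn_ge0.
move=> i; rewrite expr0 /=; change (abs ((i == 0%N)%:R) * r ^+ i <= 1).
by case: i => [|i] /=; rewrite ?abs1 ?abs0 ?mul0r ?mul1r.
Qed.

Lemma convM f g : conv r f -> conv r g -> conv r (f * g).
Proof.
move=> Hf Hg eps eps_gt0.
have [A A_gt0 HA] := conv_bnd Hf; have [B B_gt0 HB] := conv_bnd Hg.
pose d := eps / 2%:R; have d_gt0 : 0 < d by rewrite divr_gt0 ?ltr0n.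
have [N HN] := Hf _ (divr_gt0 d_gt0 B_gt0); have [N' HN'] := Hg _ (divr_gt0 d_gt0 A_gt0).
exists (N + N')%N => n le_n; apply: (@le_lt_trans _ _ d); last first.
  by rewrite ltr_pdivrMr ?ltr0n // ltr_pMr // ltr1n.
rewrite -[d]mul1r; apply: psM_bnd; last by rewrite mul1r ltW.
move=> i j eq_n; rewrite mul1r; have [le_Ni | lt_iN] := leqP N i.
  rewrite -[leRHS](divfK (lt0r_neq0 B_gt0)); apply: ler_pM; rewrite ?mulr_ge0 ?abs_ge0 //.
  exact: ltW (HN _ le_Ni).
rewrite mulrC -[leRHS](divfK (lt0r_neq0 A_gt0)); apply: ler_pM; rewrite ?mulr_ge0 ?abs_ge0 //.
by apply/ltW/HN'; move: le_n; rewrite -eq_n; move: lt_iN; lia.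
Qed.

Lemma conv_poly p : conv r (of_poly p).
Proof. by move=> eps eps_gt0; exists (size p) => i le_i; rewrite /of_poly nth_default // abs0 mul0r. Qed.
Lemma conv0 : conv r 0. Proof. by rewrite -(rmorph0 (@of_poly C)); apply: conv_poly. Qed.
Lemma conv1 : conv r 1. Proof. by rewrite -(rmorph1 (@of_poly C)); apply: conv_poly. Qed.
Lemma convX f n : conv r f -> conv r (f ^+ n).
Proof. by move=> Hf; elim: n => [|n IHn]; rewrite ?exprS; [apply: conv1 | apply: convM]. Qed.
Lemma conv_sum (I : eqType) (s : seq I) (P : pred I) (F : I -> pser C) :
  (forall i, i \in s -> P i -> conv r (F i)) -> conv r (\sum_(i <- s | P i) F i).
Proof.
move=> HF; rewrite big_seq_cond; elim/big_rec: _ => [|i x /andP[s_i Pi] IH]; first exact: conv0.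
by apply: convD IH; apply: HF.
Qed.
Lemma conv_prod (I : Type) (s : seq I) (P : pred I) (F : I -> pser C) :
  (forall i, P i -> conv r (F i)) -> conv r (\prod_(i <- s | P i) F i).
Proof.
move=> HF; elim/big_rec: _ => [|i x Pi IH]; first exact: conv1.
by apply: convM IH; apply: HF.
Qed.
Lemma conv_mmap n (w : 'I_n -> pser C) (P : {mpoly {poly C}[n]}) :
  (forall v, conv r (w v)) -> conv r (mmap (@of_poly C) w P).
Proof.
move=> Hw; apply: conv_sum => m _ _; apply: convM; first exact: conv_poly.
by apply: conv_prod => i _; apply: convX.
Qed.

Lemma ps_linM z h i : (of_poly ('X - z%:P) * h) i = (if i is j.+1 then h j else 0) - z * h i.
Proof. by rewrite rmorphB mulrBl psB psXM psCM. Qed.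

(** Iterating [H k = G k.+1 + z * H k.+1] expresses [H i] through the coefficients of [G] beyond
    [i], up to a remainder [z ^+ n * H (i + n)], which tends to zero because [abs z <= r'] and [H]
    converges on the disc of radius [r']. Estimates for [G] on the larger disc of radius [r] thus
    pass to [H]. *)
Lemma lin_quot_tail r' G H z B i : 0 < r' -> abs z <= r' -> r' <= r -> 0 < B -> conv r' H ->
  G = of_poly ('X - z%:P) * H -> (forall j, (i < j)%N -> abs (G j) * r ^+ j <= B) ->
  abs (H i) * r ^+ i.+1 <= B.
Proof.
move=> r'_gt0 le_zr' le_r'r B_gt0 cH defG HG.
have le_zr := le_trans le_zr' le_r'r.
have HH k : H k = G k.+1 + z * H k.+1 by rewrite defG ps_linM subrK.
have step n : abs (H i) * r ^+ i.+1 <= Num.max B (abs z ^+ n * abs (H (i + n)%N) * r ^+ i.+1).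
  elim: n => [|n IHn]; first by rewrite expr0 mul1r addn0 le_max lexx orbT.
  apply: le_trans IHn _; rewrite ge_max le_max lexx /=.
  rewrite -ler_pdivlMr // -(absX z) -absM HH mulrDr; apply: le_trans (absD _ _) _.
  rewrite ge_max; apply/andP; split; rewrite ler_pdivlMr // le_max.
    apply/orP; left; apply: le_trans (HG (i + n).+1 _); last by rewrite ltnS leq_addr.
    rewrite absM mulrAC mulrC ler_wpM2l ?abs_ge0 // absX -addSn exprD mulrC.
    by apply: ler_wpM2l => //; rewrite lerXn2r ?nnegrE ?abs_ge0 // ltW.
  by apply/orP; right; rewrite mulrA absM absM absX -exprSr addnS.
have d_gt0 : 0 < B / r ^+ i.+1 * r' ^+ i by rewrite mulr_gt0 ?divr_gt0 ?exprn_gt0.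
have [N HN] := cH _ d_gt0; apply: le_trans (step N) _; rewrite ge_max lexx /=.
rewrite -ler_pdivlMr // -(ler_pM2r (exprn_gt0 i r'_gt0)).
apply: le_trans (ltW (HN (i + N)%N _)); last exact: leq_addl.
rewrite mulrAC mulrC ler_wpM2l ?abs_ge0 // addnC exprD ler_wpM2r ?exprn_ge0 ?(ltW r'_gt0) //.
by rewrite lerXn2r ?nnegrE ?abs_ge0 // ltW.
Qed.

Lemma lin_quot_bnd G H z B : abs z <= r -> 0 < B -> conv r H ->
  G = of_poly ('X - z%:P) * H -> bnd r G B -> forall i, abs (H i) * r ^+ i.+1 <= B.
Proof.
move=> le_zr B_gt0 cH defG HG i.
by apply: (lin_quot_tail (r' := r) (G := G) (z := z)) => // j _.
Qed.

Lemma lin_quot_conv r' G H z : 0 < r' -> abs z <= r' -> r' <= r -> conv r' H ->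
  G = of_poly ('X - z%:P) * H -> conv r G -> conv r H.
Proof.
move=> r'_gt0 le_z le_r cH defG cG eps eps_gt0.
have d_gt0 : 0 < eps / 2%:R * r by rewrite mulr_gt0 ?divr_gt0 ?ltr0n.
have [N HN] := cG _ d_gt0; exists N => i le_i.
have /(lin_quot_tail (i := i) r'_gt0 le_z le_r d_gt0 cH defG) : forall j, (i < j)%N ->
    abs (G j) * r ^+ j <= eps / 2%:R * r.
  by move=> j lt_ij; apply/ltW/HN/(leq_trans le_i)/ltnW.
rewrite exprSr mulrA ler_pM2r // => le_d; apply: le_lt_trans le_d _.
by rewrite ltr_pdivrMr ?ltr0n // ltr_pMr // ltr1n.
Qed.

(** Induction on the zeros. With [P] the product over the other zeros, [P] is [P.[z]] plus a
    multiple of ['X - z], and [P.[z]] is invertible because the zeros are distinct; so a series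
    divisible by [P] and by ['X - z] is divisible by their product. *)
Lemma prod_quot_conv (zs : seq C) G : uniq zs -> (forall z, z \in zs -> abs z <= r) -> conv r G ->
  (forall z, z \in zs -> exists2 H, conv r H & G = of_poly ('X - z%:P) * H) ->
  exists2 H, conv r H & G = of_poly (\prod_(z <- zs) ('X - z%:P)) * H.
Proof.
elim: zs => [|z zs IHzs] /=; first by exists G; rewrite // big_nil rmorph1 mul1r.
case/andP=> zs'z uzs le_zs cG divG; have [| |H cH defG] := IHzs uzs _ cG.
- by move=> w zs_w; apply: le_zs; rewrite inE zs_w orbT.
- by move=> w zs_w; apply: divG; rewrite inE zs_w orbT.
have [|H' cH' defG'] := divG z; first exact: mem_head.
set P := \prod_(z <- zs) _ in defG.
have nzP : P.[z] != 0.
  by rewrite horner_prod prodf_seq_neq0; apply/allP => w zs_w /=; rewrite !hornerE subr_eq0;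
    apply: contraNneq zs'z => ->.
have /factor_theorem [Q HQ] : root (P - P.[z]%:P) z by rewrite /root !hornerE subrr.
pose c := of_poly (P.[z]^-1)%:P.
exists (c * (H' - of_poly Q * H)).
  apply: convM; first exact: conv_poly.
  by apply: convB => //; apply: convM => //; apply: conv_poly.
rewrite big_cons mulrC -/P [of_poly (_ * P)]rmorphM.
have cP : of_poly P.[z]%:P * c = 1 by rewrite -rmorphM -polyCM mulfV // polyC1 rmorph1.
have E : of_poly P = of_poly P.[z]%:P + of_poly Q * of_poly ('X - z%:P).
  by rewrite -[of_poly Q * _]rmorphM -HQ rmorphB /= addrC subrK.
have EH : of_poly P.[z]%:P * H = of_poly ('X - z%:P) * (H' - of_poly Q * H).
  rewrite mulrBr -defG' defG E; ring.
have HE : H = c * (of_poly ('X - z%:P) * (H' - of_poly Q * H)).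
  by rewrite -EH mulrA [c * _]mulrC cP mul1r.
rewrite {1}defG {1}HE; ring.
Qed.

(** The Schwarz lemma: by [lin_quot_bnd], every zero in the disc gains a factor [r] in the bound on
    the Gauss norm. *)
Lemma prod_quot_bnd (zs : seq C) G H B : (forall z, z \in zs -> abs z <= r) -> conv r H -> 0 < B ->
  G = of_poly (\prod_(z <- zs) ('X - z%:P)) * H -> bnd r G B ->
  bnd r H (B / r ^+ size zs).
Proof.
elim: zs G B => [|z zs IHzs] G B le_zs cH B_gt0.
  by rewrite big_nil rmorph1 mul1r divr1 => ->.
rewrite big_cons rmorphM -mulrA => defG HG; rewrite /= exprS invfM mulrA.
apply: (IHzs (of_poly (\prod_(z <- zs) ('X - z%:P)) * H)) => //.
- by move=> w zs_w; apply: le_zs; rewrite inE zs_w orbT.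
- exact: divr_gt0.
move=> i; rewrite ler_pdivlMr // -mulrA -exprSr; apply: lin_quot_bnd defG HG i => //.
  by apply: le_zs; apply: mem_head.
by apply: convM => //; apply: conv_poly.
Qed.

(* [f] takes the value [v] at [z] when [f - v] is [X - z] times a series converging on the same disc;
   no infinite sum has to be formed. *)
Definition evat (z : C) (f : pser C) (v : C) : Prop :=
  exists2 h, conv r h & f = of_poly v%:P + of_poly ('X - z%:P) * h.

Section EvalAt.
Variable z : C.
Notation ev := (evat z).

Lemma evat_poly p : ev (of_poly p) p.[z].
Proof.
have /factor_theorem [s Hs] : root (p - p.[z]%:P) z by rewrite /root !hornerE subrr.
exists (of_poly s); first exact: conv_poly.
by rewrite -rmorphM -rmorphD mulrC -Hs /= addrC subrK.
Qed.

Lemma evat1 : ev 1 1.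
Proof. by rewrite -(rmorph1 (@of_poly C)) -[X in ev _ X](hornerC 1 z); apply: evat_poly. Qed.
Lemma evat0 : ev 0 0.
Proof. by rewrite -(rmorph0 (@of_poly C)) -[X in ev _ X](hornerC 0 z); apply: evat_poly. Qed.

Lemma evatD f g v v' : ev f v -> ev g v' -> ev (f + g) (v + v').
Proof.
move=> [h ch ->] [h' ch' ->]; exists (h + h'); first exact: convD.
by rewrite polyCD [of_poly (v%:P + _)]rmorphD mulrDr addrACA.
Qed.

Lemma evatM f g v v' : ev f v -> ev g v' -> ev (f * g) (v * v').
Proof.
move=> [h ch ->] [h' ch' ->].
exists (of_poly v%:P * h' + h * of_poly v'%:P + h * (of_poly ('X - z%:P) * h')).
  by do !apply: convD; do ?apply: convM => //; apply: conv_poly.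
by rewrite polyCM [of_poly (v%:P * _)]rmorphM /=; ring.
Qed.

Lemma evatX f v n : ev f v -> ev (f ^+ n) (v ^+ n).
Proof. by move=> Hf; elim: n => [|n IHn]; rewrite ?exprS; [apply: evat1 | apply: evatM]. Qed.

Lemma evat_sum (I : Type) (s : seq I) (P : pred I) (F : I -> pser C) V :
  (forall i, P i -> ev (F i) (V i)) -> ev (\sum_(i <- s | P i) F i) (\sum_(i <- s | P i) V i).
Proof. by move=> HF; elim/big_rec2: _ => [|i x y Pi IH]; [apply: evat0 | apply: evatD; auto]. Qed.

Lemma evat_prod (I : Type) (s : seq I) (P : pred I) (F : I -> pser C) V :
  (forall i, P i -> ev (F i) (V i)) -> ev (\prod_(i <- s | P i) F i) (\prod_(i <- s | P i) V i).
Proof. by move=> HF; elim/big_rec2: _ => [|i x y Pi IH]; [apply: evat1 | apply: evatM; auto]. Qed.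

Lemma evat_mmap n (w : 'I_n -> pser C) val (P : {mpoly {poly C}[n]}) :
  (forall v, ev (w v) (val v)) ->
  ev (mmap (@of_poly C) w P) (mmap (fun p : {poly C} => p.[z]) val P).
Proof.
move=> Hw; apply: evat_sum => m _; apply: evatM; first exact: evat_poly.
by apply: evat_prod => i _; apply: evatX.
Qed.

Hypothesis le_zr : abs z <= r.

(** From [v + (X - z) h = 0] follow [v = z * h 0] and [h i = z * h i.+1], so
    [abs v = abs (h i) * abs z ^+ i.+1] for every [i], and this tends to zero. Values are therefore
    unique. *)
Lemma evat0_eq v : ev 0 v -> v = 0.
Proof.
case=> h ch eq0.
have H i : 0 = v%:P`_i + ((if i is j.+1 then h j else 0) - z * h i).
  by have := congr1 (fun f : pser C => f i) eq0; rewrite psD ps_linM.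
have h0 : v = z * h 0%N.
  by apply/eqP; rewrite -subr_eq0 (H 0%N) coefC eqxx sub0r.
have hS i : h i = z * h i.+1.
  by apply/eqP; rewrite -subr_eq0 (H i.+1) coefC add0r.
have Hz i : abs v = abs (h i) * abs z ^+ i.+1.
  elim: i => [|i IHi]; first by rewrite h0 absM mulrC.
  by rewrite IHi hS absM [abs z ^+ i.+2]exprS mulrCA mulrA.
apply/eqP; rewrite -abs_eq0; apply/contraT => nz_v.
have v_gt0 : 0 < abs v by rewrite lt_def nz_v abs_ge0.
have [N HN] := ch _ (divr_gt0 v_gt0 r_gt0); have := HN N (leqnn _).
rewrite ltr_pdivlMr // -mulrA -exprSr (Hz N) ltNge => /negP[].
by apply: ler_wpM2l; rewrite ?abs_ge0 // lerXn2r // nnegrE ?abs_ge0 // ltW.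
Qed.

End EvalAt.

Definition ucvg (F : nat -> pser C) (f : pser C) : Prop :=
  forall eps, 0 < eps -> exists N, forall m, (N <= m)%N -> bnd r (F m - f) eps.

Lemma ucvg_unique F f f' : ucvg F f -> ucvg F f' -> f = f'.
Proof.
move=> Hf Hf'; apply/funext => i; apply: (@cvg_unique (fun m => F m i)) => eps eps_gt0.
  have eps'_gt0 : 0 < eps / 2%:R * r ^+ i by rewrite mulr_gt0 ?divr_gt0 ?ltr0n.
  have [N HN] := Hf _ eps'_gt0; exists N => m /HN /(_ i); rewrite ler_pM2r // psB => Hle.
  by apply: le_lt_trans Hle _; rewrite ltr_pdivrMr ?ltr0n // ltr_pMr // ltr1n.
have eps'_gt0 : 0 < eps / 2%:R * r ^+ i by rewrite mulr_gt0 ?divr_gt0 ?ltr0n.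
have [N HN] := Hf' _ eps'_gt0; exists N => m /HN /(_ i); rewrite ler_pM2r // psB => Hle.
by apply: le_lt_trans Hle _; rewrite ltr_pdivrMr ?ltr0n // ltr_pMr // ltr1n.
Qed.

Lemma ucvg_conv F f : (forall m, conv r (F m)) -> ucvg F f -> conv r f.
Proof.
move=> cF Hf eps eps_gt0; have d_gt0 : 0 < eps / 2%:R by rewrite divr_gt0 ?ltr0n.
have [N HN] := Hf _ d_gt0; have [M HM] := cF N _ eps_gt0.
exists M => i /HM lt_i; have := HN N (leqnn _) i; rewrite psB => le_i.
rewrite -ltr_pdivlMr // -[f i](subrK (F N i)); apply: absD_lt; rewrite ltr_pdivlMr //.
rewrite -opprB absN; apply: le_lt_trans le_i _.
by rewrite ltr_pdivrMr ?ltr0n // ltr_pMr // ltr1n.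
Qed.

Lemma ucvg_shift F f k : ucvg F f -> ucvg (fun m => F (m + k)%N) f.
Proof.
by move=> Hf eps /Hf [N HN]; exists N => m le_m; apply: HN; rewrite (leq_trans le_m) ?leq_addr.
Qed.

Lemma ucvg_ext F F' f : (forall m, F m = F' m) -> ucvg F f -> ucvg F' f.
Proof. by move=> eqF Hf eps /Hf [N HN]; exists N => m /HN; rewrite eqF. Qed.

Lemma ucvg_cst f : ucvg (fun=> f) f.
Proof. by move=> eps eps_gt0; exists 0%N => m _ i; rewrite subrr ps0 abs0 mul0r ltW. Qed.

Lemma ucvgD F G f g : ucvg F f -> ucvg G g -> ucvg (fun m => F m + G m) (f + g).
Proof.
move=> Hf Hg eps eps_gt0; have [N HN] := Hf _ eps_gt0; have [N' HN'] := Hg _ eps_gt0.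
exists (maxn N N') => m; rewrite geq_max => /andP[/HN Hm /HN' Hm'].
by rewrite opprD addrACA; apply: bndD.
Qed.

Lemma ucvgM F G f g : (forall m, conv r (F m)) -> (forall m, conv r (G m)) ->
  ucvg F f -> ucvg G g -> ucvg (fun m => F m * G m) (f * g).
Proof.
move=> cF cG Hf Hg eps eps_gt0.
have [A A_gt0 HA] := conv_bnd (ucvg_conv cF Hf).
have [B B_gt0 HB] := conv_bnd (ucvg_conv cG Hg).
have [N HN] := Hf _ (divr_gt0 eps_gt0 B_gt0).
have [M HM] := Hg _ (divr_gt0 eps_gt0 A_gt0); have [L HL] := Hg _ B_gt0.
exists (maxn N (maxn M L)) => m; rewrite !geq_max => /and3P[/HN Hm /HM Hm' /HL Hl].
have -> : F m * G m - f * g = (F m - f) * G m + f * (G m - g) by ring.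
have HGB : bnd r (G m) B by rewrite -[G m](subrK g); apply: bndD.
apply: bndD.
  rewrite -[eps](divfK (lt0r_neq0 B_gt0)); apply: bndM => //; last exact: ltW.
  exact: ltW (divr_gt0 _ _).
rewrite mulrC -[eps](divfK (lt0r_neq0 A_gt0)); apply: bndM => //; last exact: ltW.
exact: ltW (divr_gt0 _ _).
Qed.

Hypothesis Hcompl : complete_abs abs.

Lemma ucvg_complete F : (forall m, conv r (F m)) ->
  (forall eps, 0 < eps -> exists N, forall m k, (N <= m)%N -> (N <= k)%N -> bnd r (F m - F k) eps) ->
  exists2 f, ucvg F f & conv r f.
Proof.
move=> cF HF.
have cvF i : exists l, cvg (fun m => F m i) l.
  apply: Hcompl => eps eps_gt0.
  have eps'_gt0 : 0 < eps / 2%:R * r ^+ i by rewrite mulr_gt0 ?divr_gt0 ?ltr0n.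
  have [N HN] := HF _ eps'_gt0; exists N => m k le_m le_k.
  have := HN m k le_m le_k i; rewrite ler_pM2r // psB => Hle.
  by apply: le_lt_trans Hle _; rewrite ltr_pdivrMr ?ltr0n // ltr_pMr // ltr1n.
have [f Hf] := choice cvF; have ucF : ucvg F f; last by exists f => //; apply: ucvg_conv ucF.
move=> eps eps_gt0; have [N HN] := HF _ eps_gt0; exists N => m le_m i.
have eps'_gt0 : 0 < eps / r ^+ i by rewrite divr_gt0.
have [M HM] := Hf i _ eps'_gt0.
rewrite psB -ler_pdivlMr // -[F m i](subrK (F (maxn M N) i)) -addrA; apply: absD_le.
  by rewrite ler_pdivlMr //; apply: HN; rewrite ?leq_maxr.
by apply: ltW; apply: HM; rewrite leq_maxl.
Qed.

Lemma bnd_const c : bnd r (of_poly c%:P) (abs c).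
Proof.
by case=> [|i]; rewrite /of_poly coefC /= ?expr0 ?mulr1 // abs0 mul0r abs_ge0.
Qed.

Lemma ucvg_const V l : cvg V l -> ucvg (fun m => of_poly (V m)%:P) (of_poly l%:P).
Proof.
move=> Hl eps /Hl [N HN]; exists N => m /HN lt_m i.
by rewrite -rmorphB -polyCB; apply: le_trans (bnd_const _ i) (ltW _).
Qed.

(** Division by [X - z] is bounded for the Gauss norm ([lin_quot_bnd]), so the quotients that
    witness the values of the [F m] form a Cauchy sequence; their limit witnesses the value of
    [f]. *)
Lemma evat_lim z F f V l : abs z <= r -> (forall m, evat z (F m) (V m)) ->
  ucvg F f -> cvg V l -> evat z f l.
Proof.
move=> le_zr evF Hf Hl.
have exH m : exists h, conv r h /\ F m = of_poly (V m)%:P + of_poly ('X - z%:P) * h.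
  by have [h ch eqF] := evF m; exists h.
have [H /all_and2[cH eqF]] := choice exH.
have HV := ucvg_const Hl.
have [|h Hh ch] := ucvg_complete cH.
  move=> eps eps_gt0; have d_gt0 : 0 < eps * r by apply: mulr_gt0.
  have [N HN] := Hf _ d_gt0; have [M HM] := HV _ d_gt0.
  exists (maxn N M) => m k; rewrite !geq_max => /andP[Nm Mm] /andP[Nk Mk] i.
  rewrite -(ler_pM2r r_gt0) -mulrA -exprSr.
  pose v x := of_poly (V x)%:P - of_poly l%:P.
  have bN x : bnd r (- x) (eps * r) <-> bnd r x (eps * r).
    by split=> Hx j; have := Hx j; rewrite psN absN.
  apply: (@lin_quot_bnd ((F m - f) + - (F k - f) + (v k - v m)) _ z) => //.
  - exact: convB.
  - by rewrite /v !eqF; ring.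
  - apply: bndD; first by apply: bndD; [exact: HN | apply/bN; exact: HN].
    by apply: bndD; [exact: HM | apply/bN; exact: HM].
exists h => //; apply: (ucvg_unique Hf).
apply: (@ucvg_ext (fun m => of_poly (V m)%:P + of_poly ('X - z%:P) * H m)) => //.
apply: ucvgD => //; apply: ucvgM => //; [move=> _; apply: conv_poly | exact: ucvg_cst].
Qed.

End Radius.
End Ultrametric.

(** * Algebraic elements *)

Section Subfields.
Variable C : fieldType.

(** Subfields stay predicates, as [in_K] and [in_Kbar] are; [sf_type] turns one into a field type
    when matrix ranks or the theory of algebraic elements are called for. *)
Record is_subfield (F : C -> Prop) : Prop := IsSubfield {
  sf1 : F 1;
  sfB : forall x y, F x -> F y -> F (x - y);
  sfM : forall x y, F x -> F y -> F (x * y);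
  sfV : forall x, F x -> F x^-1 }.

Section Closure.
Variables (F : C -> Prop) (sF : is_subfield F).

Lemma sf0 : F 0. Proof. by rewrite -(subrr 1); apply: sfB => //; apply: sf1. Qed.
Lemma sfN x : F x -> F (- x). Proof. by move=> Fx; rewrite -sub0r; apply: sfB => //; apply: sf0. Qed.
Lemma sfD x y : F x -> F y -> F (x + y).
Proof. by move=> Fx Fy; rewrite -[y]opprK; apply: sfB => //; apply: sfN. Qed.
Lemma sfX x n : F x -> F (x ^+ n).
Proof. by move=> Fx; elim: n => [|n IHn]; rewrite ?exprS; [apply: sf1 | apply: sfM]. Qed.
Lemma sf_sum (I : Type) (r : seq I) (P : pred I) (G : I -> C) :
  (forall i, P i -> F (G i)) -> F (\sum_(i <- r | P i) G i).
Proof. by move=> HG; elim/big_rec: _ => [|i x Pi Fx]; [apply: sf0 | apply: sfD; auto]. Qed.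

Definition pOver (a : {poly C}) : Prop := forall i, F a`_i.

Lemma pOverC c : F c -> pOver c%:P.
Proof. by move=> Fc i; rewrite coefC; case: ifP => // _; apply: sf0. Qed.
Lemma pOver0 : pOver 0. Proof. by rewrite -polyC0; apply/pOverC/sf0. Qed.
Lemma pOver1 : pOver 1. Proof. by rewrite -polyC1; apply: pOverC; apply: sf1. Qed.
Lemma pOverX : pOver 'X.
Proof. by move=> i; rewrite coefX; case: (i == 1%N); [apply: sf1 | apply: sf0]. Qed.
Lemma pOverB a b : pOver a -> pOver b -> pOver (a - b).
Proof. by move=> Ha Hb i; rewrite coefB; apply: sfB. Qed.
Lemma pOverD a b : pOver a -> pOver b -> pOver (a + b).
Proof. by move=> Ha Hb i; rewrite coefD; apply: sfD. Qed.
Lemma pOverN a : pOver a -> pOver (- a).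
Proof. by move=> Ha i; rewrite coefN; apply: sfN. Qed.
Lemma pOverM a b : pOver a -> pOver b -> pOver (a * b).
Proof. by move=> Ha Hb i; rewrite coefM; apply: sf_sum => j _; apply: sfM. Qed.
Lemma pOver_exp a n : pOver a -> pOver (a ^+ n).
Proof. by move=> Ha; elim: n => [|n IHn]; rewrite ?exprS; [apply: pOver1 | apply: pOverM]. Qed.
Lemma pOver_sum (I : Type) (r : seq I) (P : pred I) (G : I -> {poly C}) :
  (forall i, P i -> pOver (G i)) -> pOver (\sum_(i <- r | P i) G i).
Proof. by move=> HG; elim/big_rec: _ => [|i x Pi Fx]; [apply: pOver0 | apply: pOverD; auto]. Qed.
Lemma pOver_horner a x : pOver a -> F x -> F a.[x].
Proof.
by move=> Ha Fx; rewrite horner_coef; apply: sf_sum => i _; apply: sfM => //; apply: sfX.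
Qed.
Lemma pOver_poly n (E : nat -> C) : (forall i, F (E i)) -> pOver (\poly_(i < n) E i).
Proof. by move=> HE i; rewrite coef_poly; case: ifP => // _; apply: sf0. Qed.

End Closure.

Definition algp (F : C -> Prop) (x : C) : Prop :=
  exists P : {poly C}, P != 0 /\ (forall i, F P`_i) /\ root P x.

Section Algebraic.
Variables (F : C -> Prop) (sF : is_subfield F).

Definition sf_pred : {pred C} := fun x => `[< F x >].
Lemma sf_pred_closed : divring_closed sf_pred.
Proof.
split=> [|x y /asboolP Fx /asboolP Fy|x y /asboolP Fx /asboolP Fy]; apply/asboolP.
- exact: sf1.
- exact: sfB.
- by apply: sfM => //; apply: sfV.
Qed.
HB.instance Definition _ := GRing.isDivringClosed.Build C sf_pred sf_pred_closed.
Definition sf_type := {x : C | x \in sf_pred}.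
HB.instance Definition _ := Choice.on sf_type.
HB.instance Definition _ := SubChoice.on sf_type.
HB.instance Definition _ := [SubChoice_isSubIntegralDomain of sf_type by <:].
HB.instance Definition _ := [SubIntegralDomain_isSubField of sf_type by <:].

Lemma algpE x : algp F x <-> algebraicOver (val : sf_type -> C) x.
Proof.
split=> [[P [nzP [FP rPx]]] | [P nzP rPx]]; last first.
  exists (map_poly val P); rewrite map_poly_eq0; split=> //; split=> // i.
  by rewrite coef_map; apply/asboolP; exact: (valP P`_i).
have FP' i : P`_i \in sf_pred by apply/asboolP.
pose P' : {poly sf_type} := \poly_(i < size P) Sub P`_i (FP' i).
have mapP' : map_poly val P' = P.
  apply/polyP => i; rewrite coef_map coef_poly; case: ltnP => [_ | le_i] //=.
  by rewrite nth_default.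
exists P'; last by rewrite mapP'.
by rewrite -(map_poly_eq0 (val : {rmorphism sf_type -> C})) mapP'.
Qed.

Lemma algp_subfield : is_subfield (algp F).
Proof.
split=> [|x y /algpE ax /algpE ay|x y /algpE ax /algpE ay|x /algpE ax]; apply/algpE.
- exact: algebraic1.
- exact: algebraic_sub.
- exact: algebraic_mul.
- exact: algebraic_inv.
Qed.

Lemma algp_base x : F x -> algp F x.
Proof.
move=> Fx; exists ('X - x%:P); split; first by rewrite polyXsubC_eq0.
split; last by rewrite root_XsubC.
by apply: pOverB => //; [apply: pOverX | apply: pOverC].
Qed.

(** If [P] kills [x ^+ n], then [P \Po 'X^n] kills [x]. For exponents [q ^ n] this is the
    perfectness that lets twists of coefficients be undone inside [Kbar]. *)
Lemma algp_root x n : (0 < n)%N -> algp F (x ^+ n) -> algp F x.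
Proof.
move=> n_gt0 [P [nzP [FP rPx]]]; exists (P \Po 'X^n); split; last split.
- by rewrite comp_poly_eq0 // size_polyXn ltnS.
- move=> i; rewrite coef_comp_poly_Xn //; case: ifP => _ //; exact: sf0.
- by rewrite /root horner_comp hornerXn.
Qed.

Lemma algp_monic x : algp F x -> exists d (c : nat -> C),
  (forall i, F (c i)) /\ x ^+ d = \sum_(i < d) c i * x ^+ i.
Proof.
case=> P [nzP [FP /eqP rPx]]; exists (size P).-1, (fun i => - (P`_i / lead_coef P)); split.
  by move=> i; apply: (sfN sF); apply: (sfM sF); [|apply: (sfV sF)]; rewrite ?lead_coefE; apply: FP.
have nz_l : lead_coef P != 0 by rewrite lead_coef_eq0.
move: rPx; rewrite horner_coef -[size P in X in X -> _]prednK ?size_poly_gt0 // big_ord_recr /=.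
rewrite -lead_coefE => /eqP; rewrite addrC addr_eq0 => /eqP H.
apply: (mulfI nz_l); rewrite H mulr_sumr -sumrN; apply: eq_bigr => i _.
by rewrite -mulNr mulrA mulrN mulrCA mulfV // mulr1.
Qed.

(** A rank count over [sf_type], so that the solution lies in [F] and not only in [C]. With [F]
    equal to [Fq] it yields Siegel's lemma, with [F] equal to [Kbar] the bound on the transcendence
    degree. *)
Lemma subfield_kernel (I J : finType) (A : I -> J -> C) :
  (forall i j, F (A i j)) -> (#|J| < #|I|)%N ->
  exists v : I -> C, (forall i, F (v i)) /\ (exists i, v i != 0) /\
    forall j, \sum_i v i * A i j = 0.
Proof.
move=> FA lt_JI; have FA' i j : A i j \in sf_pred by apply/asboolP.
pose M : 'M[sf_type]_(#|I|, #|J|) :=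
  \matrix_(i, j) Sub (A (enum_val i) (enum_val j)) (FA' _ _).
have : kermx M != 0.
  by rewrite -mxrank_eq0 mxrank_ker subn_eq0 -ltnNge (leq_ltn_trans (rank_leq_col M)).
case/matrix0Pn => k [l nz_kl]; pose w := row k (kermx M).
have wM : w *m M = 0 by rewrite -row_mul mulmx_ker row0.
exists (fun i => val (w 0 (enum_rank i))); split; first by move=> i; apply/asboolP/(valP (w 0 _)).
split.
  exists (enum_val l); rewrite enum_valK mxE; apply: contra nz_kl => /eqP val0.
  exact/eqP/val_inj.
move=> j; have := congr1 (fun B : 'rV[sf_type]_#|J| => val (B 0 (enum_rank j))) wM.
rewrite mxE (rmorph_sum (val : {rmorphism sf_type -> C})) mxE /= => wM0.
rewrite -[RHS]wM0 (reindex (@enum_val _ I)) /=.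
  by apply: eq_bigr => i _; rewrite enum_valK !mxE /= enum_rankK.
exact/onW_bij/enum_val_bij.
Qed.

End Algebraic.
End Subfields.

(** * The fields Fq, K and Kbar inside C *)

Section FunctionField.
Variables (C : closedFieldType) (p e : nat) (chC : p \in [pchar C]).
Local Notation q := (p ^ e)%N.
Variable theta : C.

Lemma Fq_subfield : is_subfield (in_Fq q : C -> Prop).
Proof.
split=> [|x y Fx Fy|x y Fx Fy|x Fx]; rewrite /in_Fq; first exact: expr1n.
- by rewrite -[_ ^+ _]/(frob e chC (x - y)) rmorphB; congr (_ - _).
- by rewrite exprMn Fx Fy.
- by rewrite exprVn Fx.
Qed.

Lemma K_subfield : is_subfield (in_K q theta).
Proof.
have sFq := Fq_subfield; split.
- exists 1, 1; rewrite hornerC divr1 oner_eq0; do !split => //; exact: pOver1.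
- move=> _ _ [a [b [Ha [Hb [nzb ->]]]]] [a' [b' [Ha' [Hb' [nzb' ->]]]]].
  exists (a * b' - a' * b), (b * b'); rewrite !hornerE mulf_neq0 //.
  split; first by apply: pOverB => //; apply: pOverM.
  split; first exact: pOverM.
  by split=> //; field; rewrite nzb nzb'.
- move=> _ _ [a [b [Ha [Hb [nzb ->]]]]] [a' [b' [Ha' [Hb' [nzb' ->]]]]].
  exists (a * a'), (b * b'); rewrite !hornerE mulf_neq0 //.
  split; first exact: pOverM.
  split; first exact: pOverM.
  by split=> //=; field; rewrite nzb nzb'.
- move=> _ [a [b [Ha [Hb [nzb ->]]]]]; have [a0 | nza] := eqVneq a.[theta] 0.
    rewrite a0 mul0r invr0; exists 0, 1; rewrite !hornerC mul0r oner_eq0.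
    by split; [exact: pOver0 | split=> //; exact: pOver1].
  by exists b, a; rewrite invf_div.
Qed.

Lemma Kbar_subfield : is_subfield (in_Kbar q theta).
Proof. exact: algp_subfield K_subfield. Qed.

Lemma Fq_K x : in_Fq q x -> in_K q theta x.
Proof.
move=> Fx; exists x%:P, 1; rewrite !hornerC divr1 oner_eq0; split; last by split=> //; exact: (pOver1 Fq_subfield).
exact: (pOverC Fq_subfield Fx).
Qed.

Lemma theta_K : in_K q theta theta.
Proof.
exists 'X, 1; rewrite hornerC hornerX divr1 oner_eq0; split; first exact: (pOverX Fq_subfield).
by split=> //; exact: (pOver1 Fq_subfield).
Qed.

Lemma K_Kbar x : in_K q theta x -> in_Kbar q theta x.
Proof. exact: (algp_base K_subfield). Qed.

Lemma theta_Kbar : in_Kbar q theta theta. Proof. exact/K_Kbar/theta_K. Qed.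
Lemma Fq_Kbar x : in_Fq q x -> in_Kbar q theta x. Proof. by move/Fq_K/K_Kbar. Qed.

Lemma Kbar_root x n : (0 < n)%N -> in_Kbar q theta (x ^+ n) -> in_Kbar q theta x.
Proof. exact: (algp_root K_subfield). Qed.

End FunctionField.

(** * Finite algebras of algebraic elements *)

Section Span.
Variables (C : fieldType) (F : C -> Prop) (sF : is_subfield F).

Definition fspan (s : seq C) (x : C) : Prop :=
  exists2 c : nat -> C, (forall i, F (c i)) & x = \sum_(i < size s) c i * s`_i.

Definition findep (s : seq C) : Prop :=
  forall c : nat -> C, (forall i, F (c i)) -> \sum_(i < size s) c i * s`_i = 0 ->
  forall i, (i < size s)%N -> c i = 0.

Lemma fspan0 s : fspan s 0.
Proof. by exists (fun=> 0) => [_|]; [apply: sf0 | rewrite big1 // => i _; rewrite mul0r]. Qed.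
Lemma fspanD s x y : fspan s x -> fspan s y -> fspan s (x + y).
Proof.
move=> [c Fc ->] [c' Fc' ->]; exists (fun i => c i + c' i); first by move=> i; apply: sfD.
by rewrite -big_split; apply: eq_bigr => i _; rewrite mulrDl.
Qed.
Lemma fspanZ s k x : F k -> fspan s x -> fspan s (k * x).
Proof.
move=> Fk [c Fc ->]; exists (fun i => k * c i); first by move=> i; apply: sfM.
by rewrite mulr_sumr; apply: eq_bigr => i _; rewrite mulrA.
Qed.
Lemma fspan_sum s (I : Type) (r : seq I) (P : pred I) (G : I -> C) :
  (forall i, P i -> fspan s (G i)) -> fspan s (\sum_(i <- r | P i) G i).
Proof. by move=> HG; elim/big_rec: _ => [|i x Pi Fx]; [apply: fspan0 | apply: fspanD; auto]. Qed.
Lemma fspan_mem s x : x \in s -> fspan s x.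
Proof.
move=> s_x; exists (fun i => (i == index x s)%:R).
  by move=> i; case: (i == _); [apply: sf1 | apply: sf0].
have lt_xs : (index x s < size s)%N by rewrite index_mem.
rewrite (bigD1 (Ordinal lt_xs)) //= eqxx mul1r nth_index // big1 ?addr0 // => i ne_i.
by rewrite -val_eqE /= in ne_i; rewrite (negPf ne_i) mul0r.
Qed.
Lemma fspan_trans s s' x : (forall y, y \in s -> fspan s' y) -> fspan s x -> fspan s' x.
Proof.
move=> ss' [c Fc ->]; apply: fspan_sum => i _; apply: fspanZ => //.
by apply/ss'/mem_nth.
Qed.

Definition falgebra (s : seq C) : Prop :=
  [/\ fspan s 1, forall x y, x \in s -> y \in s -> fspan s (x * y) & forall x, x \in s -> algp F x].

Lemma falgebra_adjoin s x : falgebra s -> algp F x ->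
  exists2 s', falgebra s' & (forall y, y \in s -> fspan s' y) /\ fspan s' x.
Proof.
move=> [s1 sM sA] Ax; have [d [c [Fc xd]]] := algp_monic sF Ax.
have d_gt0 : (0 < d)%N.
  by case: (posnP d) xd => // ->; rewrite big_ord0 expr0 => /eqP; rewrite oner_eq0.
pose s' := [seq y * x ^+ j | y <- s, j <- iota 0 d].
have xk k : fspan [seq x ^+ j | j <- iota 0 d] (x ^+ k).
  elim: k => [|k IHk]; first by apply: fspan_mem; apply/mapP; exists 0%N; rewrite ?mem_iota.
  have: fspan [seq x ^+ j | j <- iota 0 d] (x ^+ k) by [].
  rewrite exprSr => -[a Fa {1}->]; rewrite mulr_suml; apply: fspan_sum => i _.
  rewrite -mulrA; apply: fspanZ => //.
  have lt_id : (i < d)%N by rewrite (leq_trans (ltn_ord i)) // size_map size_iota.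
  rewrite (nth_map 0%N) ?size_iota // nth_iota // add0n -exprSr.
  case: (ltngtP i.+1 d) lt_id => // [lt_i _ | eq_d _].
    by apply: fspan_mem; apply/mapP; exists i.+1; rewrite ?mem_iota.
  rewrite eq_d xd; apply: fspan_sum => j _; apply: fspanZ => //.
  by apply: fspan_mem; apply/mapP; exists (j : nat); rewrite ?mem_iota ?ltn_ord.
have s'xk y k : fspan s y -> fspan s' (y * x ^+ k).
  move=> [a Fa ->]; rewrite mulr_suml; apply: fspan_sum => l _.
  rewrite -mulrA; apply: fspanZ => //; have [b Fb ->] := xk k.
  rewrite mulr_sumr; apply: fspan_sum => i _; rewrite mulrCA; apply: fspanZ => //.
  have lt_id : (i < d)%N by rewrite (leq_trans (ltn_ord i)) // size_map size_iota.
  rewrite (nth_map 0%N) ?size_iota // nth_iota // add0n; apply/fspan_mem/allpairsP.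
  by exists (s`_l, i : nat); rewrite /= mem_nth // mem_iota.
exists s'; split.
- by rewrite -[1]mulr1 -[X in _ * X](expr0 x); apply: s'xk.
- move=> _ _ /allpairsP[[y i] [/= sy _ ->]] /allpairsP[[z j] [/= sz _ ->]].
  by rewrite mulrACA -exprD; apply/s'xk/sM.
- move=> _ /allpairsP[[y i] [/= sy _ ->]]; have sAlg := algp_subfield sF.
  by apply: (sfM sAlg); [apply: sA | apply: sfX].
- by move=> y sy; rewrite -[y]mulr1 -(expr0 x); apply/s'xk/fspan_mem.
- by rewrite -[x]mul1r -[X in _ * X]expr1; apply: s'xk.
Qed.

Lemma falgebra_exists (l : seq C) : (forall x, x \in l -> algp F x) ->
  exists2 s, falgebra s & forall x, x \in l -> fspan s x.
Proof.
elim: l => [_ | x l IHl Al].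
  exists [:: 1] => //; split=> [|x y|x]; rewrite ?inE.
  - by apply: fspan_mem; rewrite inE.
  - by move=> /eqP-> /eqP->; rewrite mulr1; apply: fspan_mem; rewrite inE.
  - by move=> /eqP->; apply: algp_base => //; apply: sf1.
have [|s algs sl] := IHl; first by move=> y ly; apply: Al; rewrite inE ly orbT.
have [|s' algs' [ss' s'x]] := falgebra_adjoin algs (x := x); first by apply: Al; rewrite mem_head.
exists s' => // y; rewrite inE => /predU1P[-> // | /sl]; exact: fspan_trans.
Qed.

Lemma findep_rcons b x : findep b -> ~ fspan b x -> findep (rcons b x).
Proof.
move=> fb bx c Fc; rewrite size_rcons big_ord_recr /= nth_rcons ltnn eqxx.
rewrite (eq_bigr (fun i : 'I_(size b) => c i * b`_i)); last first.
  by move=> i _; rewrite nth_rcons ltn_ord.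
have [c0 | nz_c] := eqVneq (c (size b)) 0.
  rewrite c0 mul0r addr0 => /(fb c Fc) Hc i; rewrite ltnS leq_eqVlt.
  by case/predU1P => [-> // | /Hc].
move/eqP; rewrite addrC addr_eq0 => /eqP Hx; case: bx.
exists (fun i => - (c i / c (size b))).
  by move=> i; apply: (sfN sF); apply: (sfM sF) => //; apply: (sfV sF).
apply: (mulfI nz_c); rewrite Hx -sumrN mulr_sumr; apply: eq_bigr => i _; field.
by rewrite nz_c.
Qed.

(** Starting the greedy extraction from [[:: 1]] keeps [1] as first basis vector. The Liouville
    estimate relies on it: an element of [Fq[theta]] is recognised there by the vanishing of its
    other coordinates. *)
Lemma findep_extract (s : seq C) : exists b, [/\ findep b, b`_0 = 1 /\ (0 < size b)%N,
  forall x, x \in s -> fspan b x & forall x, x \in b -> x \in 1 :: s].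
Proof.
elim/last_ind: s => [|s x [b [fb [b0 sb] bs sub]]].
  exists [:: 1]; split=> // c Fc; rewrite big_ord1 mulr1 => c0 [|i] //.
have subr y : y \in 1 :: s -> y \in 1 :: rcons s x.
  by rewrite !inE mem_rcons inE => /orP[-> // | ->]; rewrite !orbT.
have [bx | bx] := pselect (fspan b x).
  exists b; split=> // [y|y /sub/subr //]; rewrite mem_rcons inE => /predU1P[-> // | /bs //].
exists (rcons b x); split; first exact: findep_rcons.
- by rewrite nth_rcons sb b0 size_rcons.
- move=> y; rewrite mem_rcons inE => /predU1P[-> | /bs].
    by apply: fspan_mem; rewrite mem_rcons mem_head.
  by apply: fspan_trans => z bz; apply: fspan_mem; rewrite mem_rcons inE bz orbT.
- move=> y; rewrite mem_rcons inE => /predU1P[-> | /sub/subr //].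
  by rewrite inE mem_rcons mem_head orbT.
Qed.

Lemma fspanM s x y : falgebra s -> fspan s x -> fspan s y -> fspan s (x * y).
Proof.
move=> [_ sM _] [a Fa ->] [b Fb ->]; rewrite mulr_suml; apply: fspan_sum => i _.
rewrite mulr_sumr; apply: fspan_sum => j _; rewrite mulrACA.
by apply: fspanZ; [apply: sfM | apply: sM; apply: mem_nth].
Qed.

Lemma falgebra_basis (l : seq C) : (forall x, x \in l -> algp F x) ->
  exists b, [/\ falgebra b, findep b, b`_0 = 1 /\ (0 < size b)%N & forall x, x \in l -> fspan b x].
Proof.
move=> /falgebra_exists [s algs sl]; have [b [fb b0 bs sub]] := findep_extract s.
have [s1 sM sA] := algs; have spb x : fspan s x -> fspan b x by apply: fspan_trans.
have bsp x : x \in b -> fspan s x.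
  by move/sub; rewrite inE => /predU1P[-> // | /fspan_mem].
exists b; split=> // [|x /sl/spb //]; split=> [|x y bx by_|x /sub]; first exact: spb.
  by apply/spb/fspanM => //; apply: bsp.
by rewrite inE => /predU1P[-> | /sA //]; apply: algp_base => //; apply: sf1.
Qed.

End Span.

(** * Siegel's lemma and orders over Fq[theta] *)

Section Siegel.
Variables (C : closedFieldType) (p e : nat) (chC : p \in [pchar C]) (theta : C).
Local Notation q := (p ^ e)%N.
Local Notation Fq := (in_Fq q : C -> Prop).
Local Notation sFq := (Fq_subfield e chC).

(** Unknown polynomials of size at most [H] contribute [#|I| * H] coefficients, and each equation
    has at most [H + h] coefficients: a linear system over [Fq] with more unknowns than
    equations. *)
Lemma siegel_poly (I J : finType) (m : I -> J -> {poly C}) h H :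
  (forall i j, pOver Fq (m i j)) -> (forall i j, (size (m i j) <= h.+1)%N) ->
  (#|J| * (H + h) < #|I| * H)%N ->
  exists v : I -> {poly C}, [/\ forall i, pOver Fq (v i), forall i, (size (v i) <= H)%N,
    exists i, v i != 0 & forall j, \sum_i v i * m i j = 0].
Proof.
move=> Fm sm lt_JI.
pose A (x : I * 'I_H) (y : J * 'I_(H + h)) : C := ('X^(x.2) * m x.1 y.1)`_(y.2).
have FA x y : Fq (A x y).
  by apply: (pOverM sFq) => //; apply: (pOver_exp sFq); apply: (pOverX sFq).
have [|w [Fw [[[i0 a0] nz_w] eqw]]] := subfield_kernel sFq FA; first by rewrite !card_prod !card_ord.
pose v i := \sum_(a < H) w (i, a) *: 'X^a : {poly C}.
have vE i a : (v i)`_(nat_of_ord a) = w (i, a).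
  rewrite coef_sum (bigD1 a) //= coefZ coefXn eqxx mulr1 big1 ?addr0 // => b ne_b.
  by rewrite coefZ coefXn val_eqE eq_sym (negPf ne_b) mulr0.
have szv i : (size (v i) <= H)%N.
  apply: (leq_trans (size_sum _ _ _)); apply/bigmax_leqP => a _.
  by rewrite (leq_trans (size_scale_leq _ _)) // size_polyXn.
exists v; split=> //.
- move=> i; apply: (pOver_sum sFq) => a _ k; rewrite coefZ coefXn.
  by apply: (sfM sFq) => //; case: (k == a); [apply: (sf1 sFq) | apply: (sf0 sFq)].
- by exists i0; apply: contraNneq nz_w => v0; rewrite -(vE i0 a0) v0 coef0.
move=> j; apply/polyP => b; rewrite coef0 coef_sum.
have [lt_b | le_b] := ltnP b (H + h); last first.
  rewrite big1 // => i _; rewrite nth_default // (leq_trans (size_polyMleq _ _)) //.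
  by move: (szv i) (sm i j) le_b; lia.
transitivity (\sum_i \sum_(a < H) w (i, a) * ('X^a * m i j)`_b).
  apply: eq_bigr => i _; rewrite /v mulr_suml coef_sum; apply: eq_bigr => a _.
  by rewrite -scalerAl coefZ.
by rewrite pair_bigA -[RHS](eqw (j, Ordinal lt_b)); apply: eq_bigr => -[i a] _.
Qed.

Lemma common_denominator (T : finType) (c : T -> C) : (forall t, in_K q theta (c t)) ->
  exists2 D : {poly C}, pOver Fq D /\ D.[theta] != 0 &
    exists2 a : T -> {poly C}, (forall t, pOver Fq (a t)) & forall t, D.[theta] * c t = (a t).[theta].
Proof.
move=> Kc; have [a Ha] := choice Kc; have [b Hb] := choice Ha.
exists (\prod_t b t).
  split; last by rewrite horner_prod prodf_seq_neq0; apply/allP => t _; case: (Hb t) => _ [_ []].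
  elim/big_rec: _ => [|t P _ FP]; first exact: (pOver1 sFq).
  by apply: (pOverM sFq) => //; case: (Hb t) => _ [].
exists (fun t => a t * \prod_(s | s != t) b s).
  move=> t; apply: (pOverM sFq); first by case: (Hb t).
  elim/big_rec: _ => [|s P _ FP]; first exact: (pOver1 sFq).
  by apply: (pOverM sFq) => //; case: (Hb s) => _ [].
move=> t; have [_ [_ [nzb ->]]] := Hb t.
by rewrite (bigD1 t) //= !hornerM; field.
Qed.

End Siegel.

(** * Absolute values of polynomials in theta over Fq *)

Section Order.
Variables (C : closedFieldType) (R : realFieldType) (abs : C -> R).
Hypothesis Habs : nonarch_abs abs.
Variables (p e : nat) (chC : p \in [pchar C]) (e_gt0 : (0 < e)%N).
Local Notation q := (p ^ e)%N.
Variables (theta : C) (Htheta : 1 < abs theta).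
Local Notation Th := (abs theta).
Local Notation Fq := (in_Fq q : C -> Prop).
Local Notation sFq := (Fq_subfield e chC).

Lemma q_gt1 : (1 < q)%N.
Proof. by rewrite -(exp1n e) ltn_exp2r // prime_gt1 // (pcharf_prime chC). Qed.

Lemma Th_gt0 : 0 < Th. Proof. exact: lt_trans ltr01 Htheta. Qed.
Lemma ThX_gt0 n : 0 < Th ^+ n. Proof. exact: exprn_gt0 Th_gt0. Qed.
Lemma ThX_ge0 n : 0 <= Th ^+ n. Proof. exact: ltW (ThX_gt0 n). Qed.
Lemma ThX_le m n : (m <= n)%N -> Th ^+ m <= Th ^+ n.
Proof. by move=> le_mn; rewrite ler_weXn2l // ltW. Qed.
Lemma ThX_lt m n : (m < n)%N -> Th ^+ m < Th ^+ n.
Proof. by move=> lt_mn; rewrite ltr_eXn2l. Qed.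
Lemma ThX_ge1 n : 1 <= Th ^+ n. Proof. by rewrite -(expr0 Th); apply: ThX_le. Qed.

Lemma Fq_abs c : Fq c -> c != 0 -> abs c = 1.
Proof.
move=> Fc nz_c; have c_gt0 : 0 < abs c by rewrite (abs_gt0 Habs).
apply/eqP; rewrite -(@pexpr_eq1 _ _ q.-1) ?(ltW c_gt0) //; last by rewrite -ltnS prednK ?q_gt1 // ltnW ?q_gt1.
apply/eqP/(mulfI (lt0r_neq0 c_gt0)); rewrite -exprS prednK ?(ltnW q_gt1) // mulr1.
by rewrite -(absX Habs) Fc.
Qed.

Lemma Fq_abs_le c : Fq c -> abs c <= 1.
Proof.
have [-> | nz_c Fc] := eqVneq c 0; first by rewrite (abs0 Habs) ler01.
by rewrite Fq_abs.
Qed.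

Lemma Fq_poly_le a n : pOver Fq a -> (size a <= n.+1)%N -> abs a.[theta] <= Th ^+ n.
Proof.
move=> Fa sa; rewrite horner_coef; apply: (abs_sum_le Habs); first exact: ThX_ge0.
move=> i _ _; rewrite (absM Habs) (absX Habs) -[Th ^+ n]mul1r; apply: ler_pM.
- exact: (abs_ge0 Habs).
- exact: ThX_ge0.
- exact: Fq_abs_le.
- by apply: ThX_le; rewrite -ltnS (leq_trans (ltn_ord i)).
Qed.

Lemma Fq_poly_abs a : pOver Fq a -> a != 0 -> abs a.[theta] = Th ^+ (size a).-1.
Proof.
move=> Fa nz_a; have sa : (0 < size a)%N by rewrite size_poly_gt0.
have abs_lead : abs (lead_coef a * theta ^+ (size a).-1) = Th ^+ (size a).-1.
  by rewrite (absM Habs) (absX Habs) Fq_abs ?mul1r ?lead_coef_eq0 // lead_coefE; apply: Fa.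
rewrite horner_coef -[size a]prednK // big_ord_recr /= addrC -lead_coefE.
rewrite -[RHS]abs_lead; apply: (absD_eq Habs); rewrite abs_lead.
apply: (abs_sum_lt Habs); first exact: ThX_gt0.
move=> i _ _; rewrite (absM Habs) (absX Habs).
apply: le_lt_trans (ThX_lt (ltn_ord i)).
by rewrite -[leRHS]mul1r ler_wpM2r ?ThX_ge0 // Fq_abs_le.
Qed.

(** The analogue of the fact that a nonzero integer has absolute value at least 1; the Liouville
    inequality rests on it. *)
Lemma Fq_poly_ge1 a : pOver Fq a -> a.[theta] != 0 -> 1 <= abs a.[theta].
Proof.
move=> Fa nz; rewrite Fq_poly_abs //; first exact: ThX_ge1.
by apply: contraNneq nz => ->; rewrite horner0.
Qed.

Lemma Fq_poly_eq0 a : pOver Fq a -> a.[theta] = 0 -> a = 0.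
Proof.
move=> Fa a0; apply/eqP; apply: contraTT isT => nz_a.
by have := ThX_gt0 (size a).-1; rewrite -Fq_poly_abs // a0 (abs0 Habs) ltxx.
Qed.

End Order.

(** * Heights in finite extensions of K *)

Section Filtration.
Variables (C : closedFieldType) (R : realFieldType) (abs : C -> R).
Hypothesis Habs : nonarch_abs abs.
Variables (p e : nat) (chC : p \in [pchar C]) (e_gt0 : (0 < e)%N).
Local Notation q := (p ^ e)%N.
Variables (theta : C) (Htheta : 1 < abs theta).
Local Notation Th := (abs theta).
Local Notation Fq := (in_Fq q : C -> Prop).
Local Notation sFq := (Fq_subfield e chC).
Hypothesis Hcof : forall B : R, exists n, B <= Th ^+ n.

(* [T h] plays the role of the elements of height at most [h] in an order over Fq[theta] of a finite
   extension of K; [c] absorbs all the constants. *)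
Record filtration (T : nat -> C -> Prop) (c : nat) : Prop := Filtration {
  ft0 : forall h, T h 0;
  ftD : forall h x y, T h x -> T h y -> T h (x + y);
  ft_mono : forall h h' x, (h <= h')%N -> T h x -> T h' x;
  ftM : forall h h' x y, T h x -> T h' y -> T (h + h')%N (x * y);
  ft1 : T c 1;
  ftN : forall h x, T h x -> T h (- x);
  ft_theta : T c theta;
  ft_liouville : forall h x, T h x -> x != 0 -> 1 <= abs x * Th ^+ (c * h.+1);
  ft_upper : forall h x, T h x -> abs x <= Th ^+ (h + c);
  ft_siegel : forall (I J : finType) (m : I -> J -> C) h s, (forall i j, T h (m i j)) ->
    (#|J| <= s * (#|I| - #|J|))%N -> (#|J| < #|I|)%N ->
    exists v : I -> C, [/\ forall i, T (s * h + c)%N (v i), exists i, v i != 0 &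
      forall j, \sum_i v i * m i j = 0];
  ft_Kbar : forall h x, T h x -> in_Kbar q theta x }.

Lemma filtration_weaken T c c' : (c <= c')%N -> filtration T c -> filtration T c'.
Proof.
move=> le_cc' [T0 TD Tm TM T1 TN Tt TL TU TS TK]; split=> //.
- exact: Tm T1.
- exact: Tm Tt.
- move=> h x Tx nzx; apply: le_trans (TL h x Tx nzx) _.
  by rewrite ler_wpM2l ?(abs_ge0 Habs) // (ThX_le Htheta) // leq_mul2r le_cc' orbT.
- move=> h x Tx; apply: le_trans (TU h x Tx) _.
  by rewrite (ThX_le Htheta) // leq_add2l.
- move=> I J m h s Hm le_s lt_JI; have [v [Tv nzv eqv]] := TS I J m h s Hm le_s lt_JI.
  by exists v; split=> // i; apply: Tm (Tv i); rewrite leq_add2l.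
Qed.

Section OrderFiltration.
Variables (d : nat) (b : 'I_d.+1 -> C) (g : 'I_d.+1 -> 'I_d.+1 -> 'I_d.+1 -> {poly C}).
Hypothesis b0 : b ord0 = 1.
Hypothesis Fg : forall i j k, pOver Fq (g i j k).
Hypothesis bM : forall i j, b i * b j = \sum_k (g i j k).[theta] * b k.
Hypothesis bK : forall i, in_Kbar q theta (b i).
Hypothesis b_indep : forall a : 'I_d.+1 -> {poly C}, (forall k, pOver Fq (a k)) ->
  \sum_k (a k).[theta] * b k = 0 -> forall k, a k = 0.

Let kap := \max_(t : 'I_d.+1 * 'I_d.+1 * 'I_d.+1) size (g t.1.1 t.1.2 t.2).

Let le_kap i j k : (size (g i j k) <= kap)%N.
Proof. exact: (leq_bigmax (i, j, k)). Qed.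

(** The shift by [kap] pays for the structure constants and makes the filtration strictly
    multiplicative: sizes at most [h - kap], [h' - kap] and [kap] combine to at most [h + h' - kap].
    For [h <= kap] only [0] is left. *)
Definition ordfilt (h : nat) (x : C) : Prop := exists a : 'I_d.+1 -> {poly C},
  [/\ forall k, pOver Fq (a k), forall k, (size (a k) <= h - kap)%N & x = \sum_k (a k).[theta] * b k].

Local Notation T := ordfilt.

Let T_size h h' (a a' : {poly C}) i j k : (size a <= h - kap)%N -> (size a' <= h' - kap)%N ->
  (size (a * a' * g i j k)%R <= h + h' - kap)%N.
Proof.
have [-> | nza] := eqVneq a 0; first by rewrite !mul0r size_poly0.
have [-> | nza'] := eqVneq a' 0; first by rewrite mulr0 mul0r size_poly0.
move: (le_kap i j k) (size_polyMleq (a * a') (g i j k)) (size_polyMleq a a').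
by move: nza nza'; rewrite -!size_poly_gt0; lia.
Qed.

Let sizeM_kap h (a a' : {poly C}) : (size a <= h - kap)%N -> (size a' <= kap)%N ->
  (size (a * a')%R <= h)%N.
Proof.
have [-> | nza] := eqVneq a 0; first by rewrite mul0r size_poly0.
by move: nza (size_polyMleq a a'); rewrite -size_poly_gt0; lia.
Qed.

Lemma ordfiltM h h' x y : T h x -> T h' y -> T (h + h')%N (x * y).
Proof.
move=> [a [Fa sa ->]] [a' [Fa' sa' ->]].
exists (fun k => \sum_i \sum_j a i * a' j * g i j k); split.
- move=> k; apply: (pOver_sum sFq) => i _; apply: (pOver_sum sFq) => j _.
  by do 2?apply: (pOverM sFq).
- move=> k; apply: (leq_trans (size_sum _ _ _)); apply/bigmax_leqP => i _.
  apply: (leq_trans (size_sum _ _ _)); apply/bigmax_leqP => j _.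
  exact: T_size.
rewrite mulr_suml; under [RHS]eq_bigr => k _.
  rewrite horner_sum mulr_suml; under eq_bigr => i _ do rewrite horner_sum mulr_suml.
  over.
rewrite exchange_big; apply: eq_bigr => i _ /=; rewrite mulr_sumr exchange_big /=.
apply: eq_bigr => j _; rewrite mulrACA bM mulr_sumr; apply: eq_bigr => k _.
by rewrite !hornerM mulrA.
Qed.

Let T_scal h a i : pOver Fq a -> (size a <= h - kap)%N -> T h (a.[theta] * b i).
Proof.
move=> Fa sa; exists (fun k => if k == i then a else 0); split.
- by move=> k; case: ifP => // _; apply: (pOver0 sFq).
- by move=> k; case: ifP => // _; rewrite size_poly0.
rewrite (bigD1 i) //= eqxx big1 ?addr0 // => k ne_k.
by rewrite (negPf ne_k) horner0 mul0r.
Qed.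

(** Coordinates in the basis [b] replace each unknown and each equation by [d.+1] of them over
    [Fq[theta]], which keeps their ratio. With [H = s * h + 1] the condition of [siegel_poly]
    becomes [#|J| * h < H * (#|I| - #|J|)]. *)
Lemma ordfilt_siegel (I J : finType) (m : I -> J -> C) h s : (forall i j, T h (m i j)) ->
  (#|J| <= s * (#|I| - #|J|))%N -> (#|J| < #|I|)%N ->
  exists v : I -> C, [/\ forall i, T (s * h + (kap + 1))%N (v i), exists i, v i != 0 &
      forall j, \sum_i v i * m i j = 0].
Proof.
move=> Tm le_s lt_JI; have [a Ha] := choice (fun ij => Tm ij.1 ij.2).
pose M (x : I * 'I_d.+1) (y : J * 'I_d.+1) : {poly C} :=
  \sum_l a (x.1, y.1) l * g x.2 l y.2.
have Fa ij k : pOver Fq (a ij k) by case: (Ha ij).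
have sa ij k : (size (a ij k) <= h - kap)%N by case: (Ha ij).
have [| | |v [Fv sv [[i0 k0] nzv] eqv]] := @siegel_poly _ _ e chC _ _ M h (s * h).+1.
- by move=> x y; apply: (pOver_sum sFq) => l _; apply: (pOverM sFq).
- move=> x y; apply: (leq_trans (size_sum _ _ _)); apply/bigmax_leqP => l _.
  exact/leqW/sizeM_kap.
- rewrite !card_prod card_ord mulnAC [ltnRHS]mulnAC ltn_pmul2r //.
  rewrite -[X in (_ < X * _)%N](subnKC (ltnW lt_JI)) mulnDr mulnDl ltn_add2l.
  apply: (@leq_ltn_trans (s * (#|I| - #|J|) * h)); first by rewrite leq_mul2r le_s orbT.
  by rewrite mulnS -mulnA mulnCA -[X in (X < _)%N]add0n ltn_add2r subn_gt0.
exists (fun i => \sum_k (v (i, k)).[theta] * b k); split.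
- move=> i; exists (fun k => v (i, k)); split=> // k.
  by rewrite (leq_trans (sv _)) //; lia.
- exists i0; apply: contraNneq nzv => /b_indep -> //.
move=> j; have mE i : m i j = \sum_l (a (i, j) l).[theta] * b l by case: (Ha (i, j)).
transitivity (\sum_l' (\sum_i \sum_k v (i, k) * M (i, k) (j, l')).[theta] * b l'); last first.
  by rewrite big1 // => l' _; rewrite pair_bigA /= (eq_bigr (fun x => v x * M x (j, l')))
    ?eqv ?horner0 ?mul0r // => -[].
under [RHS]eq_bigr => l' _.
  rewrite horner_sum mulr_suml; under eq_bigr => i _ do rewrite horner_sum mulr_suml.
  over.
rewrite exchange_big; apply: eq_bigr => i _ /=; rewrite mulr_suml exchange_big /=.
apply: eq_bigr => k _; rewrite -mulrA mE mulr_sumr mulr_sumr.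
under [RHS]eq_bigr => l' _.
  rewrite /M /= hornerM horner_sum -mulrA mulr_suml mulr_sumr.
  over.
rewrite exchange_big; apply: eq_bigr => l _ /=; rewrite [b k * _]mulrCA bM !mulr_sumr.
by apply: eq_bigr => l' _; rewrite hornerM !mulrA.
Qed.

Lemma ordfilt_filtration : exists c, filtration T c.
Proof.
have [c0 Hc0] : exists c0, forall i, abs (b i) <= Th ^+ c0.
  have [c Hc] := choice (fun i => Hcof (abs (b i))); exists (\max_i c i) => i.
  by apply: le_trans (Hc i) _; rewrite (ThX_le Htheta) // leq_bigmax.
have T_up h x : T h x -> abs x <= Th ^+ (h + c0).
  move=> [a [Fa sa ->]]; apply: (abs_sum_le Habs) => [|i _ _]; first exact: (ThX_ge0 Htheta).
  rewrite (absM Habs) exprD; apply: ler_pM; rewrite ?(abs_ge0 Habs) //.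
  by apply: (Fq_poly_le Habs chC e_gt0) => //; rewrite (leq_trans (sa i)) // leqW // leq_subr.
pose c := (kap + 2 + d + c0)%N; exists c.
have T_liou h x : T h x -> x != 0 -> 1 <= abs x * Th ^+ (c * h.+1).
  move=> [a [Fa sa defx]] nzx.
  (* In place of a norm: [d] equations in [d.+1] unknowns give a nonzero [y] of controlled size such
     that all coordinates of [x * y] vanish except the one along [b ord0 = 1]. Then [x * y] is a
     nonzero element of [Fq[theta]], so that [1 <= abs (x * y)]. *)
  pose M (l : 'I_d.+1) (m : 'I_d) : {poly C} := \sum_k a k * g k l (lift ord0 m).
  have [| | |v [Fv sv [l0 nzv] eqv]] := @siegel_poly _ _ e chC _ _ M h (d * h).+1.
  - by move=> l m; apply: (pOver_sum sFq) => k _; apply: (pOverM sFq).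
  - move=> l m; apply: (leq_trans (size_sum _ _ _)); apply/bigmax_leqP => k _.
    exact/leqW/sizeM_kap.
  - by rewrite !card_ord; nia.
  pose y := \sum_l (v l).[theta] * b l.
  have nzy : y != 0 by apply: contraNneq nzv => /b_indep ->.
  pose w k := \sum_l \sum_i a i * v l * g i l k.
  have xyE : x * y = (w ord0).[theta].
    transitivity (\sum_k (w k).[theta] * b k); last first.
      rewrite big_ord_recl b0 mulr1 big1 ?addr0 // => k _.
      suff -> : w (lift ord0 k) = 0 by rewrite horner0 mul0r.
      rewrite -[RHS](eqv k); apply: eq_bigr => l _; rewrite mulr_sumr.
      by apply: eq_bigr => i _; rewrite mulrCA mulrA.
    rewrite defx mulr_suml; under [RHS]eq_bigr => k _.
      rewrite horner_sum mulr_suml; under eq_bigr => l _ do rewrite horner_sum mulr_suml.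
      over.
    rewrite exchange_big [RHS]/=; under [RHS]eq_bigr => l _ do rewrite exchange_big /=.
    rewrite exchange_big /=; apply: eq_bigr => i _; rewrite mulr_sumr.
    apply: eq_bigr => l _; rewrite mulrACA bM mulr_sumr; apply: eq_bigr => k _.
    by rewrite !hornerM mulrA.
  have xy_ge1 : 1 <= abs (x * y).
    rewrite xyE; apply: (Fq_poly_ge1 Habs chC e_gt0) => //; last by rewrite -xyE mulf_neq0.
    apply: (pOver_sum sFq) => l _; apply: (pOver_sum sFq) => i _.
    by do 2?apply: (pOverM sFq).
  apply: le_trans xy_ge1 _; rewrite (absM Habs) ler_wpM2l ?(abs_ge0 Habs) //.
  apply: (@le_trans _ _ (Th ^+ (d * h + c0))); last by apply: (ThX_le Htheta); rewrite /c; nia.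
  apply: (abs_sum_le Habs) => [|i _ _]; first exact: (ThX_ge0 Htheta).
  rewrite (absM Habs) exprD; apply: ler_pM; rewrite ?(abs_ge0 Habs) //.
  exact: (Fq_poly_le Habs chC e_gt0).
split=> //.
- move=> h; exists (fun=> 0); split=> [_|_|].
  + exact: (pOver0 sFq).
  + by rewrite size_poly0.
  + by rewrite big1 // => i _; rewrite horner0 mul0r.
- move=> h x y [a [Fa sa ->]] [a' [Fa' sa' ->]]; exists (fun k => a k + a' k); split=> [k|k|].
  + exact: (pOverD sFq).
  + by rewrite (leq_trans (size_polyD _ _)) // geq_max sa sa'.
  + by rewrite -big_split; apply: eq_bigr => i _; rewrite hornerD mulrDl.
- move=> h h' x le_h [a [Fa sa ->]]; exists a; split=> // k.
  by rewrite (leq_trans (sa k)) // leq_sub2r.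
- exact: ordfiltM.
- rewrite -[1]mulr1 -{2}b0 -[X in X * _](hornerC 1 theta); apply: T_scal.
    exact: (pOver1 sFq).
  by rewrite size_poly1 /c; lia.
- move=> h x [a [Fa sa ->]]; exists (fun k => - a k); split=> [k|k|].
  + exact: (pOverN sFq).
  + by rewrite size_polyN.
  + by rewrite -sumrN; apply: eq_bigr => i _; rewrite hornerN mulNr.
- rewrite -[theta]mulr1 -b0 -[X in X * _](hornerX theta); apply: T_scal.
    exact: (pOverX sFq).
  by rewrite size_polyX /c; lia.
- move=> h x Tx; apply: le_trans (T_up h x Tx) _.
  by apply: (ThX_le Htheta); rewrite /c; lia.
- move=> I J m h s Tm le_s lt_JI; have [v [Tv nzv eqv]] := ordfilt_siegel Tm le_s lt_JI.
  exists v; split=> // i; have [a [Fa sa defv]] := Tv i; exists a; split=> // k.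
  by rewrite (leq_trans (sa k)) // /c; lia.
- move=> h x [a [Fa sa ->]]; have sK := Kbar_subfield e chC theta.
  apply: (sf_sum sK) => i _; apply: (sfM sK) => //; apply: (pOver_horner sK) => //.
    by move=> k; apply: (Fq_Kbar chC); apply: Fa.
  exact: (theta_Kbar e chC).
Qed.

End OrderFiltration.

Lemma filtration_exists (l : seq C) : (forall x, x \in l -> in_Kbar q theta x) ->
  exists T c, filtration T c /\
    exists2 D, D != 0 /\ in_Kbar q theta D & forall x, x \in l -> T c (D * x).
Proof.
have sK := K_subfield e chC theta.
move=> /(falgebra_basis sK) [s [algs inds [s0 szs] sl]].
have [d szd] : exists d, size s = d.+1 by case: (size s) szs => // d; exists d.
pose B (i : 'I_d.+1) := s`_i.
have spanE x : fspan (in_K q theta) s x ->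
    exists2 c : 'I_d.+1 -> C, (forall i, in_K q theta (c i)) & x = \sum_k c k * B k.
  by case=> c Kc ->; rewrite szd; exists (fun i : 'I_d.+1 => c i).
have BM i j : exists c : 'I_d.+1 -> C,
    (forall k, in_K q theta (c k)) /\ B i * B j = \sum_k c k * B k.
  have [_ sM _] := algs; have [|c Kc defB] := spanE (B i * B j); last by exists c.
  by apply: sM; apply: mem_nth; rewrite szd.
have [c0 Hc0] := choice (fun ij => BM ij.1 ij.2).
have [D [FD nzD] [a Fa Da]] := @common_denominator _ _ e chC theta _
  (fun t : 'I_d.+1 * 'I_d.+1 * 'I_d.+1 => c0 t.1 t.2) (fun t => (Hc0 t.1).1 t.2).
(* Multiplying the basis vectors other than [1] by the common denominator [D] makes the structure
   constants integral: a product of two new vectors carries [D] twice, one [D] clears the constant,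
   the other is absorbed in the basis vector, or stays as a factor along [1]. *)
pose b (k : 'I_d.+1) := if k == ord0 then 1 else D.[theta] * B k.
pose E (k : 'I_d.+1) : {poly C} := if k == ord0 then 1 else D.
have h1 : (1 : {poly C}).[theta] = 1 by rewrite -polyC1 hornerC.
have bE k : b k = (E k).[theta] * B k.
  by rewrite /b /E; case: eqP => // ->; rewrite /B /= s0 h1 mulr1.
have FE k : pOver Fq (E k) by rewrite /E; case: eqP => // _; apply: (pOver1 sFq).
have nzE k : (E k).[theta] != 0 by rewrite /E; case: (k == ord0); rewrite ?h1 ?oner_eq0.
pose g (i j k : 'I_d.+1) : {poly C} :=
  if i == ord0 then (j == k)%:R else if j == ord0 then (i == k)%:R else
  if k == ord0 then D * a (i, j, k) else a (i, j, k).
have Fbool (x : bool) : pOver Fq (x%:R : {poly C}).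
  by case: x; [apply: (pOver1 sFq) | apply: (pOver0 sFq)].
have Fg i j k : pOver Fq (g i j k).
  by rewrite /g; do 3![case: eqP => // _]; apply: (pOverM sFq).
have sumbool (i : 'I_d.+1) : b i = \sum_k ((i == k)%:R : {poly C}).[theta] * b k.
  rewrite (bigD1 i) //= eqxx h1 mul1r big1 ?addr0 // => k ne_k.
  by rewrite eq_sym (negPf ne_k) horner0 mul0r.
have bM i j : b i * b j = \sum_k (g i j k).[theta] * b k.
  have [i0 | ni] := eqVneq i ord0.
    by rewrite {1}/b i0 eqxx mul1r sumbool; apply: eq_bigr => k _; rewrite /g eqxx.
  have [j0 | nj] := eqVneq j ord0.
    rewrite [b j]/b j0 eqxx mulr1 sumbool; apply: eq_bigr => k _.
    by rewrite /g (negPf ni) eqxx.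
  rewrite /b (negPf ni) (negPf nj) mulrACA (Hc0 (i, j)).2 mulr_sumr; apply: eq_bigr => k _.
  rewrite /g (negPf ni) (negPf nj); have [k0 | nk] := eqVneq k ord0.
    by rewrite k0 hornerM -(Da (i, j, ord0)) /B /= s0 !mulr1 mulrA.
  by rewrite -(Da (i, j, k)) /=; ring.
have sKb := Kbar_subfield e chC theta.
have [_ _ sA] := algs.
have bK i : in_Kbar q theta (b i).
  rewrite bE; apply: (sfM sKb); last by apply: sA; apply: mem_nth; rewrite szd.
  apply: (pOver_horner sKb); last exact: (theta_Kbar e chC).
  by move=> k; apply: (Fq_Kbar chC); apply: FE.
have b_indep (w : 'I_d.+1 -> {poly C}) : (forall k, pOver Fq (w k)) ->
    \sum_k (w k).[theta] * b k = 0 -> forall k, w k = 0.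
  move=> Fw sum0 k.
  pose c1 i := if (i < d.+1)%N then (w (inord i)).[theta] * (E (inord i)).[theta] else 0.
  have Kpoly f : pOver Fq f -> in_K q theta f.[theta].
    move=> Ff; apply: (pOver_horner sK) => [i|]; first exact: (Fq_K chC).
    exact: (theta_K e chC).
  have := inds c1 _ _ k; rewrite /c1 szd ltn_ord inord_val => H.
  apply: (Fq_poly_eq0 Habs chC e_gt0 Htheta) => //; apply: (mulIf (nzE k)); rewrite mul0r; apply: H => //.
    move=> i; case: ifP => _; last exact: (sf0 sK).
    by apply: (sfM sK); apply: Kpoly.
  rewrite -[RHS]sum0; apply: eq_bigr => i _.
  by rewrite ltn_ord inord_val bE mulrA.
have b0 : b ord0 = 1 by rewrite /b eqxx.
have [c HT] := ordfilt_filtration b0 Fg bM bK b_indep.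
exists (ordfilt b g).
have [D' [FD' nzD'] HD'] : exists2 D' : {poly C}, pOver Fq D' /\ D'.[theta] != 0 &
    exists h, forall x, x \in l -> ordfilt b g h (D'.[theta] * x).
  have [c1 Hc1] : exists c1 : 'I_(size l) -> 'I_d.+1 -> C, forall i,
      (forall k, in_K q theta (c1 i k)) /\ l`_i = \sum_k c1 i k * B k.
    have H (i : 'I_(size l)) : exists c1 : 'I_d.+1 -> C,
        (forall k, in_K q theta (c1 k)) /\ l`_i = \sum_k c1 k * B k.
      by have [|c1 K1 E1] := spanE l`_i; [apply: sl; apply: mem_nth | exists c1].
    by have [c1 Hc1] := choice H; exists c1.
  have [D1 [FD1 nzD1] [a1 Fa1 Da1]] := @common_denominator _ _ e chC theta _
    (fun t : 'I_(size l) * 'I_d.+1 => c1 t.1 t.2) (fun t => (Hc1 t.1).1 t.2).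
  exists (D * D1); first by rewrite hornerM mulf_neq0 //; split=> //; apply: (pOverM sFq).
  pose a2 i (k : 'I_d.+1) : {poly C} := if k == ord0 then D * a1 (i, k) else a1 (i, k).
  exists ((\max_(t : 'I_(size l) * 'I_d.+1) size (a2 t.1 t.2)) +
     \max_(t : 'I_d.+1 * 'I_d.+1 * 'I_d.+1) size (g t.1.1 t.1.2 t.2))%N.
  move=> x l_x; have lt_x : (index x l < size l)%N by rewrite index_mem.
  pose i := Ordinal lt_x; have xE : x = l`_i by rewrite /= nth_index.
  exists (a2 i); split.
  - by move=> k; rewrite /a2; case: ifP => // _; apply: (pOverM sFq).
  - by move=> k; rewrite addnK; apply: (leq_bigmax (i, k)).
  - rewrite xE (Hc1 i).2 mulr_sumr; apply: eq_bigr => k _; rewrite hornerM bE /a2 /E.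
    case: eqP => [-> | _]; last by rewrite -(Da1 (i, k)) /=; ring.
    by rewrite hornerM h1 -(Da1 (i, ord0)) /=; ring.
have [h Th] := HD'; exists (maxn c h); split.
  exact: filtration_weaken (leq_maxl _ _) HT.
exists D'.[theta].
  split=> //; apply: (pOver_horner sKb); last exact: (theta_Kbar e chC).
  by move=> k; apply: (Fq_Kbar chC); apply: FD'.
by move=> x /Th; apply: (ft_mono HT); rewrite leq_maxr.
Qed.

End Filtration.

(** * Frobenius twists of series *)

Section Twist.
Variables (C : closedFieldType) (p e : nat) (chC : p \in [pchar C]) (e_gt0 : (0 < e)%N).
Local Notation q := (p ^ e)%N.

Definition fr n := frob (e * n) chC.
HB.instance Definition _ n := GRing.RMorphism.copy (fr n) (frob (e * n) chC).
Definition tw n : pser C -> pser C := ps_map (fr n).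
HB.instance Definition _ n := GRing.RMorphism.copy (tw n) (ps_map (fr n)).

Lemma frE n x : fr n x = x ^+ (q ^ n). Proof. by rewrite /fr /frob expnM. Qed.
Lemma frD m n x : fr m (fr n x) = fr (m + n) x.
Proof. by rewrite !frE -exprM expnD mulnC. Qed.
Lemma fr0 x : fr 0 x = x. Proof. by rewrite frE. Qed.
Lemma fr_inj n : injective (fr n). Proof. exact: fmorph_inj. Qed.
Lemma qn_gt0 n : (0 < q ^ n)%N. Proof. by rewrite expn_gt0 expn_gt0 prime_gt0 // (pcharf_prime chC). Qed.
Lemma twD m n f : tw m (tw n f) = tw (m + n) f. Proof. by apply/funext => i; exact: frD. Qed.
Lemma tw0 f : tw 0 f = f. Proof. by apply/funext => i; exact: fr0. Qed.
Lemma tw_of_poly n P : tw n (of_poly P) = of_poly (map_poly (fr n) P).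
Proof. exact: ps_map_of_poly. Qed.
Lemma tw_inj n : injective (tw n). Proof. exact/ps_map_inj/fr_inj. Qed.

Lemma root_exists (y : C) n : (0 < n)%N -> exists x, x ^+ n = y.
Proof.
move=> n_gt0; have [x Hx] := solve_monicpoly (fun i => if i == 0%N then y else 0) n_gt0.
exists x; rewrite Hx; case: n n_gt0 {Hx} => // n _; rewrite big_ord_recl expr0 mulr1 big1 ?addr0 //.
by move=> i _; rewrite mul0r.
Qed.

Lemma fr_surj n y : exists x, fr n x = y.
Proof. by have [x Hx] := root_exists y (qn_gt0 n); exists x; rewrite frE. Qed.

Lemma map_fr_surj n (P : {poly C}) : exists Q, map_poly (fr n) Q = P.
Proof.
have [g Hg] := choice (fr_surj n); exists (\poly_(i < size P) g P`_i).
apply/polyP => i; rewrite coef_map coef_poly; case: ltnP => [_ | le_i]; first exact: Hg.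
by rewrite nth_default //=; apply: rmorph0.
Qed.

End Twist.

(** * The Anderson-Brownawell-Papanikolas criterion *)

Section ABP.
Variables (C : closedFieldType) (R : realFieldType) (abs : C -> R).
Hypothesis Habs : nonarch_abs abs.
Variables (p e : nat) (chC : p \in [pchar C]) (e_gt0 : (0 < e)%N).
Local Notation q := (p ^ e)%N.
Variables (theta : C) (Htheta : 1 < abs theta).
Local Notation Th := (abs theta).
Hypothesis Hcof : forall B : R, exists n, B <= Th ^+ n.
Local Notation fr := (fr e chC).
Local Notation tw := (tw e chC).
Local Notation conv := (conv abs).
Local Notation bnd := (bnd abs).
Local Notation Kbar := (in_Kbar q theta).
Local Notation Th_gt0 := (Th_gt0 Htheta).

Lemma conv_tw r n f : 0 < r -> conv r f -> conv (r ^+ (q ^ n)) (tw n f).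
Proof.
move=> r_gt0 cf eps eps_gt0; pose d := Num.min eps 1.
have d_gt0 : 0 < d by rewrite lt_min eps_gt0 ltr01.
have [N HN] := cf d d_gt0; exists N => i /HN; rewrite lt_min => /andP[lt_eps /ltW lt1].
rewrite /tw /ps_map frE (absX Habs) -exprM mulnC exprM -exprMn.
apply: le_lt_trans lt_eps; rewrite -[leRHS]expr1.
by apply: ler_wiXn2l; rewrite ?(qn_gt0 e chC) // mulr_ge0 ?(abs_ge0 Habs) // exprn_ge0 // ltW.
Qed.

Lemma bnd_tw r n f B : 0 < r -> bnd r f B -> bnd (r ^+ (q ^ n)) (tw n f) (B ^+ (q ^ n)).
Proof.
move=> r_gt0 Hf i; rewrite /tw /ps_map frE (absX Habs) -exprM mulnC exprM -exprMn.
have fr_ge0 j : 0 <= abs (f j) * r ^+ j by rewrite mulr_ge0 ?(abs_ge0 Habs) // exprn_ge0 // ltW.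
by apply: lerXn2r; rewrite ?nnegrE //; apply: le_trans (fr_ge0 i) (Hf i).
Qed.

Lemma conv_mono r r' f : 0 <= r -> r <= r' -> conv r' f -> conv r f.
Proof.
move=> r_ge0 le_rr' cf eps /cf [N HN]; exists N => i /HN; apply: le_lt_trans.
by rewrite ler_wpM2l ?(abs_ge0 Habs) // lerXn2r ?nnegrE ?(le_trans r_ge0).
Qed.

Lemma ltn_pow n : (n < q ^ n)%N. Proof. exact/ltn_expl/(q_gt1 chC e_gt0). Qed.

Section Criterion.
Variables (l : nat) (B : 'M[{poly C}]_l) (psi : 'cV[pser C]_l).
Hypothesis conv_psi : forall i, conv Th (psi i 0).
Hypothesis psi_eq : psi = map_mx (@of_poly C) B *m map_mx (tw 1) psi.
Hypothesis B_nondeg : forall z, z != theta ^+ q ->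
  forall r : 'rV[C]_l, r *m map_mx (horner_eval z) B = 0 -> r = 0.

(** The product of the twists of [B] of orders [k] to [k + n - 1]. *)
Fixpoint Bprod k n : 'M[{poly C}]_l :=
  if n is n'.+1 then map_mx (map_poly (fr k)) B *m Bprod k.+1 n' else 1%:M.

Lemma psi_Bprod k n :
  map_mx (tw k) psi = map_mx (@of_poly C) (Bprod k n) *m map_mx (tw (k + n)) psi.
Proof.
elim: n k => [|n IHn] k /=; first by rewrite addn0 map_mx1 mul1mx.
have step : map_mx (tw k) psi =
    map_mx (@of_poly C) (map_mx (map_poly (fr k)) B) *m map_mx (tw k.+1) psi.
  rewrite {1}psi_eq; apply/matrixP => i j; rewrite !mxE rmorph_sum; apply: eq_bigr => a _.
  by rewrite !mxE rmorphM /= tw_of_poly twD addn1.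
rewrite step IHn addSnnS mulmxA; congr (_ *m _).
by apply/esym; exact: map_mxM.
Qed.

(** The twist of [B] of order [j] degenerates at [z] only if [B] does at the [q ^ j]-th root of [z],
    hence only at [z = theta ^+ (q ^ j.+1)]. *)
Lemma Bprod_nondeg k n z : (forall j, (k <= j < k + n)%N -> z != theta ^+ (q ^ j.+1)) ->
  forall r : 'rV[C]_l, r *m map_mx (horner_eval z) (Bprod k n) = 0 -> r = 0.
Proof.
elim: n k => [|n IHn] k Hz r /=; first by rewrite map_mx1 mulmx1.
rewrite map_mxM mulmxA => /IHn H.
have {}H : r *m map_mx (horner_eval z) (map_mx (map_poly (fr k)) B) = 0.
  by apply: H => j Hj; apply: Hz; move: Hj; lia.
have [g Hg] := choice (fr_surj e chC k).
have nzz : g z != theta ^+ q.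
  apply: contra (Hz k _) => [/eqP E|]; last by rewrite leqnn addnS ltnS leq_addr.
  by rewrite -(Hg z) E frE -exprM -expnS.
have : map_mx g r *m map_mx (horner_eval (g z)) B = 0.
  apply/matrixP => i j; apply: (@fr_inj _ _ e chC k).
  have := congr1 (fun A : 'rV[C]_l => A i j) H; rewrite !mxE rmorph0 => H0; rewrite -[RHS]H0.
  rewrite rmorph_sum; apply: eq_bigr => a _.
  by rewrite !mxE rmorphM /horner_eval -{2}(Hg z) /= horner_map Hg.
move/(B_nondeg nzz) => gr0; apply/matrixP => i j.
have := congr1 (fun A : 'rV[C]_l => fr k (A i j)) gr0; rewrite !mxE Hg => ->.
by rewrite rmorph0.
Qed.

Section Integral.
Variables (T : nat -> C -> Prop) (c : nat).
Hypothesis filtT : filtration abs p e theta T c.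
Variable D : nat.
Hypothesis TB : forall i j k, T c (B i j)`_k.
Hypothesis sB : forall i j, (size (B i j) <= D.+1)%N.

Definition hp h (P : {poly C}) := forall i, T h P`_i.

Lemma T_sum h (I : Type) (r : seq I) (P : pred I) (F : I -> C) :
  (forall i, P i -> T h (F i)) -> T h (\sum_(i <- r | P i) F i).
Proof. by move=> HF; elim/big_rec: _ => [|i x Pi IH]; [apply: (ft0 filtT) | apply: (ftD filtT); auto]. Qed.
Lemma T_exp h n x : (0 < n)%N -> T h x -> T (h * n)%N (x ^+ n).
Proof.
case: n => // n _ Tx; elim: n => [|n IHn]; first by rewrite muln1.
by rewrite exprS mulnS; apply: (ftM filtT).
Qed.
Lemma T_theta h n : (c * n <= h)%N -> (c <= h)%N -> T h (theta ^+ n).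
Proof.
case: n => [|n] le_n le_h; first exact: (ft_mono filtT le_h (ft1 filtT)).
by apply: (ft_mono filtT le_n); apply: T_exp => //; apply: (ft_theta filtT).
Qed.
Lemma hp_sum h (I : Type) (r : seq I) (P : pred I) (F : I -> {poly C}) :
  (forall i, P i -> hp h (F i)) -> hp h (\sum_(i <- r | P i) F i).
Proof. by move=> HF j; rewrite coef_sum; apply: T_sum => i Pi; apply: HF. Qed.
Lemma hpM h h' P Q : hp h P -> hp h' Q -> hp (h + h') (P * Q).
Proof. by move=> HP HQ i; rewrite coefM; apply: T_sum => j _; apply: (ftM filtT). Qed.
Lemma hp_mono h h' P : (h <= h')%N -> hp h P -> hp h' P.
Proof. by move=> le_h HP i; apply: (ft_mono filtT le_h (HP i)). Qed.
Lemma hp_tw n h P : hp h P -> hp (h * q ^ n) (map_poly (fr n) P).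
Proof. by move=> HP i; rewrite coef_map /= frE; apply: T_exp (HP i); apply: (qn_gt0 e chC). Qed.

(** The heights [c * q ^ j] for [k <= j < k + n] add up to at most [c * (q ^ (k + n) - q ^ k)]
    because [q >= 2]. The subtracted term lets the induction close; the successor covers the empty
    product, whose entries lie in [T c]. *)
Lemma Bprod_hp k n i j : hp (c * (q ^ (k + n) - q ^ k).+1) (Bprod k n i j).
Proof.
elim: n k i j => [|n IHn] k i j /=.
  rewrite addn0 subnn muln1 mxE => a; case: (i == j); last by rewrite coef0; apply: (ft0 filtT).
  by rewrite coef1; case: (a == 0%N); [apply: (ft1 filtT) | apply: (ft0 filtT)].
rewrite mxE; apply: hp_sum => a _; rewrite mxE.
apply: (@hp_mono (c * q ^ k + c * (q ^ (k.+1 + n) - q ^ k.+1).+1)); last first.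
  by apply: hpM => //; apply: hp_tw.
rewrite -mulnDr leq_mul2l addnS addSnnS; apply/orP; right; rewrite ltnS.
have := q_gt1 chC e_gt0; have: (q ^ k.+1 <= q ^ (k + n.+1))%N.
  by rewrite leq_pexp2l ?addnS ?ltnS ?leq_addr // ltnW // (q_gt1 chC e_gt0).
have -> : (q ^ k.+1 = q * q ^ k)%N by rewrite expnS.
by move: (q ^ k)%N (q ^ (k + n.+1))%N; move: q => q'; nia.
Qed.

Lemma Bprod_hp_le k n i j : hp (c * q ^ (k + n)) (Bprod k n i j).
Proof.
apply: hp_mono (Bprod_hp k n i j); rewrite leq_mul2l; apply/orP; right.
have := qn_gt0 e chC k; have : (q ^ k <= q ^ (k + n))%N.
  by rewrite leq_pexp2l ?leq_addr // ltnW // (q_gt1 chC e_gt0).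
by move: (q ^ k)%N (q ^ (k + n))%N => a b; lia.
Qed.

Lemma Bprod_size k n i j : (size (Bprod k n i j) <= (n * D).+1)%N.
Proof.
elim: n k i j => [|n IHn] k i j /=.
  by rewrite mxE; case: (i == j); rewrite ?size_poly1 ?size_poly0.
rewrite mxE; apply: (leq_trans (size_sum _ _ _)); apply/bigmax_leqP => a _; rewrite mxE.
apply: (leq_trans (size_polyMleq _ _)); rewrite mulSn size_map_poly.
have le_sum x y : (x <= D.+1)%N -> (y <= (n * D).+1)%N -> ((x + y).-1 <= (D + n * D).+1)%N by lia.
exact: le_sum.
Qed.

Lemma evat_tw r n z f v : 0 < r -> evat abs r z f v ->
  evat abs (r ^+ (q ^ n)) (fr n z) (tw n f) (fr n v).
Proof.
move=> r_gt0 [h ch ->]; exists (tw n h); first exact: conv_tw.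
rewrite rmorphD rmorphM /= !tw_of_poly map_polyC /= rmorphB /= map_polyX map_polyC //.
Qed.

Lemma evat_lin r z h : conv r h -> evat abs r z (of_poly ('X - z%:P) * h) 0.
Proof. by move=> ch; exists h; rewrite // polyC0 rmorph0 add0r. Qed.

Variables (v rho : 'I_l -> C).
Hypothesis Hev : forall i, evat abs Th theta (psi i 0) (v i).
Hypothesis Hrho : \sum_i rho i * v i = 0.
Hypothesis Trho : forall i, T c (rho i).
Hypothesis nz_rho : exists i, rho i != 0.

Let l_gt0 : (0 < l)%N.
Proof. by case: nz_rho => i _; apply: leq_ltn_trans (ltn_ord i). Qed.

(** * The auxiliary function *)

Section Auxiliary.
Variable k : nat.
Hypothesis k_gt0 : (0 < k)%N.
(** The [l * D'] coefficients of the [g i] and the [N] multipliers [cc m] make [N * l + l * k]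
    unknowns for [N * l] equations, so Siegel's exponent is [2 * l] whatever [k] is. The Schwarz
    lemma will gain [N - D' = k]. The twist of order [2 * N] brings [psi] to the disc of radius
    [Th ^+ Q], which contains all the [z m], and leaves room for [q ^ m * a <= Q] when [m] and [a]
    are at most [N]. *)
Let N := (2 * l * k)%N.
Let D' := (2 * l * k - k)%N.
Let Q := (q ^ (2 * N))%N.
Let C1 := (c * (3 + D))%N.
Let Hg := (2 * l * (C1 * Q) + c)%N.

Let N_gt0 : (0 < N)%N. Proof. by rewrite /N !muln_gt0 l_gt0. Qed.
Let q_pow m n : (m <= n)%N -> (q ^ m <= q ^ n)%N.
Proof. by move=> le_mn; rewrite leq_pexp2l // ltnW // (q_gt1 chC e_gt0). Qed.
Let Q_gt0 : (0 < Q)%N. Proof. exact: (qn_gt0 e chC). Qed.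
Let k_N : (k <= N)%N. Proof. by rewrite /N leq_pmull // muln_gt0. Qed.
Let D'_N : (D' + k = N)%N. Proof. by rewrite /D' subnK. Qed.

Let pow_mul m a : (m <= N)%N -> (a <= N)%N -> (q ^ m * a <= Q)%N.
Proof.
move=> le_m le_a; rewrite /Q mul2n -addnn expnD leq_mul ?q_pow //.
by rewrite (leq_trans le_a) // ltnW // ltn_pow.
Qed.

Let M (m : 'I_N) : 'M[{poly C}]_l := Bprod m.+1 (2 * N - m.+1).
Let z (m : 'I_N) := theta ^+ (q ^ m.+1).
(** The vector [tw m.+1 psi] is [M m] times [tw (2 * N) psi], so [w m] is the relation [rho], raised
    to the power [q ^ m.+1] and carried over to the values at [z m] of the twist of order
    [2 * N]. *)
Let w (m : 'I_N) j := \sum_i rho i ^+ (q ^ m.+1) * (M m i j).[z m].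

Let le_mN (m : 'I_N) : (m.+1 <= 2 * N)%N.
Proof. by rewrite (leq_trans (ltn_ord m)) // leq_pmull. Qed.

Lemma T_w (m : 'I_N) j : T (C1 * Q) (w m j).
Proof.
apply: T_sum => // i _.
have le_qQ : (q ^ m.+1 <= Q)%N by apply: q_pow.
apply: (ft_mono filtT (h := c * q ^ m.+1 + (c * Q + c * (D.+1 * Q)))%N).
  rewrite -!mulnDr /C1 -mulnA leq_mul2l; apply/orP; right.
  by rewrite mulnDl !mulSn mul0n; move: le_qQ; lia.
apply: (ftM filtT); first by apply: T_exp => //; apply: (qn_gt0 e chC).
rewrite horner_coef; apply: T_sum => // a _; apply: (ftM filtT).
  by have := Bprod_hp_le m.+1 (2 * N - m.+1) i j a; rewrite subnKC.
rewrite -exprM; apply: T_theta => //; last by rewrite leq_pmulr // muln_gt0.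
rewrite leq_mul2l; apply/orP; right.
have le_a : (a <= (2 * N - m.+1) * D)%N.
  by rewrite -ltnS (leq_trans (ltn_ord a)) // Bprod_size.
apply: (leq_trans (leq_mul (leqnn _) le_a)).
apply: (@leq_trans (Q * D)); last by rewrite mulSn mulnC leq_addl.
rewrite mulnA leq_mul2r; apply/orP; right.
have -> : Q = (q ^ m.+1 * q ^ (2 * N - m.+1))%N by rewrite -expnD subnKC.
by rewrite leq_mul2l ltnW ?orbT // ltn_pow.
Qed.

(* The congruences [g = cc m * w m] at [z m] make [G], below, vanish at the [N] points [z m]; the Schwarz
   lemma then bounds its lowest coefficient from above, and Liouville's inequality from below. *)
Lemma siegel_first : exists (g : 'I_l -> {poly C}) (cc : 'I_N -> C),
  [/\ forall i, (size (g i) <= D')%N, forall i, hp Hg (g i), exists i, g i != 0 &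
      forall m j, (g j).[z m] = cc m * w m j].
Proof.
pose A (x : ('I_l * 'I_D') + 'I_N) (y : 'I_N * 'I_l) : C := match x with
  | inl ia => if ia.1 == y.2 then z y.1 ^+ ia.2 else 0
  | inr m => if m == y.1 then - w m y.2 else 0 end.
have TA x y : T (C1 * Q) (A x y).
  case: x => [ia | m] /=; case: ifP => _; try exact: (ft0 filtT); last exact/(ftN filtT)/T_w.
  rewrite /z -exprM; have le_cC1 : (c <= C1)%N by rewrite /C1 leq_pmulr.
  apply: T_theta => //; last by rewrite (leq_trans le_cC1) // leq_pmulr.
  apply: leq_mul => //; apply: pow_mul => //.
  by rewrite (leq_trans (ltnW (ltn_ord _))) // -D'_N leq_addr.
have cardI : #|{: ('I_l * 'I_D') + 'I_N}| = (N * l + l * k)%N.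
  rewrite card_sum card_prod !card_ord -[D']/(N - k)%N mulnBr [(N * l)%N]mulnC.
  have EN : N = (2 * (l * k))%N by rewrite mulnA.
  have : (l * k <= l * N)%N by rewrite leq_mul2l k_N orbT.
  by rewrite [X in (_ + X)%N]EN; move: (l * k)%N (l * N)%N => a b; clear; lia.
have cardJ : #|{: 'I_N * 'I_l}| = (N * l)%N by rewrite card_prod !card_ord.
have [| |x [Tx [x0 nzx] eqx]] := ft_siegel filtT (s := 2 * l) TA; rewrite ?cardI ?cardJ.
- by rewrite addKn /N; lia.
- by rewrite -[X in (X < _)%N]addn0 ltn_add2l muln_gt0 l_gt0.
pose g i : {poly C} := \sum_(a < D') x (inl (i, a)) *: 'X^a.
have gE i (a : 'I_D') : (g i)`_a = x (inl (i, a)).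
  rewrite coef_sum (bigD1 a) //= coefZ coefXn eqxx mulr1 big1 ?addr0 // => b ne_b.
  by rewrite coefZ coefXn val_eqE eq_sym (negPf ne_b) mulr0.
have sg i : (size (g i) <= D')%N.
  apply: (leq_trans (size_sum _ _ _)); apply/bigmax_leqP => a _.
  by rewrite (leq_trans (size_scale_leq _ _)) // size_polyXn.
have eqg m j : (g j).[z m] = x (inr m) * w m j.
  have := eqx (m, j); rewrite big_sumType /= [X in _ + X](bigD1 m) //= eqxx.
  rewrite [X in _ + (_ + X)]big1 ?addr0; last by move=> b ne_b; rewrite (negPf ne_b) mulr0.
  rewrite mulrN => /eqP; rewrite subr_eq0 => /eqP <-.
  transitivity (\sum_i \sum_(a < D') x (inl (i, a)) * (if i == j then z m ^+ a else 0)); last first.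
    by rewrite pair_bigA; apply: eq_bigr => -[].
  rewrite (bigD1 j) //= [X in _ + X]big1 ?addr0 => [|i ne_i]; last first.
    by rewrite big1 // => a _; rewrite (negPf ne_i) mulr0.
  by rewrite horner_sum; apply: eq_bigr => a _; rewrite eqxx hornerZ hornerXn.
exists g, (fun m => x (inr m)); split=> //.
  move=> i a; case: (ltnP a D') => [lt_a | le_a].
    by rewrite (gE i (Ordinal lt_a)); apply: (ft_mono filtT _ (Tx _)).
  by rewrite nth_default ?(leq_trans (sg i)) //; apply: (ft0 filtT).
(* If all [g i] vanished, the nonzero solution would have some [cc m != 0], hence [w m = 0]; but
   [rho] is nonzero and no factor of [M m] degenerates at [z m]. *)
apply: contrapT => g0; have {}g0 i : g i = 0.
  by apply/eqP/negPn/negP => nzg; apply: g0; exists i.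
case: x0 nzx => [[i a] | m]; first by rewrite -gE g0 coef0 eqxx.
move=> nzm; have: \row_i (rho i ^+ (q ^ m.+1)) = 0 :> 'rV[C]_l.
  apply: (@Bprod_nondeg m.+1 (2 * N - m.+1) (z m)) => [a le_a|].
    have ne1 : Th != 1 by rewrite gt_eqF.
    apply/eqP => /(congr1 abs); rewrite !(absX Habs) => /(ieexprIn Th_gt0 ne1).
    by move/(expnI (q_gt1 chC e_gt0)) => -[eq_a]; move: le_a; rewrite eq_a ltnn.
  apply/matrixP => a j; rewrite !mxE.
  have /eqP := eqg m j; rewrite g0 horner0 eq_sym mulf_eq0 (negPf nzm) => /eqP w0.
  by rewrite -[RHS]w0; apply: eq_bigr => i _; rewrite !mxE.
case: nz_rho => i nzi /matrixP /(_ 0 i); rewrite !mxE => /eqP.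
by rewrite expf_eq0 (negPf nzi) andbF.
Qed.

Variables (g : 'I_l -> {poly C}) (cc : 'I_N -> C).
Hypothesis sg : forall i, (size (g i) <= D')%N.
Hypothesis hg : forall i, hp Hg (g i).
Hypothesis gz : forall m j, (g j).[z m] = cc m * w m j.
Let G := \sum_i of_poly (g i) * tw (2 * N) (psi i 0).

Let ThX_Q : 0 < Th ^+ Q. Proof. exact: ThX_gt0. Qed.

Lemma G_conv : conv (Th ^+ Q) G.
Proof.
apply: conv_sum => // i _ _; apply: convM => //; first exact: conv_poly.
by apply: conv_tw; [exact: Th_gt0 | exact: conv_psi].
Qed.

(** Modulo [X - z m] the polynomials [g j] may be replaced by [cc m] times the row
    [rho ^ (q ^ m.+1)] times [M m]. Then [G] becomes [cc m] times the combination of the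
    [tw m.+1 (psi i 0)] with coefficients [rho i ^+ (q ^ m.+1)], whose value at
    [z m = fr m.+1 theta] is the twist of [\sum_i rho i * v i = 0]. *)
Lemma G_evat (m : 'I_N) : evat abs (Th ^+ (q ^ m.+1)) (z m) G 0.
Proof.
pose F j : {poly C} := (cc m)%:P * \sum_i (rho i ^+ (q ^ m.+1))%:P * M m i j.
have Fz j : (F j).[z m] = (g j).[z m].
  rewrite gz hornerM hornerC horner_sum; congr (_ * _); apply: eq_bigr => i _.
  by rewrite hornerM hornerC.
have [Qt HQt] : exists Qt, forall j, g j - F j = Qt j * ('X - (z m)%:P).
  have exQ j : exists Qj, g j - F j = Qj * ('X - (z m)%:P).
    by apply/factor_theorem; rewrite /root hornerD hornerN Fz subrr.
  by have [Qt HQ] := choice exQ; exists Qt.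
have psiM i : tw m.+1 (psi i 0) = \sum_j of_poly (M m i j) * tw (2 * N) (psi j 0).
  have := congr1 (fun A : 'cV[pser C]_l => A i 0) (psi_Bprod m.+1 (2 * N - m.+1)).
  by rewrite subnKC // !mxE => ->; apply: eq_bigr => j _; rewrite !mxE.
have -> : G = \sum_j of_poly ('X - (z m)%:P) * (of_poly (Qt j) * tw (2 * N) (psi j 0)) +
    of_poly (cc m)%:P * \sum_i of_poly (rho i ^+ (q ^ m.+1))%:P * tw m.+1 (psi i 0).
  have -> : \sum_i of_poly (rho i ^+ (q ^ m.+1))%:P * tw m.+1 (psi i 0) =
      \sum_j of_poly (\sum_i (rho i ^+ (q ^ m.+1))%:P * M m i j) * tw (2 * N) (psi j 0).
    under eq_bigr => i _ do rewrite psiM mulr_sumr.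
    rewrite exchange_big; apply: eq_bigr => j _ /=; rewrite rmorph_sum mulr_suml.
    by apply: eq_bigr => i _; rewrite rmorphM mulrA.
  rewrite mulr_sumr -big_split; apply: eq_bigr => j _ /=.
  rewrite !mulrA -rmorphM [_ * Qt j]mulrC -HQt -[of_poly (cc m)%:P * _]rmorphM -/(F j).
  by rewrite -mulrDl rmorphB /= subrK.
have rgt0 : 0 < Th ^+ (q ^ m.+1) by apply: ThX_gt0.
rewrite -[X in evat _ _ _ _ X](addr0 0); apply: evatD => //.
  have E0 : 0 = \sum_(j < l) (0 : C) by rewrite big1.
  rewrite [X in evat _ _ _ _ X]E0.
  apply: evat_sum => // j _; apply: evat_lin; apply: convM => //; first exact: conv_poly.
  apply: conv_mono (conv_tw (2 * N) Th_gt0 (conv_psi j)) => //; first exact: ltW.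
  by apply: ThX_le => //; apply: q_pow.
have E1 : 0 = (cc m) * \sum_i rho i ^+ (q ^ m.+1) * fr m.+1 (v i).
  have -> : \sum_i rho i ^+ (q ^ m.+1) * fr m.+1 (v i) = fr m.+1 (\sum_i rho i * v i).
    by rewrite rmorph_sum; apply: eq_bigr => i _; rewrite rmorphM /= (frE e chC m.+1 (rho i)).
  by rewrite Hrho rmorph0 mulr0.
rewrite [X in evat _ _ _ _ X]E1.
have evC a : evat abs (Th ^+ (q ^ m.+1)) (z m) (of_poly a%:P) a.
  by rewrite -[X in evat _ _ _ _ X](hornerC a (z m)); apply: evat_poly.
apply: evatM => //; apply: evat_sum => // i _; apply: evatM => //.
by rewrite /z -(frE e chC m.+1 theta); apply: evat_tw; [exact: Th_gt0 | exact: Hev].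
Qed.

Lemma G_bnd Cp : (forall i, bnd Th (psi i 0) (Th ^+ Cp)) ->
  bnd (Th ^+ Q) G (Th ^+ (Hg + c + (D' + Cp) * Q)).
Proof.
move=> Hpsi; apply: bnd_sum => // [|i _]; first exact: ThX_ge0.
rewrite mulnDl addnA exprD; apply: bndM; rewrite ?(ThX_ge0 Htheta) //; last first.
  by rewrite exprM; apply: bnd_tw; [exact: Th_gt0 | exact: Hpsi].
move=> a; case: (ltnP a D') => [lt_a | le_a]; last first.
  by rewrite /of_poly nth_default ?(leq_trans (sg i)) // (abs0 Habs) mul0r ThX_ge0.
rewrite exprD; apply: ler_pM; rewrite ?(abs_ge0 Habs) ?exprn_ge0 ?(ltW Th_gt0) //.
  exact: (ft_upper filtT (hg i a)).
by rewrite -exprM mulnC; apply: ThX_le => //; rewrite leq_mul2r ltnW ?orbT.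
Qed.

Let sum_pow n : (\sum_(m < n) q ^ m.+1 <= q ^ n.+1)%N.
Proof.
elim: n => [|n IHn]; first by rewrite big_ord0.
rewrite big_ord_recr /= (leq_trans (leq_add IHn (leqnn _))) // addnn -mul2n [in leqRHS]expnS.
by rewrite leq_mul2r (q_gt1 chC e_gt0) orbT.
Qed.

(** Write [G = P * H] with [P] the monic polynomial with zeros [z m]. The Schwarz lemma bounds [H],
    and as the constant term of [P] is nonzero, the lowest terms of [G] and [H] have the same index.
    The degrees of the [g i] cost [D' * Q], the zeros gain [N * Q], and the constant term of [P]
    costs at most [Q]; the net gain is [k * Q]. *)
Lemma G_small Cp i : (forall i, bnd Th (psi i 0) (Th ^+ Cp)) ->
  G i != 0 -> (forall j, (j < i)%N -> G j = 0) ->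
  abs (G i) * Th ^+ (k * Q) <= Th ^+ (Hg + c + (Cp + 1) * Q).
Proof.
move=> Hpsi nzGi G0.
pose zs := [seq z m | m <- enum 'I_N].
have absz m : abs (z m) = Th ^+ (q ^ m.+1) by rewrite (absX Habs).
have zs_le x : x \in zs -> abs x <= Th ^+ Q.
  case/mapP => m _ ->; rewrite absz; apply: ThX_le => //; exact: q_pow.
have uzs : uniq zs.
  rewrite map_inj_uniq ?enum_uniq // => m m' /(congr1 abs); rewrite !absz.
  have ne1 : Th != 1 by rewrite gt_eqF.
  by move/(ieexprIn Th_gt0 ne1)/(expnI (q_gt1 chC e_gt0)) => -[] /val_inj.
have [|H cH defG] := prod_quot_conv Habs ThX_Q uzs zs_le G_conv.
  move=> x /mapP [m _ ->]; have [h ch defG] := G_evat m.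
  have {}defG : G = of_poly ('X - (z m)%:P) * h by rewrite defG polyC0 rmorph0 add0r.
  exists h => //; apply: (lin_quot_conv Habs ThX_Q _ _ _ ch defG G_conv).
  - exact: ThX_gt0.
  - by rewrite absz.
  - by apply: ThX_le => //; apply: q_pow.
have HB := prod_quot_bnd Habs ThX_Q zs_le cH (ThX_gt0 Htheta _) defG (G_bnd Hpsi).
set P := \prod_(x <- zs) _ in defG.
have P0 : abs P`_0 = Th ^+ (\sum_(m < N) q ^ m.+1).
  rewrite -horner_coef0 horner_prod (abs_prod Habs) big_map big_enum /=.
  rewrite (big_morph _ (exprD Th) (expr0 Th)); apply: eq_bigr => m _.
  by rewrite !hornerE (absN Habs) absz.
have nzP0 : P`_0 != 0 by rewrite -(abs_gt0 Habs) P0 ThX_gt0.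
have nzH : H != 0.
  by apply: contraNneq nzGi => H0; rewrite defG H0 mulr0.
have [a [nzHa Ha0]] := ps_order nzH.
have [Ga Ga0] := @ps_lowM C (of_poly P) H 0 a (fun i => ltac:(by [])) Ha0.
rewrite -defG add0n in Ga; rewrite -defG in Ga0.
have eq_ia : i = a.
  apply/eqP; rewrite eqn_leq; apply/andP; split; rewrite leqNgt; apply/negP => lt_.
    by move: (G0 a lt_) => /eqP; rewrite Ga mulf_eq0 (negPf nzHa) (negPf nzP0).
  by rewrite Ga0 ?eqxx in nzGi.
have leH : abs (H i) * (Th ^+ Q) ^+ N <= Th ^+ (Hg + c + (D' + Cp) * Q).
  have := HB i; rewrite size_map size_enum_ord ler_pdivlMr ?exprn_gt0 ?Th_gt0 // => le1.
  apply: le_trans le1; rewrite ler_wpM2r ?exprn_ge0 ?(ltW Th_gt0) //.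
  by rewrite ler_peMr ?(abs_ge0 Habs) // -exprM ThX_ge1.
rewrite -(ler_pM2r (ThX_gt0 Htheta (D' * Q))) -mulrA -exprD -mulnDl [(k + _)%N]addnC D'_N.
rewrite eq_ia Ga -eq_ia (absM Habs) P0 -mulrA mulnC exprM.
apply: (@le_trans _ _ (Th ^+ Q * Th ^+ (Hg + c + (D' + Cp) * Q))).
  apply: ler_pM; rewrite ?(mulr_ge0, abs_ge0 Habs, exprn_ge0, ltW Th_gt0) //.
  apply: ThX_le => //; apply: (leq_trans (sum_pow N)); apply: q_pow.
  by rewrite mul2n -addnn -addn1 leq_add2l.
by rewrite -!exprD; apply: ThX_le => //; rewrite !mulnDl; lia.
Qed.

Let row (j : 'I_l.+1) (i : 'I_l) : {poly C} :=
  \sum_a map_poly (fr j) (g a) * Bprod (2 * N + j) (l - j) a i.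
Let HR := ((Hg + c * Q) * q ^ l)%N.
Let W := (D' + l * D)%N.
Let Hb := ((2 * l).+1 * HR + c)%N.

Let row_hp j i : hp HR (row j i).
Proof.
apply: hp_sum => a _; apply: (@hp_mono (Hg * q ^ j + c * q ^ (2 * N + l))%N).
  rewrite /HR mulnDl leq_add ?leq_mul2l ?q_pow ?orbT ?[(j <= l)%N](ltn_ord j) //.
  by rewrite expnD mulnA.
apply: hpM; first exact: hp_tw.
have := Bprod_hp_le (2 * N + j) (l - j) a i.
by rewrite -addnA subnKC // -ltnS.
Qed.

Let row_size j i : (size (row j i) <= W)%N.
Proof.
apply: (leq_trans (size_sum _ _ _)); apply/bigmax_leqP => a _.
apply: (leq_trans (size_polyMleq _ _)); rewrite size_map_poly.
have le_sum x y : (x <= D')%N -> (y <= ((l - j) * D).+1)%N -> ((x + y).-1 <= W)%N.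
  move=> le_x le_y; have: ((l - j) * D <= l * D)%N by rewrite leq_mul2r leq_subr orbT.
  by rewrite /W; move: le_x le_y; clear; lia.
by apply: le_sum; [exact: sg | exact: Bprod_size].
Qed.

Let twG (j : 'I_l.+1) : tw j G = \sum_i of_poly (row j i) * tw (2 * N + l) (psi i 0).
Proof.
have psiM a : tw (2 * N + j) (psi a 0) =
    \sum_i of_poly (Bprod (2 * N + j) (l - j) a i) * tw (2 * N + l) (psi i 0).
  have := congr1 (fun A : 'cV[pser C]_l => A a 0) (psi_Bprod (2 * N + j) (l - j)).
  rewrite -addnA subnKC -1?ltnS // !mxE => ->.
  by apply: eq_bigr => i _; rewrite !mxE.
rewrite /G rmorph_sum; under eq_bigr => a _.
  rewrite rmorphM /= tw_of_poly twD [(j + _)%N]addnC psiM mulr_sumr.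
  over.
rewrite exchange_big; apply: eq_bigr => i _ /=; rewrite rmorph_sum mulr_suml.
by apply: eq_bigr => a _; rewrite rmorphM mulrA.
Qed.

(** The [l.+1] series [tw j G] are polynomial combinations of the same [l] series, by [twG], hence
    dependent over polynomials. The size [X = 2 * l * W] leaves [l * W] spare unknowns and gives
    Siegel's exponent [(2 * l).+1]. *)
Lemma siegel_second : exists b : 'I_l.+1 -> {poly C},
  [/\ forall j, hp Hb (b j), exists j, b j != 0 & \sum_j of_poly (b j) * tw j G = 0].
Proof.
pose X := (2 * l * W)%N.
pose A (x : 'I_l.+1 * 'I_X) (y : 'I_l * 'I_(X + W)) : C := ('X^(x.2) * row x.1 y.1)`_(y.2).
have TA x y : T HR (A x y).
  by rewrite /A coefXnM; case: ifP => _; [apply: (ft0 filtT) | apply: row_hp].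
have lW_gt0 : (0 < l * W)%N.
  rewrite muln_gt0 l_gt0 addn_gt0 /D' subn_gt0 mulnC ltn_Pmulr //.
  by move: l_gt0; clear; lia.
have cardI : #|{: 'I_l.+1 * 'I_X}| = (l * (X + W) + l * W)%N.
  by rewrite card_prod !card_ord mulSn mulnDr -addnA addnn -mul2n [(2 * (l * W))%N]mulnA addnC.
have cardJ : #|{: 'I_l * 'I_(X + W)}| = (l * (X + W))%N by rewrite card_prod !card_ord.
have [| |y [Ty [[j0 a0] nzy] eqy]] := ft_siegel filtT (s := (2 * l).+1) TA; rewrite ?cardI ?cardJ.
- by rewrite addKn /X -mulSnr mulnCA.
- by rewrite -[X in (X < _)%N]addn0 ltn_add2l.
pose b j : {poly C} := \sum_(a < X) y (j, a) *: 'X^a.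
have bE j (a : 'I_X) : (b j)`_a = y (j, a).
  rewrite coef_sum (bigD1 a) //= coefZ coefXn eqxx mulr1 big1 ?addr0 // => i ne_i.
  by rewrite coefZ coefXn val_eqE eq_sym (negPf ne_i) mulr0.
have sb j : (size (b j) <= X)%N.
  apply: (leq_trans (size_sum _ _ _)); apply/bigmax_leqP => a _.
  by rewrite (leq_trans (size_scale_leq _ _)) // size_polyXn.
have b_row i : \sum_j b j * row j i = 0.
  apply/polyP => a; rewrite coef0 coef_sum; have [lt_a | le_a] := ltnP a (X + W); last first.
    rewrite big1 // => j _; rewrite nth_default //; apply: leq_trans le_a.
    apply: (leq_trans (size_polyMleq _ _)); apply: leq_trans (leq_pred _) _.
    by apply: leq_add; [exact: sb | exact: row_size].
  rewrite -[RHS](eqy (i, Ordinal lt_a)).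
  transitivity (\sum_j \sum_(a' < X) y (j, a') * ('X^a' * row j i)`_a).
    apply: eq_bigr => j _; rewrite /b mulr_suml coef_sum; apply: eq_bigr => a' _.
    by rewrite -scalerAl coefZ.
  by rewrite pair_bigA; apply: eq_bigr => -[].
exists b; split.
- move=> j a; case: (ltnP a X) => [lt_a | le_a].
    by rewrite (bE j (Ordinal lt_a)).
  by rewrite nth_default ?(leq_trans (sb j)) //; apply: (ft0 filtT).
- by exists j0; apply: contraNneq nzy => b0; rewrite -bE b0 coef0.
under eq_bigr => j _ do rewrite twG mulr_sumr.
rewrite exchange_big big1 // => i _ /=.
under eq_bigr => j _ do rewrite mulrA -rmorphM.
by rewrite -mulr_suml -rmorph_sum b_row rmorph0 mul0r.
Qed.

(** The coefficients of [psi] are not assumed algebraic, so Liouville's inequality is not applied to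
    [G i] itself. Lowest terms in [siegel_second] give a nontrivial additive equation for [G i] with
    coefficients in [T Hb]. If [abs (G i) < 1], its coefficient of least order is at most a bounded
    multiple of [abs (G i)], while Liouville bounds that coefficient from below. *)
Lemma G_large i : G i != 0 -> (forall j, (j < i)%N -> G j = 0) ->
  1 <= abs (G i) * Th ^+ (Hb + c + c * Hb.+1).
Proof.
move=> nzGi G0; have [b [Tb [j0 nzb] sum0]] := siegel_second.
have ex_v : exists v, [exists j, (b j)`_v != 0].
  by exists (size (b j0)).-1; apply/existsP; exists j0; rewrite -lead_coefE lead_coef_eq0.
case: (ex_minnP ex_v) => a /existsP [ja nzba] min_a.
have b0 j n : (n < a)%N -> (b j)`_n = 0.
  move=> lt_na; apply/eqP/negPn/negP => nz.
  by have := min_a n; rewrite leqNgt lt_na => /(_ _)/negP; apply=> //; apply/existsP; exists j.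
have sumq : \sum_(j < l.+1) (b j)`_a * G i ^+ (q ^ j) = 0.
  have := congr1 (fun f : pser C => f (a + i)%N) sum0; rewrite ps_sum ps0 => E; rewrite -[RHS]E.
  apply: eq_bigr => j _; have [| |-> _] := @ps_lowM C (of_poly (b j)) (tw j G) a i.
  - exact: b0.
  - by move=> n /G0 Gn0; rewrite /tw /ps_map Gn0 rmorph0.
  by rewrite /tw /ps_map frE.
have [j1 nz1 min1] := @arg_minnP _ ja (fun j => (b j)`_a != 0) (fun j : 'I_l.+1 => nat_of_ord j) nzba.
have Gi_gt0 : 0 < abs (G i) by rewrite (abs_gt0 Habs).
have liou : 1 <= abs (b j1)`_a * Th ^+ (c * Hb.+1) by apply: (ft_liouville filtT) => //; apply: Tb.
have [ge1 | lt1] := lerP 1 (abs (G i)).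
  by rewrite -[1]mulr1; apply: ler_pM => //; apply: ThX_ge1.
have eq1 : (b j1)`_a * G i ^+ (q ^ j1) = - \sum_(j | j != j1) (b j)`_a * G i ^+ (q ^ j).
  by move/eqP: sumq; rewrite (bigD1 j1) //= addr_eq0 => /eqP.
have le_b : abs (b j1)`_a <= Th ^+ (Hb + c) * abs (G i).
  rewrite -(ler_pM2r (exprn_gt0 (q ^ j1) Gi_gt0)) -(absX Habs (G i) (q ^ j1)) -(absM Habs) eq1.
  rewrite (absN Habs); apply: (abs_sum_le Habs).
    by rewrite !mulr_ge0 ?(abs_ge0 Habs) ?(ThX_ge0 Htheta).
  move=> j _ ne_j; have [-> | nzj] := eqVneq (b j)`_a 0.
    by rewrite mul0r (abs0 Habs) !mulr_ge0 ?(abs_ge0 Habs) ?(ThX_ge0 Htheta).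
  have lt_j : (j1 < j)%N by rewrite ltn_neqAle eq_sym val_eqE ne_j min1.
  rewrite (absM Habs) -mulrA; apply: ler_pM; rewrite ?(abs_ge0 Habs) //.
    by apply: (ft_upper filtT); apply: Tb.
  rewrite !(absX Habs) -exprS; apply: ler_wiXn2l; rewrite ?(abs_ge0 Habs) ?(ltW lt1) //.
  by rewrite ltn_exp2l // (q_gt1 chC e_gt0).
apply: le_trans liou _; rewrite exprD mulrA ler_wpM2r ?(ThX_ge0 Htheta) //.
by rewrite mulrC.
Qed.

End Auxiliary.

Lemma abp_integral : exists g : 'I_l -> {poly C}, exists n,
  [/\ forall i j, Kbar (g i)`_j, exists i, g i != 0 & \sum_i of_poly (g i) * tw n (psi i 0) = 0].
Proof.
have [Cp Hpsi] : exists Cp, forall i, bnd Th (psi i 0) (Th ^+ Cp).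
  have ex_C i : exists Ci, bnd Th (psi i 0) (Th ^+ Ci).
    have [X X_gt0 HX] := conv_bnd (conv_psi i); have [Ci HCi] := Hcof X.
    by exists Ci => j; apply: le_trans (HX j) HCi.
  have [Ci HCi] := choice ex_C; exists (\max_i Ci i) => i j.
  by apply: le_trans (HCi i j) _; apply: ThX_le => //; apply: leq_bigmax.
pose Kg := (2 * l * (c * (3 + D)) + c)%N.
pose Kb := ((2 * l).+1 * ((Kg + c) * q ^ l) + c)%N.
(* All heights are at most constants times [Q], and [Kg], [Kb] do not involve [k], whereas the
   Schwarz lemma gains [k * Q]. This [k] exceeds the sum of the constants, so a nonzero [G] would
   contradict [G_small] and [G_large]. *)
pose k := (Kg + c + Cp + 1 + Kb + c + c * Kb + c + 1)%N.
have k_gt0 : (0 < k)%N by rewrite /k addn1.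
have [g [cc [sg hg nzg gz]]] := siegel_first k_gt0.
exists g, (2 * (2 * l * k))%N; split=> //.
  by move=> i j; apply: (ft_Kbar filtT (hg i j)).
have [// | /ps_order [i [nzi G0]]] := eqVneq (\sum_i of_poly (g i) * tw (2 * (2 * l * k)) (psi i 0)) 0.
have small := G_small k_gt0 sg hg gz Hpsi nzi G0; have large := G_large k_gt0 sg hg nzi G0.
set Q := (q ^ (2 * (2 * l * k)))%N in small large *.
have Q_gt0 : (0 < Q)%N by apply: (qn_gt0 e chC).
set Hg := (2 * l * (c * (3 + D) * Q) + c)%N in small large.
set Hb := (_ * _ + c)%N in large.
have le_Hg : (Hg <= Kg * Q)%N.
  by rewrite /Kg mulnDl leq_add ?leq_pmulr // [leqLHS]mulnA.
have le_Hb : (Hb <= Kb * Q)%N.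
  rewrite /Kb mulnDl leq_add // ?leq_pmulr // -mulnA leq_mul2l; apply/orP; right.
  by rewrite mulnAC leq_mul2r mulnDl leq_add2r le_Hg orbT.
have lt_k : (Hg + c + (Cp + 1) * Q + (Hb + c + c * Hb.+1) < k * Q)%N.
  have le_cQ : (c <= c * Q)%N by rewrite leq_pmulr.
  have le_cHb : (c * Hb.+1 <= c * Kb * Q + c * Q)%N.
    by rewrite mulnS addnC leq_add // -mulnA leq_mul2l le_Hb orbT.
  have arith x y kg kb cq ckq ch cp r : (x <= kg -> y <= kb -> c <= cq -> ch <= ckq + cq -> 0 < r ->
      x + c + (cp + r) + (y + c + ch) < kg + cq + cp + r + kb + cq + ckq + cq + r)%N by clear; lia.
  have kQ a b c1 c2 x r : ((a + c1 + x + 1 + b + c1 + c2 + c1 + 1) * r =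
      a * r + c1 * r + x * r + r + b * r + c1 * r + c2 * r + c1 * r + r)%N.
    by rewrite !mulnDl !mul1n.
  rewrite [in ltnRHS]/k kQ mulnDl mul1n; exact: arith.
have := ler_pM ler01 (ThX_ge0 Htheta (k * Q)) large (lexx _).
rewrite mul1r mulrAC => le1; have := le_trans le1 (ler_wpM2r (ThX_ge0 Htheta _) small).
by rewrite -exprD leNgt (ThX_lt Htheta).
Qed.

End Integral.
End Criterion.

Theorem abp_criterion l (B : 'M[{poly C}]_l) (psi : 'cV[pser C]_l) (v rho : 'I_l -> C) :
  (forall i, conv Th (psi i 0)) ->
  psi = map_mx (@of_poly C) B *m map_mx (tw 1) psi ->
  (forall z, z != theta ^+ q -> forall r : 'rV[C]_l, r *m map_mx (horner_eval z) B = 0 -> r = 0) ->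
  (forall i j k, Kbar (B i j)`_k) ->
  (forall i, evat abs Th theta (psi i 0) (v i)) ->
  (forall i, Kbar (rho i)) -> (exists i, rho i != 0) -> \sum_i rho i * v i = 0 ->
  exists g : 'I_l -> {poly C}, [/\ forall i j, Kbar (g i)`_j, exists i, g i != 0 &
    \sum_i of_poly (g i) * psi i 0 = 0].
Proof.
move=> cpsi psi_eq Bnd KB Hev Krho [i0 nzrho] Hrho.
have sK := Kbar_subfield e chC theta.
pose s := [seq rho i | i <- enum 'I_l] ++
  flatten [seq (B ij.1 ij.2 : seq C) | ij <- enum {: 'I_l * 'I_l}].
have [|T [c [filtT [D0 [nzD0 KD0] TD0]]]] := @filtration_exists _ _ _ Habs _ _ chC e_gt0 _ Htheta Hcof s.
  move=> x; rewrite mem_cat => /orP[/mapP[i _ ->] // | /flattenP[_ /mapP[[i j] _ ->] /=]].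
  by move/(nthP 0) => [k _ <-].
(* Denominators are cleared by rescaling the solution: since [D0 * eta ^+ q = eta], the vector
   [eta * psi] satisfies the same kind of equation with [D0 * B] for [B]. *)
have [eta Heta] := root_exists D0^-1 (ltac:(by rewrite subn_gt0 (q_gt1 chC e_gt0)) : (0 < q - 1)%N).
have nzeta : eta != 0.
  apply: contraNneq nzD0 => eta0; move/eqP: Heta.
  by rewrite eta0 expr0n subn_eq0 leqNgt (q_gt1 chC e_gt0) eq_sym invr_eq0.
have etaq : D0 * eta ^+ q = eta.
  by rewrite -[X in eta ^+ X](subnK (ltnW (q_gt1 chC e_gt0))) exprD expr1 Heta mulrA mulfV // mul1r.
pose E := of_poly eta%:P.
have twE n : tw n E = of_poly (eta ^+ (q ^ n))%:P by rewrite tw_of_poly map_polyC /= frE.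
have TBD : forall i j k, T c ((D0%:P *: B) i j)`_k.
  move=> i j k; rewrite mxE coefCM; have [lt_k | le_k] := ltnP k (size (B i j)); last first.
    by rewrite nth_default // mulr0; apply: (ft0 filtT).
  apply: TD0; rewrite mem_cat; apply/orP; right; apply/flattenP.
  exists (B i j : seq C); last exact: mem_nth.
  by apply/mapP; exists (i, j); rewrite ?mem_enum.
pose D := \max_(ij : 'I_l * 'I_l) size (B ij.1 ij.2).
have sBD i j : (size ((D0%:P *: B) i j) <= D.+1)%N.
  rewrite mxE mul_polyC (leq_trans (size_scale_leq _ _)) // leqW //.
  exact: (leq_bigmax (i, j)).
have [|||||||g [n [Kg [i1 nzg] sum0]]] := @abp_integral l (D0%:P *: B) (E *: psi) _ _ _ T c filtT D TBD
  sBD (fun i => eta * v i) (fun i => D0 * rho i).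
- by move=> i; rewrite mxE; apply: convM => //; [exact: Th_gt0 | exact: conv_poly].
- rewrite {1}psi_eq; apply/matrixP => i j; rewrite !mxE mulr_sumr; apply: eq_bigr => a _.
  rewrite !mxE [of_poly (_ * B i a)]rmorphM [tw 1 (_ * _)]rmorphM /= twE expn1 /E.
  rewrite mulrACA -[of_poly D0%:P * _]rmorphM -polyCM etaq.
  by rewrite !mulrA.
- move=> z nz r Hr; apply: (Bnd z nz); apply/matrixP => i j.
  have /matrixP /(_ i j) := Hr; rewrite !mxE => Hij.
  apply: (mulfI nzD0); rewrite mulr0 -[RHS]Hij mulr_sumr; apply: eq_bigr => a _.
  by rewrite !mxE /horner_eval hornerM hornerC mulrCA.
- move=> i; rewrite mxE; apply: evatM => //; first exact: Th_gt0.
  by rewrite -[X in evat _ _ _ _ X](hornerC eta theta); apply: evat_poly.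
- transitivity (D0 * eta * \sum_i rho i * v i); last by rewrite Hrho mulr0.
  by rewrite mulr_sumr; apply: eq_bigr => i _; ring.
- by move=> i; apply: TD0; rewrite mem_cat; apply/orP; left; apply/mapP; exists i; rewrite ?mem_enum.
- by exists i0; rewrite mulf_neq0.
(* The relation obtained is between the [n]-th twists; the [q ^ n]-th roots of its coefficients stay
   in [Kbar] and give one between the functions themselves. *)
have [g' Hg'] := choice (fun i => map_fr_surj e chC n (g i)).
exists g'; split.
- move=> i j; apply: (Kbar_root chC (qn_gt0 e chC n)); rewrite -(frE e chC).
  by rewrite -coef_map Hg'.
- by exists i1; apply: contraNneq nzg => g0; rewrite -Hg' g0 rmorph0.
have : tw n (E * \sum_i of_poly (g' i) * psi i 0) = tw n 0.
  rewrite mulr_sumr !rmorph_sum rmorph0 -[RHS]sum0; apply: eq_bigr => i _.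
  by rewrite !rmorphM /= tw_of_poly Hg' mxE rmorphM mulrCA.
move/(@tw_inj _ _ e chC n)/(@ps_mulf_eq0 C) => [E0 | //].
by case/negP: (of_poly_neq0 (p := eta%:P) (ltac:(by rewrite polyC_eq0) : eta%:P != 0)); apply/eqP.
Qed.

End ABP.

(** * Series fixed by Frobenius *)

Section Inverse.
Variables (C : fieldType) (g : pser C).

Fixpoint inv_coefs n : seq C :=
  if n is n'.+1 then
    rcons (inv_coefs n')
      ((g 0%N)^-1 * ((n' == 0%N)%:R - \sum_(i < n') (inv_coefs n')`_i * g (n' - i)%N))
  else [::].

Lemma size_inv_coefs n : size (inv_coefs n) = n.
Proof. by elim: n => //= n IHn; rewrite size_rcons IHn. Qed.

Lemma nth_inv_coefs n i : (i < n)%N -> (inv_coefs n)`_i = (inv_coefs i.+1)`_i.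
Proof.
elim: n => // n IHn; rewrite ltnS leq_eqVlt => /predU1P[-> // | lt_in].
by rewrite -[LHS]/((rcons _ _)`_i) nth_rcons size_inv_coefs lt_in IHn.
Qed.

Lemma ps_inverse : g 0%N != 0 -> exists h, h * g = 1.
Proof.
move=> nz_g; exists (fun n => (inv_coefs n.+1)`_n : C); apply/funext => n.
rewrite psM big_ord_recr /= subnn nth_rcons size_inv_coefs ltnn eqxx.
rewrite (eq_bigr (fun i : 'I_n => (inv_coefs n)`_i * g (n - i)%N)); last first.
  by move=> i _; rewrite [in RHS]nth_inv_coefs.
by rewrite mulrAC mulVf // mul1r addrC subrK.
Qed.

End Inverse.

Section Constants.
Variables (C : closedFieldType) (R : realFieldType) (abs : C -> R).
Hypothesis Habs : nonarch_abs abs.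
Variables (p e : nat) (chC : p \in [pchar C]) (e_gt0 : (0 < e)%N).
Local Notation q := (p ^ e)%N.
Local Notation Fq := (in_Fq q : C -> Prop).
Local Notation sFq := (Fq_subfield e chC).
Local Notation tw := (tw e chC).

Lemma Fq_finite : exists rs : seq C, forall x, Fq x -> x \in rs.
Proof.
have q1 := q_gt1 chC e_gt0.
have [rs Hrs] := closed_field_poly_normal ('X^q - 'X : {poly C}); exists rs => x Fx.
have nz : ('X^q - 'X : {poly C}) != 0.
  rewrite -size_poly_gt0 size_polyDl size_polyXn // size_polyN size_polyX ltnS //.
have : root ('X^q - 'X) x by rewrite /root !hornerE Fx subrr.
by rewrite Hrs rootZ ?lead_coef_eq0 // root_prod_XsubC.
Qed.

(** Let [s] be the least index at which [abs (g s)] is maximal. For large [n] the coefficient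
    [f n = \sum_i g i * c (n - i)] is smaller than [abs (g s)], and distinct elements of [Fq] are at
    distance 1; so [c (n - s)] is determined by the [c (n - i)] with [s < i < m], where [m] is such
    that later terms are negligible. A recursion of finite memory over a finite field is eventually
    periodic. *)
Lemma Fq_series_rational (c g f : pser C) : (forall i, Fq (c i)) -> g != 0 ->
  conv abs 1 g -> conv abs 1 f -> c * g = f ->
  exists n P, (0 < P)%N /\ forall i, (n <= i)%N -> c (i + P)%N = c i.
Proof.
move=> Fc nzg cg cf defF; have [b [nzgb _]] := ps_order nzg.
have abs1X (h : pser C) i : abs (h i) * 1 ^+ i = abs (h i) by rewrite expr1n mulr1.
have small (h : pser C) eps : 0 < eps -> conv abs 1 h -> exists N, forall i, (N <= i)%N -> abs (h i) < eps.
  by move=> eps_gt0 /(_ eps eps_gt0) [N HN]; exists N => i /HN; rewrite abs1X.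
have ex_s : exists s, `[< forall i, abs (g i) <= abs (g s) >].
  have gb_gt0 : 0 < abs (g b) by rewrite (abs_gt0 Habs).
  have [N HN] := small _ _ gb_gt0 cg.
  have [s _ Hs] := @Order.TotalTheory.arg_maxP _ _ 'I_(maxn N b).+1 ord0 xpredT (fun i => abs (g i)) isT.
  exists s; apply/asboolP => i; have [lt_i | le_i] := ltnP i (maxn N b).+1.
    exact: (Hs (Ordinal lt_i)).
  apply: le_trans (ltW (HN i _)) _; first by rewrite (leq_trans (leq_maxl N b)) // ltnW.
  have lt_b : (b < (maxn N b).+1)%N by rewrite ltnS leq_maxr.
  exact: (Hs (Ordinal lt_b)).
case: (ex_minnP ex_s) => s /asboolP max_s min_s.
have gs_gt0 : 0 < abs (g s) by apply: lt_le_trans (max_s b); rewrite (abs_gt0 Habs).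
have lt_s i : (i < s)%N -> abs (g i) < abs (g s).
  move=> lt_is; rewrite lt_neqAle max_s andbT; apply/eqP => eq_i.
  by have := min_s i; rewrite leqNgt lt_is => /(_ _)/negP; apply=> //; apply/asboolP => j; rewrite eq_i.
have [m0 Hm0] := small _ _ gs_gt0 cg; have [n0 Hn0] := small _ _ gs_gt0 cf.
pose m := (maxn m0 s.+1); have lt_sm : (s < m)%N by rewrite leq_maxr.
have Hm i : (m <= i)%N -> abs (g i) < abs (g s).
  by move=> le_mi; apply: Hm0; apply: leq_trans le_mi; apply: leq_maxl.
pose c' n i := if (i <= n)%N then c (n - i)%N else 0.
have Fc' n i : Fq (c' n i) by rewrite /c'; case: ifP => // _; apply: (sf0 sFq).
have fE L n : (n < L)%N -> f n = \sum_(i < L) g i * c' n i.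
  move=> lt_nL; rewrite -defF mulrC psM (big_ord_widen_cond L (fun=> true) (fun i => g i * c (n - i)%N)) //.
  rewrite big_mkcond; apply: eq_bigr => i _ /=; rewrite /c' ltnS.
  by case: ifP => //; rewrite mulr0.
pose n1 := maxn n0 m.
have determ n n' : (n1 <= n)%N -> (n1 <= n')%N ->
    (forall i, (s < i < m)%N -> c (n - i)%N = c (n' - i)%N) -> c (n - s)%N = c (n' - s)%N.
  move=> le_n le_n' eq_c; pose L := (maxn n n').+1.
  have le_m x : (n1 <= x)%N -> (m <= x)%N by apply: leq_trans; apply: leq_maxr.
  have le_n0 x : (n1 <= x)%N -> (n0 <= x)%N by apply: leq_trans; apply: leq_maxl.
  have lt_sL : (s < L)%N.
    by rewrite ltnS (leq_trans (ltnW lt_sm)) // (leq_trans (le_m _ le_n)) // leq_maxl.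
  have c's x : (n1 <= x)%N -> forall i, (i <= m)%N -> c' x i = c (x - i)%N.
    by move=> /le_m le_x i le_i; rewrite /c' (leq_trans le_i).
  have diff : f n - f n' = \sum_(i < L) g i * (c' n i - c' n' i).
    rewrite (fE L n) ?ltnS ?leq_maxl // (fE L n') ?ltnS ?leq_maxr // -sumrB.
    by apply: eq_bigr => i _; rewrite mulrBr.
  have Fd i : Fq (c' n i - c' n' i) by apply: (sfB sFq).
  have lt_d : abs (g s * (c' n s - c' n' s)) < abs (g s).
    have -> : g s * (c' n s - c' n' s) =
        f n - f n' - \sum_(i < L | i != Ordinal lt_sL) g i * (c' n i - c' n' i).
      by rewrite diff (bigD1 (Ordinal lt_sL)) //= addrK.
    apply: (absB_lt Habs); first by apply: (absB_lt Habs); apply: Hn0; apply: le_n0.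
    apply: (abs_sum_lt Habs) => // i _ ne_is.
    rewrite (absM Habs); case: (boolP (s < i < m)%N) => [in_i | ].
      have le_im : (i <= m)%N by case/andP: in_i => _ /ltnW.
      by rewrite !c's // eq_c // subrr (abs0 Habs) mulr0.
    rewrite negb_and -!leqNgt => out_i; apply: (@le_lt_trans _ _ (abs (g i))).
      rewrite -[leRHS]mulr1 ler_wpM2l ?(abs_ge0 Habs) //.
      exact: (Fq_abs_le Habs chC e_gt0).
    case/orP: out_i => [|/Hm //]; rewrite leq_eqVlt => /predU1P [eq_i | /lt_s //].
    by case/eqP: ne_is; apply/val_inj.
  apply/eqP; rewrite -subr_eq0 -!c's ?(ltnW lt_sm) //; apply: contraTT lt_d => nzd.
  by rewrite (absM Habs) (Fq_abs Habs chC e_gt0 (Fd s) nzd) mulr1 ltxx.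
have propagate n n' : (n1 <= n)%N -> (n1 <= n')%N ->
    (forall i, (s < i < m)%N -> c (n - i)%N = c (n' - i)%N) ->
    forall k, c (n + k - s)%N = c (n' + k - s)%N.
  move=> le_n le_n' eq_c k.
  have le_m x : (n1 <= x)%N -> (m <= x)%N by apply: leq_trans; apply: leq_maxr.
  suff st : forall i, (s <= i < m)%N -> c (n + k - i)%N = c (n' + k - i)%N by apply: st; rewrite leqnn.
  elim: k => [|k IHk] i /andP[le_si lt_im].
    rewrite !addn0; move: le_si; rewrite leq_eqVlt => /predU1P[<- | lt_si]; first exact: determ.
    by apply: eq_c; rewrite lt_si.
  have shift j : (s < j < m)%N -> c (n + k.+1 - j)%N = c (n' + k.+1 - j)%N.
    case: j => [|j]; first by rewrite ltn0.
    by move=> /andP[lt_sj lt_jm]; rewrite !addnS !subSS; apply: IHk; rewrite -ltnS lt_sj ltnW.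
  move: le_si; rewrite leq_eqVlt => /predU1P[<- | lt_si]; last by apply: shift; rewrite lt_si.
  by apply: determ => //; [apply: leq_trans le_n _ | apply: leq_trans le_n' _]; apply: leq_addr.
have [rs Hrs] := Fq_finite.
pose state n : {ffun 'I_m -> 'I_(size rs).+1} := [ffun i : 'I_m => inord (index (c (n - i)%N) rs)].
have state_eq n n' : state n = state n' -> forall i, (i < m)%N -> c (n - i)%N = c (n' - i)%N.
  move=> eq_st i lt_i; have := congr1 (fun F : {ffun 'I_m -> 'I_(size rs).+1} => val (F (Ordinal lt_i))) eq_st.
  rewrite !ffunE /= !inordK ?ltnS ?index_size // => eq_ind.
  by rewrite -(nth_index 0 (Hrs _ (Fc (n - i)%N))) eq_ind nth_index //; apply: Hrs.
pose K := #|{ffun 'I_m -> 'I_(size rs).+1}|.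
have /injectivePn [x [y ne_xy eq_xy]] : ~~ injectiveb (fun x : 'I_K.+1 => state (n1 + x)%N).
  by apply/injectiveP => /leq_card; rewrite card_ord ltnn.
wlog lt_xy : x y ne_xy eq_xy / (x < y)%N.
  move=> W; case: (ltngtP x y) => [lt_xy | lt_yx | /val_inj eq]; first exact: (W x y).
    by apply: (W y x) => //; rewrite eq_sym.
  by rewrite eq eqxx in ne_xy.
exists (n1 + x - s)%N, (y - x)%N; split; first by rewrite subn_gt0.
move=> i le_i.
have H : forall j, (s < j < m)%N -> c (n1 + x - j)%N = c (n1 + y - j)%N.
  by move=> j /andP[_ lt_jm]; apply: state_eq.
have := propagate (n1 + x)%N (n1 + y)%N (leq_addr _ _) (leq_addr _ _) H (i - (n1 + x - s))%N.
have le_s : (s <= n1 + x)%N.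
  by rewrite (leq_trans (ltnW lt_sm)) // (leq_trans (leq_maxr n0 m)) // leq_addr.
have -> : (n1 + x + (i - (n1 + x - s)) - s = i)%N by move: le_s le_i; clear; lia.
have -> : (n1 + y + (i - (n1 + x - s)) - s = i + (y - x))%N by move: le_s le_i lt_xy; clear; lia.
by [].
Qed.

(** Once a power of [X] is split off [g], the quotient is a power series fixed by Frobenius, so its
    coefficients lie in [Fq]. By [Fq_series_rational] they are eventually periodic, and
    multiplication by [1 - X^P], with [P] the period, yields a polynomial. *)
Lemma fixed_quotient (f g : pser C) : conv abs 1 f -> conv abs 1 g -> g != 0 ->
  f * tw 1 g = g * tw 1 f ->
  exists al be : {poly C}, [/\ pOver Fq al, pOver Fq be, be != 0 & of_poly be * f = of_poly al * g].
Proof.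
move=> cf cg nzg eq_fg; have [b [nzgb g0]] := ps_order nzg.
pose g1 : pser C := fun i => g (i + b)%N.
have gE : g = of_poly 'X^b * g1.
  apply/funext => i; rewrite psXnM; case: ltnP => [/g0 // | le_bi].
  by rewrite /g1 subnK.
have cg1 : conv abs 1 g1.
  move=> eps /cg [N HN]; exists N => i le_i; have := HN (i + b)%N (leq_trans le_i (leq_addr _ _)).
  by rewrite !expr1n.
have nzg1 : g1 != 0 by apply: contraNneq nzg => g10; rewrite gE g10 mulr0.
have [h Hh] : exists h, h * g1 = 1 by apply: ps_inverse; rewrite /g1 add0n.
pose c := h * f; have defF : c * g1 = f by rewrite mulrAC Hh mul1r.
have nzX : of_poly 'X^b != 0 :> pser C by apply: of_poly_neq0; rewrite -size_poly_gt0 size_polyXn.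
have twX : tw 1 (of_poly 'X^b) = of_poly 'X^b by rewrite tw_of_poly map_polyXn.
have eq1 : f * tw 1 g1 = g1 * tw 1 f.
  apply: (ps_mulfI nzX); move: eq_fg; rewrite gE rmorphM /= twX => E.
  by rewrite mulrCA E mulrA.
have nztw : tw 1 g1 != 0.
  by apply: contraNneq nzg1 => tw0; apply/eqP; apply: (@tw_inj _ _ e chC 1); rewrite tw0 rmorph0.
have twc : tw 1 c = c.
  apply: (ps_mulfI nzg1); apply: (ps_mulfI nztw).
  rewrite [g1 * c]mulrC defF [RHS]mulrC eq1 -[in RHS]defF [tw 1 (c * g1)]rmorphM /=; ring.
have Fc i : Fq (c i).
  by have := congr1 (fun s : pser C => s i) twc; rewrite /tw /ps_map frE expn1.
have [n [P [P_gt0 per]]] := Fq_series_rational Fc nzg1 cg1 cf defF.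
pose d : {poly C} := 1 - 'X^P.
have Fd : pOver Fq d by apply: (pOverB sFq); [apply: (pOver1 sFq) | apply: (pOver_exp sFq); apply: (pOverX sFq)].
pose al := \poly_(i < n + P) (of_poly d * c) i.
have alE : of_poly al = of_poly d * c.
  apply/funext => i; rewrite /of_poly coef_poly; case: ltnP => // le_i.
  rewrite -/(of_poly d) rmorphB rmorph1 mulrBl mul1r psB psXnM.
  have le_P : (P <= i)%N by rewrite (leq_trans _ le_i) // leq_addl.
  rewrite ltnNge le_P /=; apply/esym/eqP; rewrite subr_eq0; apply/eqP.
  rewrite -[in LHS](subnK le_P); apply: per.
  by rewrite leq_subRL // addnC.
exists al, (d * 'X^b); split.
- apply: (pOver_poly sFq) => i; rewrite psM; apply: (sf_sum sFq) => j _.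
  by apply: (sfM sFq) => //; apply: Fd.
- by apply: (pOverM sFq) => //; apply: (pOver_exp sFq); apply: (pOverX sFq).
- rewrite mulf_neq0 //; last by rewrite -size_poly_gt0 size_polyXn.
  apply/eqP => /(congr1 (fun r : {poly C} => r`_0)) /eqP.
  by rewrite coefB coef1 coefXn coef0 (ltn_eqF P_gt0) subr0 oner_eq0.
- by rewrite alE gE -defF rmorphM; ring.
Qed.

End Constants.

(** * Substitutions in polynomials *)

Section MPolyTools.
Variables (n : nat) (S : idomainType).
Local Notation MP := {mpoly S[n]}.

Lemma mpoly_rmorph_ext (R' : nzRingType) (A : comNzRingType) (phi psi : {rmorphism {mpoly R'[n]} -> A}) :
  (forall c, phi c%:MP = psi c%:MP) -> (forall i, phi 'X_i = psi 'X_i) -> phi =1 psi.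
Proof.
move=> eqC eqX P; rewrite (mpolyE P) !rmorph_sum; apply: eq_bigr => m _.
rewrite -mul_mpolyC !rmorphM eqC; congr (_ * _); rewrite mpolyXE_id !rmorph_prod.
by apply: eq_bigr => i _; rewrite !rmorphXn eqX.
Qed.

Definition msub (s : 'I_n -> MP) : MP -> MP := mmap (@mpolyC n S) s.
HB.instance Definition _ s := GRing.RMorphism.copy (msub s) (mmap (@mpolyC n S) s).

Lemma msubC s c : msub s c%:MP = c%:MP. Proof. exact: mmapC. Qed.
Lemma msubX s i : msub s 'X_i = s i. Proof. by rewrite /msub mmapX mmap1U. Qed.

Lemma msubD s P Q : msub s (P + Q) = msub s P + msub s Q. Proof. exact: rmorphD. Qed.
Lemma msubM s P Q : msub s (P * Q) = msub s P * msub s Q. Proof. exact: rmorphM. Qed.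
Lemma msubE s P k : msub s (P ^+ k) = msub s P ^+ k. Proof. exact: rmorphXn. Qed.
Lemma msub0 s : msub s 0 = 0. Proof. exact: rmorph0. Qed.

Definition mfree (P : MP) (v : 'I_n) := forall m, m \in msupp P -> m v = 0%N.

Lemma mmap_agree (A : comNzRingType) (f : S -> A) (s s' : 'I_n -> A) P :
  (forall u, mfree P u \/ s u = s' u) -> mmap f s P = mmap f s' P.
Proof.
move=> agree; rewrite /mmap big_seq [RHS]big_seq; apply: eq_bigr => m Pm; congr (_ * _).
by apply: eq_bigr => u _; case: (agree u) => [free_u | -> //]; rewrite free_u ?expr0.
Qed.

(** As a polynomial in the translation parameter, the translate of [P] minus [P] has infinitely many
    roots, hence vanishes; the parameter [- 'X_v] then erases [v] from [P]. *)
Lemma mfree_shift P v (a : nat -> S) : injective a ->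
  (forall k, msub (fun u => if u == v then 'X_v + (a k)%:MP else 'X_u) P = P) -> mfree P v.
Proof.
move=> inj_a shiftP.
pose F : {rmorphism S -> {poly MP}} := (@polyC MP \o @mpolyC n S).
pose G := mmap F (fun u => if u == v then ('X_v)%:P + 'X else ('X_u)%:P).
have hornerG z : (G P).[z] = msub (fun u => if u == v then 'X_v + z else 'X_u) P.
  apply: (@mpoly_rmorph_ext S MP (horner_eval z \o G)
    (msub (fun u => if u == v then 'X_v + z else 'X_u))) => [c | u] /=.
    by rewrite /horner_eval /G mmapC hornerC msubC.
  rewrite /horner_eval /G mmapX mmap1U msubX; case: eqP => _; last by rewrite hornerC.
  by rewrite hornerD hornerC hornerX.
have GP : G P = P%:P.
  apply/eqP; rewrite -subr_eq0; apply: contraTT isT => nz.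
  pose rs := [seq (a k)%:MP : MP | k <- iota 0 (size (G P - P%:P))].
  have urs : uniq rs.
    by rewrite map_inj_uniq ?iota_uniq // => k k' /(can_inj (@mpolyCK n S)) /inj_a.
  have rrs : all (root (G P - P%:P)) rs.
    by apply/allP => _ /mapP[k _ ->]; rewrite /root hornerD hornerN hornerC hornerG shiftP subrr.
  by have := max_poly_roots nz rrs urs; rewrite size_map size_iota ltnn.
have := hornerG (- 'X_v); rewrite GP hornerC => killP m Pm; apply/eqP.
case: posnP => // mv_gt0; move: Pm; rewrite mcoeff_msupp {1}killP.
rewrite /msub /mmap raddf_sum big1 ?eqxx //= => m' _; rewrite mcoeffCM.
suff -> : (mmap1 (fun u => if u == v then 'X_v - 'X_v else 'X_u) m')@_m = 0 :> S by rewrite mulr0.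
have [m'v0 | m'v_gt0] := posnP (m' v); last first.
  rewrite /mmap1 (bigD1 v) //= eqxx subrr expr0n (gtn_eqF m'v_gt0) mul0r mcoeff0 //.
have -> : mmap1 (fun u => if u == v then 'X_v - 'X_v else 'X_u : MP) m' = 'X_[m'].
  rewrite /mmap1 [RHS]mpolyXE_id; apply: eq_bigr => u _; case: eqP => // ->.
  by rewrite m'v0 !expr0.
rewrite mcoeffX; case: eqP => // eq_m; by rewrite -eq_m m'v0 in mv_gt0.
Qed.

(** * Weighted degrees and leading forms *)

Section Weights.
Variable wt : 'I_n -> nat.
Definition mwt (m : 'X_{1..n}) : nat := \sum_i m i * wt i.
Definition wlt D (P : MP) := forall m, m \in msupp P -> (mwt m < D)%N.

Lemma mwtD a b : mwt (a + b)%MM = (mwt a + mwt b)%N.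
Proof. by rewrite /mwt -big_split; apply: eq_bigr => i _; rewrite mnmDE mulnDl. Qed.

Lemma wlt_coef D P m : wlt D P -> (D <= mwt m)%N -> P@_m = 0.
Proof. by move=> wP; rewrite leqNgt => /negP Hm; apply: memN_msupp_eq0; apply/negP => /wP. Qed.
Lemma wlt_coefP D P : (forall m, (D <= mwt m)%N -> P@_m = 0) -> wlt D P.
Proof. by move=> H m; rewrite mcoeff_msupp ltnNge; apply: contra => /H ->; rewrite eqxx. Qed.
Lemma wlt0 D : wlt D 0. Proof. by move=> m; rewrite msupp0. Qed.
Lemma wltD D P Q : wlt D P -> wlt D Q -> wlt D (P + Q).
Proof. by move=> HP HQ; apply: wlt_coefP => m le_D; rewrite mcoeffD !(wlt_coef _ le_D) ?addr0. Qed.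
Lemma wltN D P : wlt D P -> wlt D (- P).
Proof. by move=> HP; apply: wlt_coefP => m le_D; rewrite mcoeffN (wlt_coef HP le_D) oppr0. Qed.
Lemma wltB D P Q : wlt D P -> wlt D Q -> wlt D (P - Q).
Proof. by move=> HP HQ; apply: wltD => //; apply: wltN. Qed.
Lemma wlt_mono D D' P : (D <= D')%N -> wlt D P -> wlt D' P.
Proof. by move=> le_D HP m /HP /leq_trans; apply. Qed.
Lemma wltM D D' P Q : wlt D.+1 P -> wlt D' Q -> wlt (D + D') (P * Q).
Proof.
move=> HP HQ m /msuppM_le /allpairsP[[a b] /= [/HP ltP /HQ ltQ ->]].
by rewrite mwtD -addnS leq_add // -ltnS.
Qed.
Lemma wltC c : wlt 1 c%:MP.
Proof.
apply: wlt_coefP => m; rewrite mcoeffC; case: eqP => [-> | _]; last by rewrite mulr0.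
by rewrite /mwt big1 // => i _; rewrite mnm0E mul0n.
Qed.
Lemma wltX v : wlt (wt v).+1 'X_v.
Proof.
move=> m /mem_msuppXP <-; rewrite ltnS /mwt (bigD1 v) //= mnm1E eqxx mul1n big1 ?addn0 // => i ne_i.
by rewrite mnm1E eq_sym (negPf ne_i) mul0n.
Qed.
Lemma wltCM D c P : wlt D P -> wlt D (c%:MP * P).
Proof. by move=> HP; have := wltM (@wltC c) HP. Qed.

Variables (cst : 'I_n -> S) (r s : 'I_n -> MP).
Hypothesis sE : forall v, s v = (cst v)%:MP * 'X_v + r v.
Hypothesis wr : forall v, wlt (wt v) (r v).

(** Same leading form in weight [D]. *)
Let eqtop D P Q := [/\ wlt D.+1 P, wlt D.+1 Q & wlt D (P - Q)].

Let eqtopM D D' P Q P' Q' : eqtop D P Q -> eqtop D' P' Q' -> eqtop (D + D') (P * P') (Q * Q').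
Proof.
move=> [wP wQ wPQ] [wP' wQ' wPQ']; split; rewrite -?addnS; try exact: wltM.
have -> : P * P' - Q * Q' = (P - Q) * P' + Q * (P' - Q') by ring.
apply: wltD; last exact: wltM.
by rewrite mulrC addnC; apply: wltM.
Qed.

Let eqtop1 : eqtop 0 1 1.
Proof. by split; rewrite ?subrr -?mpolyC1; [exact: wltC | exact: wltC | exact: wlt0]. Qed.

Let eqtopX D P Q k : eqtop D P Q -> eqtop (k * D) (P ^+ k) (Q ^+ k).
Proof.
move=> H; elim: k => [|k IHk]; first by rewrite mul0n !expr0.
by rewrite mulSn !exprS; apply: eqtopM.
Qed.

Lemma msub_mon a : eqtop (mwt a) (mmap1 s a) (mmap1 (fun v => (cst v)%:MP * 'X_v) a).
Proof.
rewrite /mmap1 /mwt; elim/big_rec3: _ => [|v x y D _ IH]; first exact: eqtop1.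
apply: eqtopM IH; apply: eqtopX; rewrite sE; split.
- apply: wltD; first by apply: wltCM; apply: wltX.
  by apply: (wlt_mono (leqnSn (wt v))); apply: wr.
- by apply: wltCM; apply: wltX.
- by rewrite addrC addKr.
Qed.

(** A substitution that is diagonal up to lower weight does not mix monomials of top weight. It
    serves for [sig], where only [o] has a nontrivial factor, and for [grp], where all factors are
    1. *)
Lemma msub_top D P : wlt D.+1 P -> wlt D.+1 (msub s P) /\
  forall m, mwt m = D -> (msub s P)@_m = P@_m * \prod_v cst v ^+ m v.
Proof.
move=> wP; have mon a : mmap1 (fun v => (cst v)%:MP * 'X_v) a = (\prod_v cst v ^+ a v)%:MP * 'X_[a] :> MP.
  rewrite mpolyXE_id rmorph_prod -big_split; apply: eq_bigr => v _ /=.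
  by rewrite exprMn rmorphXn.
split.
  apply: wlt_coefP => m le_m; rewrite /msub /mmap raddf_sum big_seq big1 //= => a Pa.
  have [wa _ _] := @msub_mon a; rewrite mcoeffCM (wlt_coef wa) ?mulr0 //.
  exact: leq_trans (wP a Pa) le_m.
move=> m wm; rewrite /msub /mmap raddf_sum /=.
have term a : a \in msupp P -> ((P@_a)%:MP * mmap1 s a)@_m = if a == m then P@_m * \prod_v cst v ^+ m v else 0.
  move=> Pa; rewrite mcoeffCM; have [wa wb wab] := @msub_mon a.
  have := wP a Pa; rewrite ltnS leq_eqVlt => /predU1P [eq_a | lt_a]; last first.
    case: eqP => [eq_am | _]; first by rewrite eq_am wm ltnn in lt_a.
    by rewrite (wlt_coef wa) ?mulr0 // wm.
  have /eqP := wlt_coef wab (eq_leq (etrans eq_a (esym wm))).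
  rewrite mcoeffB subr_eq0 mon mcoeffCM mcoeffX => /eqP ->.
  by case: eqP => [-> | _]; rewrite ?mulr1 ?mulr0.
rewrite big_seq (eq_bigr (fun a => if a == m then P@_m * \prod_v cst v ^+ m v else 0)); last exact: term.
rewrite -big_seq -big_mkcond /=; have [Pm | /memN_msupp_eq0 ->] := boolP (m \in msupp P).
  by rewrite -big_filter filter_pred1_uniq ?msupp_uniq // big_seq1.
by rewrite big1 ?mul0r // => a _; rewrite mul0r.
Qed.

End Weights.

Lemma count_msupp_lt (wt : 'I_n -> nat) D (P Q : MP) m0 :
  (forall m, mwt wt m = D -> m \in msupp Q -> m \in msupp P /\ m != m0) ->
  m0 \in msupp P -> mwt wt m0 = D ->
  (count (fun m => mwt wt m == D) (msupp Q) < count (fun m => mwt wt m == D) (msupp P))%N.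
Proof.
move=> QP Pm0 wm0; rewrite -!size_filter.
have uP : uniq (filter (fun m => mwt wt m == D) (msupp P)) by rewrite filter_uniq ?msupp_uniq.
have inP : m0 \in filter (fun m => mwt wt m == D) (msupp P) by rewrite mem_filter wm0 eqxx.
have := uniq_leq_size (s1 := filter (fun m => mwt wt m == D) (msupp Q))
  (s2 := rem m0 (filter (fun m => mwt wt m == D) (msupp P))).
rewrite filter_uniq ?msupp_uniq // => /(_ isT) H; apply: leq_ltn_trans (H _) _.
  move=> m; rewrite mem_filter mem_rem_uniq // inE mem_filter => /andP[/eqP wm Qm].
  by have [Pm ->] := QP m wm Qm; rewrite wm eqxx Pm.
by rewrite size_rem // prednK // size_filter -has_count; apply/hasP; exists m0; rewrite ?wm0.
Qed.

End MPolyTools.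

Definition valid (d i j : nat) : bool := (0 < j < i)%N && (i <= d.+1)%N.

Section CoefPredicate.
Variables (n : nat) (C : fieldType) (F : C -> Prop) (sF : is_subfield F).
Local Notation MP := {mpoly {poly C}[n]}.

Definition mOver (P : MP) := forall m, pOver F P@_m.

Lemma mOverC c : pOver F c -> mOver c%:MP.
Proof.
move=> Fc m; rewrite mcoeffC; case: (m == 0%MM); first by rewrite mulr1.
by rewrite mulr0; apply: (pOver0 sF).
Qed.
Lemma mOverX m : mOver 'X_[m].
Proof. by move=> m'; rewrite mcoeffX; case: (m == m'); [apply: (pOver1 sF) | apply: (pOver0 sF)]. Qed.
Lemma mOverD P Q : mOver P -> mOver Q -> mOver (P + Q).
Proof. by move=> HP HQ m; rewrite mcoeffD; apply: (pOverD sF). Qed.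
Lemma mOverB P Q : mOver P -> mOver Q -> mOver (P - Q).
Proof. by move=> HP HQ m; rewrite mcoeffB; apply: (pOverB sF). Qed.
Lemma mOverM P Q : mOver P -> mOver Q -> mOver (P * Q).
Proof. by move=> HP HQ m; rewrite mcoeffM; apply: (pOver_sum sF) => i _; apply: (pOverM sF). Qed.
Lemma mOver1 : mOver 1. Proof. by rewrite -mpolyC1; apply: mOverC; apply: (pOver1 sF). Qed.
Lemma mOver0 : mOver 0. Proof. by rewrite -mpolyC0; apply: mOverC; apply: (pOver0 sF). Qed.
Lemma mOver_exp P k : mOver P -> mOver (P ^+ k).
Proof. by move=> HP; elim: k => [|k IHk]; rewrite ?exprS; [apply: mOver1 | apply: mOverM]. Qed.
Lemma mOver_sum (I : Type) (r : seq I) (A : pred I) (G : I -> MP) :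
  (forall i, A i -> mOver (G i)) -> mOver (\sum_(i <- r | A i) G i).
Proof. by move=> HG; elim/big_rec: _ => [|i x Pi Fx]; [apply: mOver0 | apply: mOverD; auto]. Qed.
Lemma mOver_prod (I : Type) (r : seq I) (A : pred I) (G : I -> MP) :
  (forall i, A i -> mOver (G i)) -> mOver (\prod_(i <- r | A i) G i).
Proof. by move=> HG; elim/big_rec: _ => [|i x Pi Fx]; [apply: mOver1 | apply: mOverM; auto]. Qed.
Lemma mOver_msub s P : (forall v, mOver (s v)) -> mOver P -> mOver (msub s P).
Proof.
move=> Hs HP; apply: mOver_sum => m _; apply: mOverM; first exact: mOverC.
by apply: mOver_prod => v _; apply: mOver_exp.
Qed.
End CoefPredicate.

Lemma map_mpoly_surj (n : nat) (A B : nzRingType) (f : {rmorphism A -> B}) (Q : {mpoly B[n]}) :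
  (forall y, exists x, f x = y) -> exists P : {mpoly A[n]}, map_mpoly f P = Q.
Proof.
move=> surj; have [g Hg] := choice surj.
exists (\sum_(m <- msupp Q) g Q@_m *: 'X_[m]).
rewrite rmorph_sum [RHS]mpolyE; apply: eq_bigr => m _ /=.
by rewrite map_mpolyZ map_mpolyX Hg.
Qed.

(** Each substitution moves [P] by an increment. When the increments are fixed by the other
    substitutions they simply add up, so a commutator moves [P] by zero. *)
Lemma commuting_shift (V : zmodType) (rA rB rZ : V -> V) (P : V) :
  (forall x y, rA (x + y) = rA x + rA y) -> (forall x y, rB (x + y) = rB x + rB y) ->
  rB (rA P) = rA (rB (rZ P)) -> rB (rA P - P) = rA P - P -> rB (rZ P - P) = rZ P - P ->
  rA (rB P - P) = rB P - P -> rA (rZ P - P) = rZ P - P -> rZ P = P.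
Proof.
move=> rAD rBD comm BA BZ AB AZ; apply/eqP; rewrite -subr_eq0; apply/eqP.
set EA := rA P - P in BA; set EB := rB P - P in AB; set EZ := rZ P - P in BZ AZ *.
have A : rA P = P + EA by rewrite addrC subrK.
have B : rB P = P + EB by rewrite addrC subrK.
have Z : rZ P = P + EZ by rewrite addrC subrK.
clearbody EA EB EZ.
have lhs : rB (rA P) = P + EB + EA by rewrite A rBD B BA.
have rhs : rA (rB (rZ P)) = P + EB + EA + EZ.
  by rewrite Z rBD BZ B !rAD AB AZ A [P + EA + EB]addrAC.
by move: comm; rewrite lhs rhs -{1}[P + EB + EA]addr0 => /addrI.
Qed.

(** * Reduction to relations between series of depth one *)

Section Ostrowski.
Variables (C : closedFieldType) (R : realFieldType) (abs : C -> R).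
Hypothesis Habs : nonarch_abs abs.
Variables (p e : nat) (chC : p \in [pchar C]) (e_gt0 : (0 < e)%N).
Local Notation q := (p ^ e)%N.
Variable theta : C.
Local Notation Fq := (in_Fq q : C -> Prop).
Local Notation Kbar := (in_Kbar q theta).
Local Notation sFq := (Fq_subfield e chC).
Local Notation sK := (Kbar_subfield e chC theta).
Local Notation tw := (tw e chC 1).
Local Notation fr := (fr e chC 1).

Variables (n d : nat) (o : 'I_n) (idx : nat -> nat -> 'I_n) (lab : 'I_n -> nat * nat).
Hypothesis lab_o : lab o = (0, 0)%N.
Hypothesis idxK : forall i j, valid d i j -> lab (idx i j) = (i, j).
Hypothesis labP : forall v, v != o -> valid d (lab v).1 (lab v).2 /\ v = idx (lab v).1 (lab v).2.
Local Notation MP := {mpoly {poly C}[n]}.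
Local Notation KP := (mOver Kbar).

Lemma idx_neq_o i j : valid d i j -> idx i j != o.
Proof.
move=> vij; apply/eqP => eq_o; have := idxK vij; rewrite eq_o lab_o => -[i0 j0].
by move: vij; rewrite /valid -i0 -j0.
Qed.

(* Entries of the generic lower unitriangular matrix; the variable [o] stands for Omega. *)
Definition hat i j : MP := if valid d i j then 'X_(idx i j) else (i == j)%:R.

Lemma hat_lt i j : (i < j)%N -> hat i j = 0.
Proof.
by move=> lt_ij; rewrite /hat /valid [(j < i)%N]ltnNge (ltnW lt_ij) andbF (ltn_eqF lt_ij).
Qed.
Lemma hat_eq i : hat i i = 1. Proof. by rewrite /hat /valid ltnn andbF eqxx. Qed.
Lemma hatX v : v != o -> 'X_v = hat (lab v).1 (lab v).2.
Proof. by case/labP => vij {1}->; rewrite /hat vij. Qed.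

(** Distance to the diagonal, and zero for [o]. Both [sig] and the translations by [E_lj] with
    [j < l] change [X_ij] by terms of lower weight only. *)
Definition wt (v : 'I_n) : nat := (lab v).1 - (lab v).2.

Lemma hat_wlt i j : wlt wt (i - j).+1 (hat i j).
Proof.
rewrite /hat; case: ifP => [vij | _].
  have -> : (i - j)%N = wt (idx i j) by rewrite /wt idxK.
  exact: wltX.
apply: (@wlt_mono _ _ _ 1) => //.
by rewrite -mpolyC_nat; apply: wltC.
Qed.

Lemma mOver_hat i j : KP (hat i j).
Proof.
rewrite /hat; case: ifP => [_ | _]; first exact: (mOverX sK).
by case: (i == j); [exact: (@mOver1 n _ _ sK) | exact: (@mOver0 n _ _ sK)].
Qed.

Section Substitutions.
Variables (nn : nat -> nat) (u : nat -> {poly C}).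
Hypothesis Ku : forall k, (1 <= k <= d)%N -> pOver Kbar (u k).

Let mu : {poly C} := 'X - (theta ^+ q)%:P.
Let Kmu : pOver Kbar mu.
Proof.
apply: (pOverB sK); first exact: (pOverX sK).
by apply: (pOverC sK); apply: (sfX sK); apply: (theta_Kbar e chC).
Qed.

(** The series [u_k Om^(n_k)] read in the variable tau(Om), through [Om = mu tau(Om)]. *)
Definition fcoef k : MP := (u k * mu ^+ nn k)%:MP * 'X_o ^+ nn k.

(* [X = Phi (tau X)] for the matrix of the series, read off entrywise. *)
Definition sig (v : 'I_n) : MP :=
  if v == o then mu%:MP * 'X_o
  else 'X_v + fcoef (lab v).1.-1 * hat (lab v).1.-1 (lab v).2.

(* Right multiplication of the generic matrix by [1 + x E_lj]. *)
Definition grp (l j : nat) (x : {poly C}) (v : 'I_n) : MP :=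
  if (v != o) && ((lab v).2 == j) then 'X_v + x%:MP * hat (lab v).1 l else 'X_v.

Lemma wt_o : wt o = 0%N. Proof. by rewrite /wt lab_o. Qed.

Lemma fcoef_wlt k : wlt wt 1 (fcoef k).
Proof.
apply: wltCM; elim: (nn k) => [|a IHa]; first by rewrite expr0 -mpolyC1; apply: wltC.
by rewrite exprS; apply: (@wltM _ _ _ 0 1) => //; rewrite -{1}wt_o; apply: wltX.
Qed.

Lemma valid_o v : v != o -> [/\ (1 <= (lab v).2)%N, ((lab v).2 < (lab v).1)%N & ((lab v).1 <= d.+1)%N].
Proof. by move=> /labP[/andP[/andP[? ?] ?] _]; split. Qed.

Lemma sig_wlt v : wlt wt (wt v) (if v == o then 0 else fcoef (lab v).1.-1 * hat (lab v).1.-1 (lab v).2).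
Proof.
case: eqP => [_ | /eqP /valid_o [j_gt0 lt_ji _]]; first exact: wlt0.
apply: (@wlt_mono _ _ _ ((lab v).1.-1 - (lab v).2).+1); first by rewrite /wt; lia.
by rewrite -[X in wlt _ X _]add0n; apply: (@wltM _ _ _ 0); [apply: fcoef_wlt | apply: hat_wlt].
Qed.

Lemma sigE v : sig v = (if v == o then mu else 1)%:MP * 'X_v +
  (if v == o then 0 else fcoef (lab v).1.-1 * hat (lab v).1.-1 (lab v).2).
Proof. by rewrite /sig; case: eqP => [-> | _]; rewrite ?addr0 // mpolyC1 mul1r. Qed.

Lemma grpE l j x v : grp l j x v = 1%:MP * 'X_v +
  (if (v != o) && ((lab v).2 == j) then x%:MP * hat (lab v).1 l else 0).
Proof. by rewrite /grp mpolyC1 mul1r; case: ifP => _; rewrite ?addr0. Qed.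

Lemma grp_wlt l j x v : (j < l)%N ->
  wlt wt (wt v) (if (v != o) && ((lab v).2 == j) then x%:MP * hat (lab v).1 l else 0).
Proof.
move=> lt_jl; case: ifP => [/andP[/valid_o [j_gt0 lt_ji _] /eqP eq_j] | _]; last exact: wlt0.
apply: wltCM; have [le_l | lt_l] := leqP l (lab v).1; last by rewrite hat_lt //; apply: wlt0.
apply: (@wlt_mono _ _ _ ((lab v).1 - l).+1); last exact: hat_wlt.
by rewrite /wt eq_j; move: lt_jl le_l lt_ji; rewrite eq_j; lia.
Qed.

Lemma sig_o : sig o = mu%:MP * 'X_o. Proof. by rewrite /sig eqxx. Qed.

Lemma grp_o l j x : grp l j x o = 'X_o. Proof. by rewrite /grp eqxx. Qed.

Lemma grp_hat l j x i k : (j < l <= d.+1)%N -> (0 < j)%N ->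
  msub (grp l j x) (hat i k) = hat i k + (if k == j then x%:MP * hat i l else 0).
Proof.
move=> /andP[lt_jl le_l] j_gt0; rewrite {1 2}/hat; case: ifPn => [vik | nvik].
  by rewrite msubX /grp (idx_neq_o vik) idxK //=; case: ifP => _; rewrite ?addr0.
rewrite rmorph_nat; case: (k =P j) => [eq_kj | _]; last by rewrite addr0.
suff -> : hat i l = 0 by rewrite mulr0 addr0.
case: (ltngtP i l) => [/hat_lt // | lt_li | eq_il].
  rewrite /hat; case: ifPn => [vil | _]; last by rewrite gtn_eqF.
  move: nvik vil; rewrite /valid eq_kj j_gt0 (ltn_trans lt_jl lt_li) /= => /negP nle.
  by case/andP => _ /nle.
by move: nvik; rewrite /valid eq_kj eq_il j_gt0 lt_jl le_l.
Qed.

Lemma sig_hat i j : (0 < j)%N -> (i <= d.+1)%N ->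
  msub sig (hat i j) = hat i j + fcoef i.-1 * hat i.-1 j.
Proof.
move=> j_gt0 le_i; rewrite {1 2}/hat; case: ifPn => [vij | nvij].
  by rewrite msubX /sig (negPf (idx_neq_o vij)) idxK.
rewrite rmorph_nat hat_lt ?mulr0 ?addr0 //.
by move: nvij; rewrite /valid j_gt0 le_i andbT /=; lia.
Qed.

Lemma grp_fcoef l j x k : msub (grp l j x) (fcoef k) = fcoef k.
Proof. by rewrite rmorphM rmorphXn /= msubC msubX grp_o. Qed.

Local Opaque sig grp hat fcoef.

(** On the generic matrix [sig] is a left multiplication and [grp] a right one, and [grp] fixes the
    variable of Omega on which the left factor depends. *)
Lemma sig_grp l j x : (j < l <= d.+1)%N -> (0 < j)%N ->
  forall P, msub (grp l j x) (msub sig P) = msub sig (msub (grp l j x) P).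
Proof.
move=> /andP[lt_jl le_l] j_gt0.
apply: (@mpoly_rmorph_ext n {poly C} MP (msub (grp l j x) \o msub sig) (msub sig \o msub (grp l j x))) => [c | v] /=.
  by rewrite !msubC.
have [-> | no] := eqVneq v o.
  by rewrite !msubX grp_o !sig_o msubM msubC !msubX grp_o sig_o.
have [k_gt0 lt_ki le_i] := valid_o no.
have jl : (j < l <= d.+1)%N by rewrite lt_jl.
rewrite (hatX no); move: (lab v).1 (lab v).2 k_gt0 lt_ki le_i => a b b_gt0 lt_ba le_a.
rewrite (sig_hat b_gt0 le_a) msubD msubM grp_fcoef !(grp_hat _ _ _ jl j_gt0) msubD.
rewrite (sig_hat b_gt0 le_a); case: ifP => _; last by rewrite msub0 !addr0.
rewrite msubM msubC (sig_hat (leq_trans (ltn0Sn _) lt_jl) le_a).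
by rewrite mulrDr [fcoef _ * (_ * _)]mulrCA [x%:MP * (_ + _)]mulrDr addrACA.
Qed.

(** Right multiplication by both sides of [(1 + E_il)(1 + x E_lj) = (1 + x E_lj)(1 + E_il)(1 + x
    E_ij)]. *)
Lemma grp_commutator i l j x : (0 < j < l)%N -> (l < i <= d.+1)%N ->
  forall P, msub (grp i l 1) (msub (grp l j x) P) =
    msub (grp l j x) (msub (grp i l 1) (msub (grp i j x) P)).
Proof.
move=> /andP[j_gt0 lt_jl] /andP[lt_li le_i].
have le_l := leq_trans (ltnW lt_li) le_i; have l_gt0 := ltn_trans j_gt0 lt_jl.
have jl : (j < l <= d.+1)%N by rewrite lt_jl.
have li : (l < i <= d.+1)%N by rewrite lt_li.
have ji : (j < i <= d.+1)%N by rewrite (ltn_trans lt_jl).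
apply: (@mpoly_rmorph_ext n {poly C} MP (msub (grp i l 1) \o msub (grp l j x))
  (msub (grp l j x) \o (msub (grp i l 1) \o msub (grp i j x)))) => [c | v] /=.
  by rewrite !msubC.
have [-> | no] := eqVneq v o; first by rewrite !(msubX, grp_o).
rewrite (hatX no); move: (lab v).1 (lab v).2 => a b.
have ilF : (i == l) = false by rewrite gtn_eqF.
have ijF : (i == j) = false by rewrite gtn_eqF // (ltn_trans lt_jl).
have ljF : (l == j) = false by rewrite gtn_eqF.
have jlF : (j == l) = false by rewrite ltn_eqF.
rewrite !(grp_hat _ _ _ jl j_gt0) !(grp_hat _ _ _ ji j_gt0) msubD (grp_hat _ _ _ li l_gt0).
rewrite !msubD (grp_hat _ _ _ li l_gt0) msubD (grp_hat _ _ _ jl j_gt0).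
have [-> | _] := eqVneq b j.
  rewrite jlF !msub0 !addr0 !msubM !msubC !(grp_hat _ _ _ li l_gt0) eqxx ilF addr0.
  by rewrite (grp_hat _ _ _ jl j_gt0) ijF addr0 mpolyC1 mul1r mulrDr addrA.
rewrite !msub0 !addr0; case: ifP => _; last by rewrite !msub0 !addr0.
by rewrite msubM msubC (grp_hat _ _ _ jl j_gt0) ijF addr0.
Qed.

Local Transparent sig grp hat fcoef.

Variable w : 'I_n -> pser C.
Hypothesis w_eq : forall v, w v = mmap (@of_poly C) (tw \o w) (sig v).
Hypothesis conv_w : forall v, conv abs 1 (w v).
Hypothesis nz_wo : w o != 0.
Local Notation ev := (mmap (@of_poly C) w).
Local Notation evtw := (mmap (@of_poly C) (tw \o w)).
Local Notation phi := (map_poly fr).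

Lemma ev_sig P : evtw (msub sig P) = ev P.
Proof.
apply: (@mpoly_rmorph_ext n {poly C} (pser C) (evtw \o msub sig) ev) => [c | v] /=.
  by rewrite msubC !mmapC.
by rewrite msubX -w_eq mmapX mmap1U.
Qed.

Let tw_ev P : tw (ev P) = evtw (map_mpoly phi P).
Proof.
apply: (@mpoly_rmorph_ext n {poly C} (pser C) (tw \o ev) (evtw \o map_mpoly phi)) => [c | v] /=.
  by rewrite map_mpolyC !mmapC tw_of_poly.
by rewrite map_mpolyX !mmapX !mmap1U.
Qed.

Let phi_hat i j : map_mpoly phi (hat i j) = hat i j.
Proof.
rewrite /hat; case: ifP => _; first exact: map_mpolyX.
by case: (i == j); [apply: rmorph1 | apply: rmorph0].
Qed.

Let phi_grp l j x P : phi x = x -> map_mpoly phi (msub (grp l j x) P) = msub (grp l j x) (map_mpoly phi P).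
Proof.
move=> phix; apply: (@mpoly_rmorph_ext n {poly C} MP (map_mpoly phi \o msub (grp l j x))
  (msub (grp l j x) \o map_mpoly phi)) => [c | v] /=.
  by rewrite !(msubC, map_mpolyC).
rewrite map_mpolyX !msubX /grp; case: ifP => _; last exact: map_mpolyX.
by rewrite rmorphD rmorphM /= map_mpolyX phi_hat map_mpolyC; congr (_ + _%:MP * _); exact: phix.
Qed.

Let Kgrp l j x P : pOver Kbar x -> KP P -> KP (msub (grp l j x) P).
Proof.
move=> Kx; apply: (mOver_msub sK) => v; rewrite /grp; case: ifP => _; last exact: (mOverX sK).
apply: (mOverD sK); first exact: (mOverX sK).
by apply: (mOverM sK); [apply: (mOverC sK) | apply: mOver_hat].
Qed.

Lemma mOver_sig P : KP P -> KP (msub sig P).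
Proof.
apply: (mOver_msub sK) => v; rewrite /sig; case: ifP => [_ | /negbT /valid_o [j_gt0 lt_ji le_i]].
  by apply: (mOverM sK); [apply: (mOverC sK) | apply: (mOverX sK)].
apply: (mOverD sK); first exact: (mOverX sK).
apply: (mOverM sK); last exact: mOver_hat.
apply: (mOverM sK); last by apply: (mOver_exp sK); apply: (mOverX sK).
apply: (mOverC sK); apply: (pOverM sK); last exact: (pOver_exp sK).
by apply: Ku; move: j_gt0 lt_ji le_i; lia.
Qed.

Let w_o : w o = of_poly mu * tw (w o).
Proof. by rewrite {1}w_eq /sig eqxx rmorphM /= mmapC mmapX mmap1U. Qed.

Section Step.
Variables (D : nat) (P : MP) (m0 : 'X_{1..n}).
Hypothesis IH : forall Q, KP Q -> ev Q = 0 -> wlt wt D.+1 Q -> Q = 0.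
Hypotheses (KPP : KP P) (evP : ev P = 0) (wP : wlt wt D.+2 P).
Hypotheses (Pm0 : m0 \in msupp P) (wm0 : mwt wt m0 = D.+1).
Hypothesis IHcount : forall Q, KP Q -> ev Q = 0 -> wlt wt D.+2 Q ->
  (count (fun m => mwt wt m == D.+1) (msupp Q) < count (fun m => mwt wt m == D.+1) (msupp P))%N ->
  Q = 0.

Let a := P@_m0.
Let ex := m0 o.

Let nz_a : a != 0. Proof. by rewrite -mcoeff_msupp. Qed.

Let top_sig m : mwt wt m = D.+1 -> (msub sig P)@_m = P@_m * mu ^+ m o.
Proof.
move=> wm; have [_ ->] := msub_top sigE sig_wlt wP; last by [].
rewrite (bigD1 o) //= eqxx big1 ?mulr1 // => v ne_vo.
by rewrite (negPf ne_vo) expr1n.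
Qed.

(** Let [P'] be [sig P] with its coefficients untwisted; it is again a relation. Since [sig] only
    rescales top monomials, [P'] acquires no new one, and the combination of [P'] and [P] that
    cancels [m0] has fewer of them; it vanishes by [IHcount]. Twisting back, the factor [mu ^+ ex]
    is the scaling of [m0]. *)
Lemma sig_semi_invariant :
  (map_poly fr a)%:MP * msub sig P = (a * mu ^+ ex)%:MP * map_mpoly phi P.
Proof.
have [P' defP'] := map_mpoly_surj (msub sig P) (map_fr_surj e chC 1).
have P'E m : phi P'@_m = (msub sig P)@_m by rewrite -defP' mcoeff_map_mpoly.
have KP' : KP P'.
  move=> m k; apply: (Kbar_root chC (qn_gt0 e chC 1)); rewrite -(frE e chC) -coef_map /=.
  by rewrite P'E; apply: mOver_sig.
have evP' : ev P' = 0.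
  by apply: (@tw_inj _ _ e chC 1); rewrite tw_ev defP' ev_sig evP rmorph0.
have wsig := (msub_top sigE sig_wlt wP).1.
have wP' : wlt wt D.+2 P'.
  move=> m; rewrite mcoeff_msupp => nz; apply: wsig; rewrite mcoeff_msupp -P'E.
  by rewrite map_poly_eq0.
have : a%:MP * P' - (P'@_m0)%:MP * P = 0.
  apply: IHcount.
  - apply: (mOverB sK); apply: (mOverM sK).
    + exact: (mOverC sK (KPP m0)).
    + exact: KP'.
    + exact: (mOverC sK (KP' m0)).
    + exact: KPP.
  - by rewrite rmorphB !rmorphM /= evP evP' !mulr0 subrr.
  - by apply: wltB; apply: wltCM.
  - apply: (count_msupp_lt (m0 := m0) _ Pm0 wm0) => m wm.
    rewrite !mcoeff_msupp mcoeffB !mcoeffCM; have [Pm | Pm] := eqVneq P@_m 0.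
      have : phi P'@_m = 0 by rewrite P'E (top_sig wm) Pm mul0r.
      by move/eqP; rewrite map_poly_eq0 => /eqP ->; rewrite ?Pm !mulr0 subrr eqxx.
    by move=> nz; split; [by [] | apply: contraNneq nz => ->; rewrite mulrC subrr].
move/eqP; rewrite subr_eq0 => /eqP /(congr1 (map_mpoly phi)) E.
rewrite !rmorphM /= !map_mpolyC defP' in E.
have E2 : phi P'@_m0 = a * mu ^+ ex by rewrite P'E; exact: top_sig.
by rewrite -E2; exact: E.
Qed.

(** Semi-invariance passes to the translate of [P], because [grp] commutes with [sig] and [x] is
    fixed by Frobenius. Hence its value [f] satisfies the same first order Frobenius equation as
    [g = a Om^ex], and [f / g] is a quotient of polynomials over [Fq] by [fixed_quotient]. The
    resulting identity is a relation of lower weight, as translations preserve top terms, so it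
    already holds between polynomials by [IH]. *)
Lemma grp_quotient l j x : (0 < j < l)%N -> (l <= d.+1)%N -> pOver Fq x ->
  exists be ga : {poly C}, be != 0 /\ be%:MP * (msub (grp l j x) P - P) = ga%:MP * 'X_o ^+ ex.
Proof.
move=> /andP[j_gt0 lt_jl] le_l Fx; have jl : (j < l <= d.+1)%N by rewrite lt_jl.
have phix : phi x = x.
  by apply/polyP => i; rewrite coef_map /= frE expn1; apply: Fx.
have Kx : pOver Kbar x by move=> i; apply: (Fq_Kbar chC); apply: Fx.
pose f := ev (msub (grp l j x) P); pose g := of_poly a * w o ^+ ex.
have nz_g : g != 0.
  apply/eqP => /ps_mulf_eq0 [/eqP | /eqP]; first by rewrite (negPf (of_poly_neq0 nz_a)).
  by rewrite (negPf (ps_expf_neq0 _ nz_wo)).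
have cf : conv abs 1 f by apply: conv_mmap.
have cg : conv abs 1 g by apply: convM => //; [apply: conv_poly | apply: convX].
have twf : of_poly (map_poly fr a) * f = of_poly (a * mu ^+ ex) * tw f.
  have fE : f = evtw (msub (grp l j x) (msub sig P)) by rewrite (sig_grp _ jl j_gt0) ev_sig.
  have evtwCM c Q : evtw (msub (grp l j x) (c%:MP * Q)) = of_poly c * evtw (msub (grp l j x) Q).
    by rewrite msubM msubC rmorphM /= mmapC.
  have twfE : tw f = evtw (msub (grp l j x) (map_mpoly phi P)).
    by rewrite -(phi_grp l j P phix); exact: tw_ev.
  have H := congr1 (fun Q => evtw (msub (grp l j x) Q)) sig_semi_invariant.
  have H' := etrans (esym (evtwCM _ _)) (etrans H (evtwCM _ _)).
  by rewrite twfE; exact: (etrans (congr1 _ fE) H').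
have fg : f * tw g = g * tw f.
  have twg : tw g = of_poly (map_poly fr a) * tw (w o) ^+ ex.
    by rewrite /g rmorphM rmorphXn /= tw_of_poly.
  have wo : w o ^+ ex = of_poly mu ^+ ex * tw (w o) ^+ ex by rewrite {1}w_o exprMn.
  have mux : of_poly (a * mu ^+ ex) = of_poly a * of_poly mu ^+ ex.
    by rewrite [LHS]rmorphM; congr (_ * _); apply: rmorphXn.
  by rewrite twg mulrCA mulrA twf /g wo mux; move: (tw f) (tw (w o)) => x1 x2; ring.
have [al [be [Fal Fbe nz_be eq_fg]]] := fixed_quotient Habs e_gt0 cf cg nz_g fg.
have Kb b : pOver Fq b -> pOver Kbar b by move=> Fb i; apply: (Fq_Kbar chC); apply: Fb.
exists be, (al * a); split=> //; apply/eqP; rewrite -subr_eq0; apply/eqP/IH.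
- have KX : KP ('X_o ^+ ex) by apply: (mOver_exp sK); apply: (mOverX sK).
  apply: (mOverB sK); apply: (mOverM sK) => //; try exact: (mOverC sK (Kb _ Fbe)).
    by apply: (mOverB sK) => //; apply: Kgrp.
  by apply: (mOverC sK); apply: (pOverM sK); [apply: Kb | apply: KPP].
- transitivity (of_poly be * f - of_poly (al * a) * w o ^+ ex).
    have evM A B : ev (A * B) = ev A * ev B := rmorphM _ A B.
    have evB A B : ev (A - B) = ev A - ev B := rmorphB _ A B.
    have evX A k : ev (A ^+ k) = ev A ^+ k := rmorphXn _ k A.
    by rewrite evB !evM evB evP subr0 evX !mmapC mmapX mmap1U.
  by rewrite eq_fg /g [of_poly (al * a)]rmorphM mulrA subrr.
have [wg top_g] := msub_top (grpE l j x) (fun v => @grp_wlt l j x v lt_jl) wP.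
apply: wltB.
  apply: wltCM; apply: wlt_coefP => m; rewrite leq_eqVlt => /predU1P [wm | lt_m].
    by rewrite mcoeffB (top_g _ (esym wm)) big1 ?mulr1 ?subrr // => v _; rewrite expr1n.
  by apply: (wlt_coef _ lt_m); apply: wltB.
apply: wltCM; apply: (@wlt_mono _ _ _ 1) => //; elim: ex => [|k IHk].
  by rewrite expr0 -mpolyC1; apply: wltC.
by rewrite exprS; apply: (@wltM _ _ _ 0 1) => //; rewrite -{1}wt_o; apply: wltX.
Qed.

Lemma grp_fix_diff l j x l' j' x' : (0 < j < l)%N -> (l <= d.+1)%N -> pOver Fq x ->
  msub (grp l' j' x') (msub (grp l j x) P - P) = msub (grp l j x) P - P.
Proof.
move=> jl le_l Fx; have [be [ga [nz_be E]]] := grp_quotient jl le_l Fx.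
have nz_MP : be%:MP != 0 :> MP by rewrite mpolyC_eq0.
apply: (mulfI nz_MP); rewrite E -{1}(msubC (grp l' j' x') be) -msubM E.
by rewrite msubM msubE msubC msubX grp_o.
Qed.

(** The index [j.+1] lies strictly between [j] and [i], so the translation by [E_ij] is a
    commutator, and [grp_fix_diff] provides the fixed increments. For [i = j.+1] no intermediate
    index exists, which is why depth one survives. *)
Lemma grp_invariant i j x : (0 < j)%N -> (j.+1 < i <= d.+1)%N -> pOver Fq x ->
  msub (grp i j x) P = P.
Proof.
move=> j_gt0 /andP[lt_ji le_i] Fx; have F1 := pOver1 sFq.
have jl : (0 < j < j.+1)%N by rewrite j_gt0 ltnSn.
have li' : (j.+1 < i <= d.+1)%N by rewrite lt_ji.
have li : (0 < j.+1 < i)%N by rewrite lt_ji.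
have jm : (0 < j < i)%N by rewrite j_gt0 ltnW.
have le_l : (j.+1 <= d.+1)%N by apply: leq_trans le_i; apply: ltnW.
exact: (commuting_shift (msubD _) (msubD _) (grp_commutator x jl li' P) (grp_fix_diff i j.+1 1 jl le_l Fx)
  (grp_fix_diff i j.+1 1 jm le_i Fx) (grp_fix_diff j.+1 j x li le_i F1) (grp_fix_diff j.+1 j x jm le_i Fx)).
Qed.

(** Descending induction on the weight. The translation by [x E_ij] shifts [X_ij] by [x], and [X_tj]
    with [t > i] by [x X_ti]; these [X_tj] have greater weight and are already absent from [P]. So
    [P] is invariant under the pure shifts of [X_ij] by all powers of ['X]. *)
Lemma step_free : forall v, (2 <= wt v)%N -> mfree P v.
Proof.
suff H k : forall v, (2 <= wt v)%N -> (d.+1 - wt v < k)%N -> mfree P v.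
  by move=> v wv; apply: (H (d.+1 - wt v).+1).
elim: k => // k IHk v wv lt_k.
have no : v != o by apply: contraTneq wv => ->; rewrite wt_o.
have [j_gt0 lt_ji le_i] := valid_o no.
have lt2 : ((lab v).2.+1 < (lab v).1 <= d.+1)%N by rewrite le_i andbT; move: wv; rewrite /wt; lia.
apply: (@mfree_shift n _ P v (fun b => 'X^b)).
  by move=> b b' /(congr1 (fun r : {poly C} => size r)); rewrite !size_polyXn => -[].
move=> b; have Fb : pOver Fq ('X^b : {poly C}) by apply: (pOver_exp sFq); apply: (pOverX sFq).
rewrite -[RHS](grp_invariant j_gt0 lt2 Fb); apply: mmap_agree => t; rewrite /grp.
have [-> | ne_tv] := eqVneq t v; first by right; rewrite no eqxx hat_eq mulr1.
have [-> | nto] := eqVneq t o; first by right.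
case: eqP => [eq_j | _] /=; last by right.
have [lt_t | le_t] := ltnP (lab t).1 (lab v).1; first by right; rewrite hat_lt // mulr0 addr0.
have lt_t : ((lab v).1 < (lab t).1)%N.
  rewrite ltn_neqAle le_t andbT; apply: contraNneq ne_tv => eq_i.
  have [_ Et] := labP nto; have [_ Ev] := labP no.
  by apply/eqP; rewrite [LHS]Et [RHS]Ev eq_i eq_j.
have [_ lt_t' le_t'] := valid_o nto; left; apply: IHk; rewrite /wt.
  by move: wv; rewrite /wt -eq_j; lia.
move: lt_k; rewrite /wt eq_j; move: le_t' lt_t lt_t' lt_ji; rewrite eq_j; lia.
Qed.

End Step.

(** Double induction, on the weight and on the number of monomials of top weight. [Hbase] settles
    weight zero, where only [o] occurs, as well as the relations that [step_free] has stripped of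
    higher entries. *)
Theorem ostrowski :
  (forall P, KP P -> ev P = 0 -> (forall v, (2 <= wt v)%N -> mfree P v) -> P = 0) ->
  forall P, KP P -> ev P = 0 -> P = 0.
Proof.
move=> Hbase.
have H D : forall Q, KP Q -> ev Q = 0 -> wlt wt D.+1 Q -> Q = 0.
  elim: D => [|D IHD] P KPP evP wP.
    apply: Hbase => // v wv m /wP; rewrite ltnS leqn0 /mwt sum_nat_eq0 => /forallP /(_ v) /=.
    by rewrite muln_eq0 => /orP[/eqP // | /eqP w0]; rewrite w0 in wv.
  have [c] := ubnP (count (fun m => mwt wt m == D.+1) (msupp P)).
  elim: c P KPP evP wP => // c IHc P KPP evP wP; rewrite ltnS => le_c.
  have [/hasP [m0 Pm0 /eqP wm0] | no_top] := boolP (has (fun m => mwt wt m == D.+1) (msupp P)).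
    apply: Hbase => // v wv; apply: (@step_free D P m0) => // Q KQ evQ wQ lt_Q.
    by apply: IHc => //; apply: leq_trans lt_Q le_c.
  apply: IHD => // m Pm; rewrite ltn_neqAle -ltnS [(_ < _)%N]wP // andbT.
  by apply: contra no_top => /eqP eq_m; apply/hasP; exists m => //; apply/eqP.
move=> P KPP evP; apply: (H (\max_(m <- msupp P) mwt wt m)) => // m Pm.
by rewrite ltnS; apply: leq_bigmax_seq.
Qed.

End Substitutions.
End Ostrowski.

(** * The series Omega and Y *)

Section IteratedSum.
Variable A : comNzRingType.

(** Sum over [N > i_1 > ... > i_s >= 0], nested so that each index bounds the sum inside it. *)
Fixpoint itsum (a : seq (nat -> A)) (N : nat) : A :=
  if a is a1 :: a' then \sum_(n < N) a1 n * itsum a' n else 1.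

Definition shift_fun (f : nat -> A) : nat -> A := fun n => f n.+1.

(** The innermost index is either positive, and then all indices can be lowered by one, or zero, and
    then its factor is constant. As a twist shifts the terms, this is the origin of the functional
    equation of the [Y_ij]. *)
Lemma itsum_rconsS a b N :
  itsum (rcons a b) N.+1 = itsum (map shift_fun (rcons a b)) N + b 0%N * itsum (map shift_fun a) N.
Proof.
elim: a N => [|a1 a IHa] N /=.
  rewrite big_ord_recl /= !mulr1 addrC; congr (_ + _).
rewrite big_ord_recl /=; have -> : itsum (rcons a b) 0 = 0.
  by case: (a) => [|a2 a'] /=; rewrite big_ord0.
rewrite mulr0 add0r mulr_sumr -big_split; apply: eq_bigr => n _ /=.
by rewrite [X in a1 _ * X]IHa mulrDr [in RHS]mulrCA.
Qed.

Lemma itsum_scale (c : seq A) (a b : seq (nat -> A)) N : size a = size c -> size b = size c ->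
  (forall k n, (k < size c)%N -> nth (fun=> 0) b k n = c`_k * nth (fun=> 0) a k n) ->
  itsum b N = (\prod_(x <- c) x) * itsum a N.
Proof.
elim: c a b N => [|x c IHc] [|a1 a] [|b1 b] N //= sa sb H; first by rewrite big_nil mul1r.
rewrite big_cons mulr_sumr; apply: eq_bigr => n _.
have -> : b1 n = x * a1 n := H 0%N n isT.
rewrite (IHc a b); [ring | by case: sa | by case: sb | ].
by move=> k m lt_k; apply: (H k.+1 m).
Qed.

Definition cons_ff (s N : nat) (x : 'I_N * {ffun 'I_s -> 'I_N}) : {ffun 'I_s.+1 -> 'I_N} :=
  [ffun k => if unlift ord0 k is Some k' then x.2 k' else x.1].

Lemma cons_ff0 s N (x : 'I_N * {ffun 'I_s -> 'I_N}) : cons_ff x ord0 = x.1.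
Proof. by rewrite ffunE unlift_none. Qed.
Lemma cons_ffS s N (x : 'I_N * {ffun 'I_s -> 'I_N}) k : cons_ff x (lift ord0 k) = x.2 k.
Proof. by rewrite ffunE liftK. Qed.

Lemma cons_ff_bij s N : bijective (@cons_ff s N).
Proof.
pose g (f : {ffun 'I_s.+1 -> 'I_N}) : 'I_N * {ffun 'I_s -> 'I_N} :=
  (f ord0, [ffun k => f (lift ord0 k)]).
exists g => [[i f] | f]; rewrite /g.
  by rewrite cons_ff0; congr (_, _); apply/ffunP => k; rewrite ffunE cons_ffS.
by apply/ffunP => k; case: (unliftP ord0 k) => [k' -> | ->]; rewrite ?cons_ffS ?cons_ff0 ?ffunE.
Qed.

(** The extra bound [b] serves the induction: once the first index is fixed, it bounds the remaining
    ones. *)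
Lemma sum_decreasing_ff s N b (G : nat -> nat -> A) : (b <= N)%N ->
  \sum_(f : {ffun 'I_s -> 'I_N} | decreasing_ff f && [forall k, (f k < b)%N])
     \prod_(k < s) G k (f k) = itsum [seq G k | k <- iota 0 s] b.
Proof.
elim: s b G => [|s IHs] b G le_bN.
  have f0 : {ffun 'I_0 -> 'I_N} by apply: finfun => -[].
  rewrite (big_pred1 f0) ?big_ord0 // => f /=.
  have -> : f = f0 by apply/ffunP => -[].
  by rewrite eqxx; apply/andP; split; apply/forallP => -[].
rewrite (reindex (@cons_ff s N)) /=; last by apply: onW_bij; apply: cons_ff_bij.
have cond (x : 'I_N * {ffun 'I_s -> 'I_N}) : decreasing_ff (cons_ff x) && [forall k, (cons_ff x k < b)%N] =
    (x.1 < b)%N && (decreasing_ff x.2 && [forall k, (x.2 k < x.1)%N]).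
  case: x => i f /=; apply/andP/and3P => [[/forallP dec /forallP lt_b] | [lt_ib /forallP dec /forallP lt_i]].
    split; first by have := lt_b ord0; rewrite cons_ff0.
      apply/forallP => k1; apply/forallP => k2; apply/implyP => lt_k.
      by have /forallP /(_ (lift ord0 k2)) := dec (lift ord0 k1); rewrite !cons_ffS => /implyP; apply.
    by apply/forallP => k; have /forallP /(_ (lift ord0 k)) := dec ord0; rewrite cons_ffS cons_ff0.
  split; apply/forallP => k1; last first.
    case: (unliftP ord0 k1) => [k ->|->]; rewrite ?cons_ffS ?cons_ff0 //=.
    exact: ltn_trans (lt_i k) lt_ib.
  apply/forallP => k2; apply/implyP; case: (unliftP ord0 k2) => [k2' ->|->]; last by rewrite ltn0.
  case: (unliftP ord0 k1) => [k1' ->|->] lt_k; rewrite !cons_ffS ?cons_ff0 ?lt_i //=.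
  by have /forallP /(_ k2') /implyP := dec k1'; apply.
rewrite (eq_bigl _ _ cond) -(pair_big_dep (fun i : 'I_N => (i < b)%N)
  (fun (i : 'I_N) (f : {ffun 'I_s -> 'I_N}) => decreasing_ff f && [forall k, (f k < i)%N])
  (fun i f => \prod_(k < s.+1) G k (cons_ff (i, f) k))) /=.
rewrite (big_ord_widen_cond N xpredT (fun i => G 0%N i * itsum [seq G k | k <- iota 1 s] i) le_bN).
apply: eq_bigr => i lt_ib; rewrite (iotaDl 1 0) -map_comp.
rewrite -(IHs i (fun k => G k.+1)) ?(ltnW (ltn_ord i)) // mulr_sumr; apply: eq_bigr => f _.
by rewrite big_ord_recl cons_ff0; congr (_ * _); apply: eq_bigr => k _; rewrite cons_ffS.
Qed.

End IteratedSum.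

Lemma L_partial_itsum (C : closedFieldType) q (th : C) vs ms N :
  L_partial q th vs ms N =
  itsum [seq (fun n => frob_eval q th n vs`_k / Pth q th n ^+ nth 0%N ms k) | k <- iota 0 (size vs)] N.
Proof.
rewrite /L_partial -(sum_decreasing_ff (size vs) (fun k n => frob_eval q th n vs`_k / Pth q th n ^+ nth 0%N ms k) (leqnn N)).
by apply: eq_bigl => f; rewrite [X in _ && X](_ : _ = true) ?andbT //; apply/forallP => k.
Qed.

(** * Uniform limits of iterated sums *)

Section Limits.
Variables (C : closedFieldType) (R : realFieldType) (abs : C -> R).
Hypotheses (Habs : nonarch_abs abs) (Hcompl : complete_abs abs).
Variables (r : R) (r_gt0 : 0 < r).
Local Notation conv := (conv abs r).
Local Notation bnd := (bnd abs r).
Local Notation ucvg := (ucvg abs r).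

Lemma bnd1 : bnd 1 1.
Proof. by have := bnd_const Habs r 1; rewrite rmorph1 (abs1 Habs). Qed.

Lemma ucvg_bnd F f B : 0 < B -> (forall m, bnd (F m) B) -> ucvg F f -> bnd f B.
Proof.
move=> B_gt0 HF /(_ _ B_gt0) [N HN]; have -> : f = F N - (F N - f) by rewrite opprB addrC subrK.
apply: (bndD Habs r_gt0) => // i; rewrite psN (absN Habs); exact: HN.
Qed.

Lemma ucvg_steps F : (forall m, conv (F m)) -> ucvg (fun m => F m.+1 - F m) 0 ->
  exists2 f, ucvg F f & conv f.
Proof.
move=> cF HF; apply: (ucvg_complete Habs r_gt0 Hcompl) => // eps /HF [N HN].
have H m : (N <= m)%N -> bnd (F m - F N) eps.
  elim: m => [|m IHm]; first by rewrite leqn0 => /eqP ->; rewrite subrr => i; have := HN _ (leqnn _) i;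
    apply: le_trans; rewrite ps0 (abs0 Habs) mul0r mulr_ge0 ?(abs_ge0 Habs) ?exprn_ge0 ?ltW.
  rewrite leq_eqVlt => /predU1P[<- | le_m].
    by rewrite subrr => i; have := HN _ (leqnn _) i;
    apply: le_trans; rewrite ps0 (abs0 Habs) mul0r mulr_ge0 ?(abs_ge0 Habs) ?exprn_ge0 ?ltW.
  have -> : F m.+1 - F N = (F m.+1 - F m - 0) + (F m - F N) by rewrite subr0 addrA subrK.
  by apply: (bndD Habs r_gt0); [apply: HN | apply: IHm].
exists N => m k /H Hm /H Hk; have -> : F m - F k = (F m - F N) - (F k - F N).
  by rewrite opprB addrA subrK.
by apply: (bndD Habs r_gt0) => // i; rewrite psN (absN Habs).
Qed.

Lemma ucvg0_bnd (a : nat -> pser C) : (forall m, conv (a m)) -> ucvg a 0 ->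
  exists2 B, 0 < B & forall m, bnd (a m) B.
Proof.
move=> ca /(_ _ ltr01) [N HN].
suff [B B_gt0 HB] : exists2 B, 0 < B & forall m, (m < N)%N -> bnd (a m) B.
  exists (Num.max B 1); first by rewrite lt_max B_gt0.
  move=> m i; rewrite le_max; case: (ltnP m N) => [/HB -> // | /HN /(_ i)].
  by rewrite subr0 => ->; rewrite orbT.
elim: N {HN} => [|N [B B_gt0 HB]]; first by exists 1.
have [A A_gt0 HA] := conv_bnd (ca N); exists (Num.max A B); first by rewrite lt_max A_gt0.
move=> m; rewrite ltnS leq_eqVlt => /predU1P[-> | /HB Hm] i; rewrite le_max ?HA //.
by rewrite Hm orbT.
Qed.

Lemma ucvg0M (a b : nat -> pser C) B : 0 < B -> (forall m, bnd (b m) B) -> ucvg a 0 ->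
  ucvg (fun m => a m * b m) 0.
Proof.
move=> B_gt0 Hb Ha eps eps_gt0; have [N HN] := Ha _ (divr_gt0 eps_gt0 B_gt0).
exists N => m /HN; rewrite !subr0 => Ham; rewrite -[eps](divfK (lt0r_neq0 B_gt0)).
by apply: (bndM Habs r_gt0) => //; rewrite ltW ?divr_gt0.
Qed.

(** Increments of the outer sum are [a m] times an inner sum, so the uniform bound on inner sums has
    to be carried through the induction. *)
Lemma itsum_ucvg (s : seq (nat -> pser C)) :
  (forall a, a \in s -> (forall m, conv (a m)) /\ ucvg a 0) ->
  (exists2 f, ucvg (itsum s) f & conv f) /\
  (forall N, conv (itsum s N)) /\ (exists2 B, 0 < B & forall N, bnd (itsum s N) B).
Proof.
elim: s => [_ | a s IHs Hs].
  split; last split; last 1 first.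
  - by exists 1 => // N; apply: bnd1.
  - by exists 1; [move: (ucvg_cst Habs r 1); apply: ucvg_ext | apply: (conv1 Habs)].
  - by move=> N; apply: (conv1 Habs).
have [_ [cs [B B_gt0 HB]]] := IHs (fun b sb => Hs b (mem_behead (s := a :: s) sb)).
have [ca a0] := Hs a (mem_head _ _); have [A A_gt0 HA] := ucvg0_bnd ca a0.
have cas N : conv (itsum (a :: s) N).
  by apply: (conv_sum Habs r_gt0) => i _ _; apply: (convM Habs r_gt0).
split; last split=> //.
  apply: ucvg_steps => //; apply: ucvg_ext (ucvg0M B_gt0 HB a0) => m /=.
  by rewrite big_ord_recr /= addrAC subrr add0r.
exists (A * B) => [|N]; first exact: mulr_gt0.
apply: (bnd_sum Habs r_gt0) => [|i _]; first by rewrite mulr_ge0 ?ltW.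
by apply: (bndM Habs r_gt0); rewrite ?ltW.
Qed.

Lemma evat_itsum z (a : seq (nat -> pser C)) (b : seq (nat -> C)) N : size a = size b ->
  (forall k n, (k < size b)%N -> evat abs r z (nth (fun=> 0) a k n) (nth (fun=> 0) b k n)) ->
  evat abs r z (itsum a N) (itsum b N).
Proof.
elim: a b N => [|a1 a IHa] [|b1 b] N //= => [_ _ | [szab] H]; first exact: (evat1 Habs).
apply: (evat_sum Habs r_gt0) => i _; apply: (evatM Habs r_gt0); first exact: (H 0%N).
by apply: IHa => // k n lt_k; apply: (H k.+1 n).
Qed.

Lemma evat_div z a f g v : evat abs r z f v -> f = of_poly ('X - a%:P) * g -> conv g -> a != z ->
  evat abs r z g (v / (z - a)).
Proof.
move=> evf defg cg nz; have nza : z - a != 0 by rewrite subr_eq0 eq_sym.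
have -> : g = (f - of_poly ('X - z%:P) * g) * of_poly ((z - a)^-1)%:P.
  rewrite defg -mulrBl -rmorphB /= (_ : _ - _ = (z - a)%:P); last by rewrite polyCB; ring.
  rewrite mulrAC -rmorphM /=.
  by rewrite -polyCM mulfV // rmorph1 mul1r.
rewrite -[v]subr0; apply: (evatM Habs r_gt0).
  case: evf => h ch ->; exists (h - g); first exact: (convB Habs r_gt0).
  by rewrite subr0 mulrBr addrA.
by rewrite -{2}[(z - a)^-1](hornerC _ z); apply: (evat_poly Habs).
Qed.

End Limits.

(** * The function Omega *)

Section Omega.
Variables (C : closedFieldType) (R : realFieldType) (abs : C -> R).
Hypotheses (Habs : nonarch_abs abs) (Hcompl : complete_abs abs).
Variables (p e : nat) (chC : p \in [pchar C]) (e_gt0 : (0 < e)%N).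
Local Notation q := (p ^ e)%N.
Variables (theta : C) (Htheta : 1 < abs theta).
Local Notation Th := (abs theta).
Variables (zeta : C) (Hzeta : zeta ^+ (q - 1) = - theta).
Local Notation fr := (fr e chC).
Local Notation tw := (tw e chC).
Local Notation conv := (conv abs Th).
Local Notation bnd := (bnd abs Th).
Local Notation ucvg := (ucvg abs Th).
Local Notation Kbar := (in_Kbar q theta).
Local Notation Th_gt0 := (Th_gt0 Htheta).

Let nz_theta : theta != 0.
Proof. by rewrite -(abs_eq0 Habs) gt_eqF ?Th_gt0. Qed.
Let q1_gt0 : (0 < q - 1)%N. Proof. by rewrite subn_gt0 (q_gt1 chC e_gt0). Qed.
Let abs_zeta : abs zeta ^+ (q - 1) = Th. Proof. by rewrite -(absX Habs) Hzeta (absN Habs). Qed.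
Let zeta_gt1 : 1 < abs zeta.
Proof.
rewrite ltNge; apply/negP => le1; move: Htheta; rewrite -abs_zeta ltNge.
by rewrite exprn_ile1 ?(abs_ge0 Habs).
Qed.
Let nz_zeta : zeta != 0. Proof. by rewrite -(abs_eq0 Habs) gt_eqF ?(lt_trans ltr01). Qed.

Lemma zeta_Kbar : Kbar zeta.
Proof.
have sK := Kbar_subfield e chC theta.
by apply: (Kbar_root chC q1_gt0); rewrite Hzeta; apply: (sfN sK); apply: (theta_Kbar e chC).
Qed.

Lemma theta_pow_inj m n : theta ^+ m = theta ^+ n -> m = n.
Proof.
move/(congr1 abs); rewrite !(absX Habs) => E.
by apply/eqP; rewrite eqn_leq; apply/andP; split; rewrite leqNgt; apply/negP => /(ThX_lt Htheta);
  rewrite E ltxx.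
Qed.

Let cc i : C := (theta ^+ (q ^ i))^-1.
Let abs_cc i : abs (cc i) = (Th ^+ (q ^ i))^-1. Proof. by rewrite (absV Habs) (absX Habs). Qed.
Let qi_gt1 i : (0 < i)%N -> (1 < q ^ i)%N.
Proof. by move=> i_gt0; rewrite -(exp1n i) ltn_exp2r ?(q_gt1 chC e_gt0). Qed.
Let cc_small i : (0 < i)%N -> abs (theta * cc i) = (Th ^+ (q ^ i).-1)^-1.
Proof.
move=> i_gt0; rewrite (absM Habs) abs_cc; case: (q ^ i)%N (qi_gt1 i_gt0) => // k _.
by rewrite exprS invfM mulrA mulfV ?mul1r // gt_eqF ?Th_gt0.
Qed.
Let cc_lt1 i : (0 < i)%N -> abs (theta * cc i) < 1.
Proof.
move=> i_gt0; rewrite cc_small // invf_lt1 ?(ThX_gt0 Htheta) //.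
by rewrite -(expr0 Th) (ThX_lt Htheta) // -ltnS prednK ?qi_gt1 // ltnW ?qi_gt1.
Qed.
Let abs_fac i : (0 < i)%N -> abs (1 - theta * cc i) = 1.
Proof.
move=> i_gt0; rewrite (absD_eq Habs) ?(abs1 Habs) // (absN Habs); exact: cc_lt1.
Qed.

Let sN N : C := zeta ^+ q * \prod_(1 <= i < N.+1) (1 - theta / theta ^+ (q ^ i))^-1.
Let abs_sN N : abs (sN N) = abs zeta ^+ q.
Proof.
rewrite (absM Habs) (absX Habs) (abs_prod Habs) big_nat big1 ?mulr1 // => i /andP[i_gt0 _].
by rewrite (absV Habs) abs_fac // invr1.
Qed.
Let zq_gt0 : 0 < abs zeta ^+ q. Proof. by rewrite exprn_gt0 // (lt_trans ltr01). Qed.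

Section PiTilde.
Variables (pt : C) (Hpt : IsPiTilde abs q theta zeta pt).

(** All partial products have absolute value [abs zeta ^+ q], since each factor has absolute value
    1. *)
Lemma pi_tilde_neq0 : pt != 0.
Proof.
apply/eqP => pt0; have [N /(_ N (leqnn N))] := Hpt zq_gt0.
by rewrite -/(sN N) pt0 subr0 abs_sN ltxx.
Qed.

(* The value group need not be archimedean a priori; convergence of the product for [pt] makes the
   powers of [Th] cofinal. *)
Lemma Th_cofinal B : exists n, B <= Th ^+ n.
Proof.
have [le_B | B_gt0] := leP B 0; first by exists 0%N; rewrite (le_trans le_B) ?expr0 ?ler01.
have [N HN] := Hpt (divr_gt0 zq_gt0 B_gt0).
exists (q ^ N.+1).-1; have := absB_lt Habs (HN _ (leqnSn N)) (HN _ (leqnn N)).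
rewrite -/(sN N) -/(sN N.+1) opprB addrA subrK.
have -> : sN N.+1 - sN N = sN N * (theta * cc N.+1) / (1 - theta * cc N.+1).
  have -> : sN N.+1 = sN N / (1 - theta * cc N.+1) by rewrite /sN big_nat_recr //= mulrA.
  have nz1 : 1 - theta * cc N.+1 != 0 by rewrite -(abs_eq0 Habs) abs_fac ?oner_eq0.
  by move: nz1; move: (theta * _) (sN N) => a b nz1; field.
rewrite (absM Habs) (absV Habs) abs_fac // invr1 mulr1 (absM Habs) abs_sN ltr_pM2l //.
by rewrite cc_small // ltf_pV2 ?posrE ?(ThX_gt0 Htheta) // => /ltW.
Qed.
Local Notation Hcof := Th_cofinal.

Let OmP N : {poly C} := (zeta ^- q)%:P * \prod_(1 <= i < N.+1) (1 - (cc i)%:P * 'X).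

Let OmP_S N : OmP N.+1 = OmP N * (1 - (cc N.+1)%:P * 'X).
Proof. by rewrite /OmP big_nat_recr //= mulrA. Qed.

Let bnd_cX i : bnd (of_poly ((cc i)%:P * 'X)) (Th / Th ^+ (q ^ i)).
Proof.
move=> j; rewrite /of_poly coefCM coefX; case: eqP => [-> | _].
  by rewrite mulr1 abs_cc expr1 mulrC.
by rewrite mulr0 (abs0 Habs) mul0r divr_ge0 ?ltW ?Th_gt0 ?(ThX_gt0 Htheta).
Qed.

Let bnd_OmP N : bnd (of_poly (OmP N)) (abs zeta ^- q).
Proof.
elim: N => [|N IHN].
  rewrite /OmP big_geq // mulr1; have := bnd_const Habs Th (zeta ^- q).
  by rewrite (absV Habs) (absX Habs).
have zq_ge0 : 0 <= abs zeta ^- q by rewrite invr_ge0 ltW.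
rewrite OmP_S rmorphM -[_ ^- _]mulr1; apply: (bndM Habs Th_gt0) => //; rewrite rmorphB rmorph1 => i.
apply: (bndD Habs Th_gt0) => {}i; first exact: (bnd1 Habs).
rewrite psN (absN Habs); apply: le_trans (bnd_cX _ i) _.
by rewrite ler_pdivrMr ?(ThX_gt0 Htheta) // mul1r -{1}[Th]expr1 (ThX_le Htheta) // ltnW ?qi_gt1.
Qed.

Let OmP_steps : ucvg (fun m => of_poly (OmP m.+1) - of_poly (OmP m)) 0.
Proof.
apply: (@ucvg_ext _ _ _ _ (fun m => - of_poly ((cc m.+1)%:P * 'X) * of_poly (OmP m))) => [m|].
  by rewrite OmP_S -rmorphB -rmorphN -rmorphM /=; congr of_poly; ring.
apply: (ucvg0M Habs Th_gt0 _ bnd_OmP); first by rewrite invr_gt0.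
move=> eps eps_gt0; have [n Hn] := Hcof eps^-1.
exists n => m le_nm i; rewrite subr0 psN (absN Habs); apply: le_trans (bnd_cX _ i) _.
rewrite ler_pdivrMr ?(ThX_gt0 Htheta) // -ler_pdivrMl //.
have lt_m : (n.+1 <= q ^ m.+1)%N by apply: leq_trans (ltn_pow chC e_gt0 m.+1); rewrite ltnS leqW.
apply: le_trans (ThX_le Htheta lt_m); rewrite exprSr; apply: ler_wpM2r => //; exact/ltW/Th_gt0.
Qed.

Lemma ucvg_tw n F f : ucvg F f -> ucvg (fun m => tw n (F m)) (tw n f).
Proof.
move=> Hf eps eps_gt0; pose d := Num.min eps 1.
have d_gt0 : 0 < d by rewrite lt_min eps_gt0 ltr01.
have [N HN] := Hf _ d_gt0; exists N => m /HN /(bnd_tw Habs e chC n Th_gt0) Hm i.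
have := Hm i; rewrite -rmorphB; set x := abs _ => Hx.
have le1 : (1 <= q ^ n)%N := qn_gt0 e chC n.
apply: (@le_trans _ _ (x * (Th ^+ (q ^ n)) ^+ i)).
  apply: ler_wpM2l; first exact: (abs_ge0 Habs).
  by rewrite -exprM (ThX_le Htheta) // leq_pmull.
apply: le_trans Hx _; apply: (@le_trans _ _ d); last by rewrite ge_min lexx.
rewrite -[leRHS]expr1; apply: ler_wiXn2l => //; first exact: ltW.
by rewrite ge_min lexx orbT.
Qed.

Lemma bnd_tw_Th n f B : bnd f B -> bnd (tw n f) (B ^+ (q ^ n)).
Proof.
move=> /(bnd_tw Habs e chC n Th_gt0) H i; apply: le_trans (H i).
apply: ler_wpM2l; first exact: (abs_ge0 Habs).
by rewrite -exprM (ThX_le Htheta) // leq_pmull // (qn_gt0 e chC).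
Qed.

Lemma conv_tw_Th n f : conv f -> conv (tw n f).
Proof.
move=> /(conv_tw Habs e chC n Th_gt0); apply: (conv_mono Habs); first exact/ltW/Th_gt0.
by rewrite -{1}[Th]expr1 (ThX_le Htheta) // (qn_gt0 e chC).
Qed.

Let cc_fr i : fr 1 (cc i) = cc i.+1.
Proof. by rewrite frE expn1 /cc exprVn -exprM -expnSr. Qed.

(** The equation [zeta ^+ (q - 1) = - theta] raised to the power [q]; it matches the normalising
    factor of Omega with its functional equation. *)
Let zeta_fr : - theta ^+ q * fr 1 (zeta ^- q) = zeta ^- q.
Proof.
have -> : - theta ^+ q = zeta ^+ ((q - 1) * q).
  by rewrite exprM Hzeta -[RHS]/(frob e chC (- theta)) rmorphN.
rewrite frE expn1 exprVn -exprM mulnBl mul1n expfB_cond; last by rewrite (negPf nz_zeta) leq_pmull // ltnW // (q_gt1 chC e_gt0).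
by rewrite mulrAC mulfV ?mul1r // expf_neq0.
Qed.

Lemma Omega_exists : exists Om : pser C,
  [/\ conv Om, bnd Om (abs zeta ^- q), Om = of_poly ('X - (theta ^+ q)%:P) * tw 1 Om,
      evat abs Th theta Om pt^-1 & Om != 0].
Proof.
have [Om HOm cOm] := ucvg_steps Habs Hcompl Th_gt0 (fun m => conv_poly Habs Th (OmP m)) OmP_steps.
have eOm : evat abs Th theta Om pt^-1.
  apply: (evat_lim Habs Th_gt0 Hcompl (V := fun m => (OmP m).[theta])) HOm _ => //.
    by move=> m; apply: (evat_poly Habs).
  apply: cvg_ext (cvg_neq0_inv Habs pi_tilde_neq0 Hpt) => m.
  rewrite invfM -prodfV hornerM hornerC horner_prod; congr (_ * _); apply: eq_bigr => i _.
  by rewrite invrK !hornerE mulrC.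
exists Om; split=> //.
- by apply: (ucvg_bnd Habs Th_gt0) HOm => //; rewrite invr_gt0.
- apply: (ucvg_unique Habs Th_gt0 (ucvg_shift 1 HOm)).
  have cfr m : of_poly ('X - (theta ^+ q)%:P) * tw 1 (of_poly (OmP m)) = of_poly (OmP (m + 1)%N).
    rewrite tw_of_poly -rmorphM /=; congr of_poly; rewrite /OmP rmorphM /= map_polyC /= rmorph_prod /=.
    rewrite addn1 [in RHS]big_ltn // [in RHS]big_add1 /=.
    rewrite (eq_bigr (fun i => 1 - (cc i.+1)%:P * 'X)); last first.
      by move=> i _; rewrite rmorphB rmorph1 rmorphM /= map_polyC map_polyX /= cc_fr.
    have -> : 'X - (theta ^+ q)%:P = - (theta ^+ q)%:P * (1 - (cc 1)%:P * 'X).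
      rewrite mulrBr mulr1 mulNr opprK mulrA -polyCM /cc expn1 mulfV ?expf_neq0 // mul1r; ring.
    have -> : (zeta ^- q)%:P = - (theta ^+ q)%:P * (fr 1 (zeta ^- q))%:P by rewrite -polyCN -polyCM zeta_fr.
    by rewrite -!mulrA; congr (_ * _); rewrite mulrCA.
  apply: ucvg_ext cfr _; apply: (ucvgM Habs Th_gt0) => [m|m||].
  + exact: (conv_poly Habs).
  + exact/conv_tw_Th/(conv_poly Habs).
  + exact: (ucvg_cst Habs).
  + exact: ucvg_tw.
apply: contraNneq pi_tilde_neq0 => Om0; rewrite -invr_eq0; apply/eqP.
by apply: (evat0_eq Habs Th_gt0 (z := theta)); rewrite -?Om0.
Qed.

End PiTilde.
End Omega.

(** * The iterated series Y and their values *)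

Section IteratedSeries.
Variables (C : closedFieldType) (R : realFieldType) (abs : C -> R).
Hypotheses (Habs : nonarch_abs abs) (Hcompl : complete_abs abs).
Variables (p e : nat) (chC : p \in [pchar C]) (e_gt0 : (0 < e)%N).
Local Notation q := (p ^ e)%N.
Variables (theta : C) (Htheta : 1 < abs theta).
Local Notation Th := (abs theta).
Variables (zeta : C) (Hzeta : zeta ^+ (q - 1) = - theta).
Local Notation fr := (fr e chC).
Local Notation tw := (tw e chC).
Local Notation conv := (conv abs Th).
Local Notation bnd := (bnd abs Th).
Local Notation ucvg := (ucvg abs Th).
Local Notation Kbar := (in_Kbar q theta).
Local Notation Th_gt0 := (Th_gt0 Htheta).
Hypothesis Hcof : forall B : R, exists n, B <= Th ^+ n.

(* Two terms of an equation for [x] over [Fq[theta]] tie in absolute value. *)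
Lemma alg_small x : Kbar x -> abs x < 1 -> exists2 D, (0 < D)%N & abs x ^+ D * Th <= 1.
Proof.
move=> [P [nzP [KP /eqP rP]]] x_lt1.
have [-> | nz_x] := eqVneq x 0; first by exists 1%N => //; rewrite (abs0 Habs) mul0r ler01.
have x_gt0 : 0 < abs x by rewrite (abs_gt0 Habs).
have [D [FD nzD] [a Fa Ha]] := @common_denominator _ _ e chC theta _ (fun i : 'I_(size P) => P`_i) (fun i => KP i).
pose t i := (a i).[theta] * x ^+ i.
have sum_t : \sum_i t i = 0.
  transitivity (D.[theta] * P.[x]); last by rewrite rP mulr0.
  by rewrite [P.[x]]horner_coef mulr_sumr; apply: eq_bigr => i _; rewrite /t -Ha mulrA.
have sP : (0 < size P)%N by rewrite size_poly_gt0.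
have lt_last : ((size P).-1 < size P)%N by rewrite prednK.
pose last := Ordinal lt_last.
have nz_t i : (a i).[theta] != 0 -> abs (t i) = Th ^+ (size (a i)).-1 * abs x ^+ i.
  move=> nz_a; rewrite /t (absM Habs) (absX Habs) (Fq_poly_abs Habs chC e_gt0 Htheta) //.
  by apply: contraNneq nz_a => ->; rewrite horner0.
have nz_last : (a last).[theta] != 0.
  by rewrite -Ha mulf_neq0 // -[P`_last]/(lead_coef P) lead_coef_eq0.
have [i nz_i max_i] := @arg_maxP _ _ _ last (fun i => (a i).[theta] != 0) (fun i => abs (t i)) nz_last.
have [j nz_j [ne_ji eq_ji]] : exists2 j, (a j).[theta] != 0 & j != i /\ abs (t j) = abs (t i).
  apply: contrapT => no; have ti_gt0 : 0 < abs (t i).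
    by rewrite (abs_gt0 Habs) mulf_neq0 ?expf_neq0.
  have lt_i j : j != i -> abs (t j) < abs (t i).
    move=> ne_ji; have [a0 | nz_j] := eqVneq (a j).[theta] 0; first by rewrite /t a0 mul0r (abs0 Habs).
    rewrite lt_neqAle [X in _ && X](max_i j nz_j) andbT; apply/eqP => eq_ji; apply: no; by exists j.
  move: sum_t; rewrite (bigD1 i) //= => /(congr1 abs); rewrite (absD_eq Habs) ?(abs0 Habs).
    by move=> t0; rewrite t0 ltxx in ti_gt0.
  by apply: (abs_sum_lt Habs) => // j _; apply: lt_i.
have tie (i1 i2 : 'I_(size P)) : (i1 < i2)%N -> (a i1).[theta] != 0 -> (a i2).[theta] != 0 ->
    abs (t i1) = abs (t i2) -> exists2 D, (0 < D)%N & abs x ^+ D * Th <= 1.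
  move=> lt12 nz1 nz2; rewrite !nz_t // -(subnK (ltnW lt12)) exprD mulrA => E0.
  have E := mulIf (lt0r_neq0 (exprn_gt0 i1 x_gt0)) E0.
  exists (i2 - i1)%N; first by rewrite subn_gt0.
  set k1 := (size _).-1 in E; set k2 := (size _).-1 in E.
  have lt_k : (k1 < k2)%N.
    rewrite ltnNge; apply/negP => /(ThX_le Htheta); rewrite E leNgt => /negP; apply.
    by rewrite gtr_pMr ?(ThX_gt0 Htheta) // exprn_ilt1 ?ltW // subn_eq0 -ltnNge.
  rewrite -(ler_pM2l (ThX_gt0 Htheta k1)) mulr1 mulrCA -exprSr mulrC.
  apply: le_trans (_ : Th ^+ k2 * abs x ^+ (i2 - i1) <= _); last by rewrite -E.
  by apply: ler_wpM2r; [rewrite exprn_ge0 // ltW | apply: (ThX_le Htheta)].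
case: (ltngtP i j) => [lt_ij | lt_ji | /val_inj eq_ij]; last by rewrite eq_ij eqxx in ne_ji.
  exact: (tie i j).
exact: (tie j i).
Qed.

(** By [alg_small] some power of [x] has absolute value at most the inverse of [Th], and the powers
    of [Th] are cofinal. Algebraicity replaces here the archimedean property of the value field. *)
Lemma alg_small_pow x eps : Kbar x -> abs x < 1 -> 0 < eps ->
  exists N, forall n, (N <= n)%N -> abs x ^+ n <= eps.
Proof.
move=> Kx x_lt1 eps_gt0; have [D D_gt0 leD] := alg_small Kx x_lt1; have [m Hm] := Hcof eps^-1.
exists (D * m)%N => n le_n; apply: le_trans (_ : abs x ^+ (D * m) <= _).
  by apply: ler_wiXn2l => //; [apply: (abs_ge0 Habs) | apply: ltW].
rewrite -(ler_pM2r (ThX_gt0 Htheta m)) exprM -exprMn; apply: le_trans (_ : 1 <= _).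
  by rewrite exprn_ile1 // mulr_ge0 ?exprn_ge0 ?(abs_ge0 Habs) // ltW ?Th_gt0.
by rewrite -ler_pdivrMl // mulr1.
Qed.

Variables (pt : C) (Om : pser C).
Hypotheses (cOm : conv Om) (bOm : bnd Om (abs zeta ^- q)).
Hypothesis Om_eq : Om = of_poly ('X - (theta ^+ q)%:P) * tw 1 Om.
Hypothesis eOm : evat abs Th theta Om pt^-1.
Variables (d : nat) (nn : nat -> nat) (u : nat -> {poly C}).
Hypothesis Ku : forall k, (1 <= k <= d)%N -> forall j, Kbar (u k)`_j.
Hypothesis Hubd : forall k, (1 <= k <= d)%N -> forall j,
            abs (u k)`_j ^+ (q - 1) < Th ^+ (nn k * q).

Let f k := of_poly (u k) * Om ^+ nn k.
Let ff k : nat -> pser C := fun m => tw m (f k).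

Let cff k m : conv (ff k m).
Proof.
apply: (conv_tw_Th Habs e chC Htheta); apply: (convM Habs Th_gt0); first exact: (conv_poly Habs).
exact: (convX Habs Th_gt0).
Qed.

Let ff_small k : (1 <= k <= d)%N -> ucvg (ff k) 0.
Proof.
move=> Hk eps eps_gt0; have sK := Kbar_subfield e chC theta.
have zeta_gt0 : 0 < abs zeta.
  by rewrite (abs_gt0 Habs); apply: contraTneq Htheta => z0; move: Hzeta; rewrite z0 expr0n subn_eq0
    leqNgt (q_gt1 chC e_gt0) /= => /esym/eqP; rewrite oppr_eq0 => /eqP ->; rewrite (abs0 Habs) -leNgt ler01.
have zM_gt0 n : 0 < abs zeta ^+ n by apply: exprn_gt0.
(* Each coefficient of [u k] is weighed against the Gauss norm bound [abs zeta ^- q] of [Om], taken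
   [nn k] times. As [abs zeta ^+ (q - 1) = Th], the hypothesis on [u k] says exactly that
   [abs (ga j) < 1]; the [ga j] are algebraic, so their powers decay. *)
pose ga j := (u k)`_j / zeta ^+ (q * nn k).
have ga_lt1 j : abs (ga j) < 1.
  rewrite (absM Habs) (absV Habs) (absX Habs) ltr_pdivrMr // mul1r ltNge; apply/negP => le_u.
  have := Hubd Hk j; rewrite ltNge => /negP; apply.
  rewrite -{1}(absN Habs theta) -Hzeta (absX Habs) -exprM mulnC [(nn k * q)%N]mulnC exprM.
  by apply: lerXn2r; rewrite ?nnegrE ?(abs_ge0 Habs) // ltW.
have Kga j : Kbar (ga j).
  apply: (sfM sK); first exact: Ku.
  by apply: (sfV sK); apply: (sfX sK); apply: (zeta_Kbar chC e_gt0 Hzeta).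
have [N HN] : exists N, forall j n, (j < size (u k))%N -> (N <= n)%N -> abs (ga j) ^+ n * Th ^+ j <= eps.
  elim: (size _) => [|s [N HN]]; first by exists 0%N.
  have [N' HN'] := alg_small_pow (Kga s) (ga_lt1 s) (divr_gt0 eps_gt0 (ThX_gt0 Htheta s)).
  exists (maxn N N') => j n; rewrite ltnS leq_eqVlt geq_max => /predU1P[-> | lt_j] /andP[leN leN'].
    by rewrite -ler_pdivlMr ?(ThX_gt0 Htheta) // HN'.
  exact: HN.
exists N => m le_m; rewrite subr0 /ff /f rmorphM rmorphXn /= tw_of_poly.
pose B := ((abs zeta ^- q) ^+ (q ^ m)) ^+ nn k.
have B_gt0 : 0 < B by rewrite !exprn_gt0 // invr_gt0.
rewrite -[eps](divfK (lt0r_neq0 B_gt0)); apply: (bndM Habs Th_gt0); rewrite ?ltW ?divr_gt0 //; last first.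
  by apply: (bndX Habs Th_gt0); [rewrite exprn_ge0 // invr_ge0 ltW | apply: bnd_tw_Th].
move=> j; rewrite /of_poly coef_map /= frE (absX Habs) ler_pdivlMr //.
case: (ltnP j (size (u k))) => [lt_j | le_j]; last first.
  by rewrite nth_default // (abs0 Habs) expr0n gtn_eqF ?(qn_gt0 e chC) // !mul0r ltW.
rewrite mulrAC; apply: le_trans (HN j (q ^ m)%N lt_j _); last first.
  by apply: leq_trans le_m _; apply/ltnW/(ltn_pow chC e_gt0).
rewrite le_eqVlt; apply/orP; left; apply/eqP; congr (_ * _).
rewrite /B /ga (absM Habs) (absV Habs) (absX Habs) exprMn -!exprVn -!exprM; congr (_ * _ ^+ _).
by rewrite mulnA mulnAC.
Qed.

Definition Yterms i j := [seq ff k | k <- iota j (i - j)].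

Let Yterms_ok i j : (0 < j <= i)%N -> (i <= d.+1)%N ->
  forall a, a \in Yterms i j -> (forall m, conv (a m)) /\ ucvg a 0.
Proof.
move=> /andP[j_gt0 le_ji] le_i a /mapP[k]; rewrite mem_iota => Hk ->; split=> //.
by apply: ff_small; move: Hk; lia.
Qed.

Let Yterms_rcons i j : (j < i)%N -> Yterms i j = rcons (Yterms i.-1 j) (ff i.-1).
Proof.
case: i => // i; rewrite ltnS => le_ji; rewrite /Yterms /= subSn // -addn1 iotaD map_cat /= cats1.
by rewrite subnKC.
Qed.

Let tw_itsum i j N : itsum (map (@shift_fun _) (Yterms i j)) N = tw 1 (itsum (Yterms i j) N).
Proof.
rewrite /Yterms; elim: (iota _ _) N => [|k s IHs] N /=; first by rewrite rmorph1.
rewrite rmorph_sum; apply: eq_bigr => m _; rewrite rmorphM /= IHs; congr (_ * _).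
by rewrite /shift_fun /ff twD.
Qed.

Lemma Y_exists : exists Y : nat -> nat -> pser C,
  [/\ forall i j, (0 < j <= i)%N -> (i <= d.+1)%N -> conv (Y i j),
      forall j, (0 < j <= d.+1)%N -> Y j j = 1,
      forall i j, (0 < j < i)%N -> (i <= d.+1)%N ->
        Y i j = tw 1 (Y i j) + of_poly (u i.-1) * Om ^+ nn i.-1 * tw 1 (Y i.-1 j) &
      forall x i j, (0 < j < i)%N -> (i <= d.+1)%N ->
        IsL abs q theta (subseq_ij u i j) (subseq_ij nn i j) x ->
        evat abs Th theta (Y i j) (pt^-1 ^+ (\sum_(j <= k < i) nn k) * x)].
Proof.
have H ij : exists y, (0 < ij.2 <= ij.1)%N -> (ij.1 <= d.+1)%N -> ucvg (itsum (Yterms ij.1 ij.2)) y /\ conv y.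
  case: ij => i j /=; case: (boolP ((0 < j <= i)%N && (i <= d.+1)%N)) => [/andP[Hj Hi] | no]; last first.
    by exists 0 => Hj Hi; rewrite Hj Hi in no.
  by have [[y Hy cy] _] := itsum_ucvg Habs Hcompl Th_gt0 (Yterms_ok Hj Hi); exists y.
have [Y HY] := choice H; exists (fun i j => Y (i, j)).
have cY i j (Hj : (0 < j <= i)%N) (Hi : (i <= d.+1)%N) := (HY (i, j) Hj Hi).2.
have uY i j (Hj : (0 < j <= i)%N) (Hi : (i <= d.+1)%N) := (HY (i, j) Hj Hi).1.
split=> //.
- move=> j /andP[j_gt0 le_j]; have := uY j j; rewrite j_gt0 leqnn /= => /(_ isT le_j).
  rewrite /Yterms subnn /= => Hu; apply: (ucvg_unique Habs Th_gt0 Hu).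
  exact: (ucvg_cst Habs Th 1).
- move=> i j /andP[j_gt0 lt_ji] le_i.
  have Hji : (0 < j <= i)%N by rewrite j_gt0 ltnW.
  have Hji1 : (0 < j <= i.-1)%N by move: lt_ji; rewrite j_gt0; case: (i).
  have le_i1 : (i.-1 <= d.+1)%N by apply: leq_trans le_i; apply: leq_pred.
  apply: (ucvg_unique Habs Th_gt0 (ucvg_shift 1 (uY i j Hji le_i))).
  apply: (@ucvg_ext _ _ _ _ (fun m => tw 1 (itsum (Yterms i j) m) + f i.-1 * tw 1 (itsum (Yterms i.-1 j) m))).
    move=> m; rewrite addn1 -!tw_itsum Yterms_rcons //= itsum_rconsS; congr (_ + _ * _).
    by rewrite /ff tw0.
  have cI i' j' (Hj' : (0 < j' <= i')%N) (Hi' : (i' <= d.+1)%N) :=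
    (itsum_ucvg Habs Hcompl Th_gt0 (Yterms_ok Hj' Hi')).2.1.
  apply: (ucvgD Habs Th_gt0); first exact: (ucvg_tw Habs _ _ Htheta _ (uY _ _ _ _)).
  apply: (ucvgM Habs Th_gt0) => [m|m||].
  + by rewrite -[f _](tw0 e chC); apply: cff.
  + by apply: (conv_tw_Th Habs e chC Htheta); apply: cI.
  + exact: (ucvg_cst Habs).
  + exact: (ucvg_tw Habs _ _ Htheta _ (uY _ _ _ _)).
move=> x i j /andP[j_gt0 lt_ji] le_i [sz HL].
have Hji : (0 < j <= i)%N by rewrite j_gt0 ltnW.
(* One passes from [tw m Om] to [tw m.+1 Om] by dividing by [X - theta^(q^(m+1))], which does not
   vanish at [theta]; the values of these factors build up [Pth]. *)
have etwOm m : evat abs Th theta (tw m Om) (pt^-1 / Pth q theta m).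
  elim: m => [|m IHm]; first by rewrite tw0 /Pth big_geq // divr1.
  rewrite /Pth big_nat_recr //= -/(Pth q theta m) invfM mulrA.
  apply: (evat_div Habs Th_gt0 IHm) => //; first last.
  - apply/eqP => /(@theta_pow_inj _ _ _ Habs _ Htheta _ 1) /eqP.
    by rewrite gtn_eqF // -(exp1n m.+1) ltn_exp2r // (q_gt1 chC e_gt0).
  - exact: (conv_tw_Th Habs e chC Htheta).
  rewrite {1}Om_eq rmorphM /= tw_of_poly twD addn1; congr (of_poly _ * _).
  by rewrite rmorphB /= map_polyX map_polyC /= frE -exprM -expnS.
pose V N := itsum [seq (fun m => frob_eval q theta m (u k) * (pt^-1 / Pth q theta m) ^+ nn k) | k <- iota j (i - j)] N.
have szk : size (iota j (i - j)) = (i - j)%N := size_iota _ _.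
apply: (evat_lim Habs Th_gt0 Hcompl (V := V)) (uY i j Hji le_i) _ => //.
  move=> N; apply: (evat_itsum Habs Th_gt0); first by rewrite !size_map.
  move=> k m; rewrite size_map => lt_k; rewrite !(nth_map 0%N) //.
  rewrite /ff /f rmorphM rmorphXn /= tw_of_poly; apply: (evatM Habs Th_gt0).
    have -> : frob_eval q theta m (u (nth 0%N (iota j (i - j)) k)) = (map_poly (fr m) (u (nth 0%N (iota j (i - j)) k))).[theta].
      by rewrite /frob_eval; congr (_.[_]); apply: eq_map_poly => a; rewrite frE.
    exact: (evat_poly Habs).
  exact: (evatX Habs Th_gt0).
apply: cvg_ext (cvg_mulc Habs _ HL) => N.
rewrite L_partial_itsum size_map size_iota expr_sum.
have -> : \prod_(j <= k < i) pt^-1 ^+ nn k = \prod_(y <- [seq pt^-1 ^+ nn k | k <- iota j (i - j)]) y.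
  by rewrite big_map.
apply/esym/itsum_scale; rewrite ?size_map ?size_iota // => k m lt_k.
rewrite !(nth_map 0%N) ?size_iota // !nth_iota // add0n.
by rewrite exprMn [(Pth _ _ _)^-1 ^+ _]exprVn mulrCA.
Qed.

End IteratedSeries.

Lemma mcoeff_sumX (I : eqType) (s : seq I) n (S : nzRingType) (h : I -> 'X_{1..n}) (c : I -> S) k :
  (\sum_(i <- s) c i *: 'X_[h i])@_k = \sum_(i <- s) c i * (h i == k)%:R.
Proof. by rewrite raddf_sum; apply: eq_bigr => i _ /=; rewrite mcoeffZ mcoeffX. Qed.

Lemma mcoeff_sumX_inj (I : eqType) (s : seq I) n (S : nzRingType) (h : I -> 'X_{1..n}) (c : I -> S) i :
  uniq s -> i \in s -> {in s &, injective h} -> (\sum_(i <- s) c i *: 'X_[h i])@_(h i) = c i.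
Proof.
move=> uniq_s s_i inj_h; rewrite mcoeff_sumX (bigD1_seq i) //= eqxx mulr1 big_seq_cond big1 ?addr0 //.
by move=> j /andP[s_j /negPf ne_ji]; rewrite (inj_in_eq inj_h) // ne_ji mulr0.
Qed.

(** * Independence of the values at theta *)

Section MonomialChange.
Variables (C : fieldType) (F : C -> Prop) (sF : is_subfield F).

(** Independence of the [a v] outside [S]. Variables in [S] keep their index but may not occur in
    relations, so a subfamily needs no new indexing. *)
Definition indep n (S : pred 'I_n) (a : 'I_n -> C) := forall P : {mpoly C[n]},
  (forall m, F P@_m) -> (forall v, S v -> mfree P v) -> P.@[a] = 0 -> P = 0.

(** The monomials of a relation in [a] are sent injectively to monomials in [b], up to a common
    factor [c]. Letting [h] and [c] depend on the finite list [ms] makes room for clearing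
    denominators. *)
Lemma indep_transfer n n' (S : pred 'I_n) (S' : pred 'I_n') a b :
  (forall ms : seq 'X_{1..n}, (forall m v, m \in ms -> S v -> m v = 0%N) ->
     exists (h : 'X_{1..n} -> 'X_{1..n'}) (c : C), [/\ {in ms &, injective h},
      forall m v, m \in ms -> S' v -> h m v = 0%N &
      forall m, m \in ms -> \prod_i b i ^+ h m i = c * \prod_i a i ^+ m i]) ->
  indep S' b -> indep S a.
Proof.
move=> Hms indb P FP freeP Pa.
have [m v Pm Sv | h [c [inj_h free_h Hh]]] := Hms (msupp P); first exact: (freeP v).
pose Q : {mpoly C[n']} := \sum_(m <- msupp P) P@_m *: 'X_[h m].
have Q0 : Q = 0.
  apply: indb => [k | v Sv k | ].
  - by rewrite mcoeff_sumX; apply: (sf_sum sF) => m _; apply: (sfM sF) => //; case: (_ == _);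
      [apply: (sf1 sF) | apply: (sf0 sF)].
  - rewrite mcoeff_msupp mcoeff_sumX => nz; have /hasP[m Pm /eqP <-] : has (fun m => h m == k) (msupp P).
      apply: contraNT nz => /hasPn no; rewrite big_seq big1 // => m /no /negPf ->; exact: mulr0.
    exact: free_h.
  rewrite raddf_sum big_seq; transitivity (c * P.@[a]); last by rewrite Pa mulr0.
  rewrite mevalE mulr_sumr [RHS]big_seq; apply: eq_bigr => m Pm /=.
  by rewrite mevalZ mevalX Hh // mulrCA.
apply/mpolyP => m; rewrite mcoeff0; case: (boolP (m \in msupp P)) => [Pm | /memN_msupp_eq0 //].
by rewrite -(mcoeff_sumX_inj (fun m => P@_m) (msupp_uniq P) Pm inj_h) -/Q Q0 mcoeff0.
Qed.

Lemma indep_reindex n n' (S : pred 'I_n) (j : 'I_n -> 'I_n') a b :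
  (forall v v', ~~ S v -> ~~ S v' -> j v = j v' -> v = v') -> (forall v, ~~ S v -> a v = b (j v)) ->
  indep xpred0 b -> indep S a.
Proof.
move=> inj_j ab; apply: indep_transfer => ms free.
have hE (m : 'X_{1..n}) (v : 'I_n) : ~~ S v -> (\sum_(v' | ~~ S v' && (j v' == j v)) m v' = m v)%N.
  move=> nSv; rewrite (big_pred1 v) // => v'; apply/andP/eqP => [[nSv' /eqP /inj_j -> //] | ->].
  by rewrite nSv eqxx.
exists (fun m => [multinom (\sum_(v | ~~ S v && (j v == i)) m v)%N | i < n']), 1; split=> //.
  move=> m m' s_m s_m' /mnmP E; apply/mnmP => v; case: (boolP (S v)) => [Sv | nSv].
    by rewrite !(free _ v).
  by have := E (j v); rewrite !mnmE !hE.
move=> m s_m; rewrite mul1r.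
have -> : \prod_i a i ^+ m i = \prod_(v | ~~ S v) a v ^+ m v.
  by rewrite (bigID S) /= big1 ?mul1r // => v Sv; rewrite (free m v).
rewrite [RHS](partition_big j xpredT) //=; apply: eq_bigr => i _; rewrite mnmE expr_sum.
by apply: eq_bigr => v /andP[nSv /eqP <-]; rewrite ab.
Qed.

(* The change of variables is an involution of the torus, hence permutes Laurent monomials. *)
Lemma indep_torus n (S : pred 'I_n) (o : 'I_n) (M : 'I_n -> nat) a b : ~~ S o -> a o != 0 ->
  b o = (a o)^-1 -> (forall v, v != o -> b v = b o ^+ M v * a v) -> indep S b -> indep S a.
Proof.
move=> nSo nz_ao bo bv; apply: indep_transfer => ms free.
(* Rewritten in [b], the monomial [m] in [a] acquires [b o] to the power [- L m]; the common factor
   [b o ^+ E] makes all these exponents nonnegative. *)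
pose L (m : 'X_{1..n}) := (m o + \sum_(v | v != o) M v * m v)%N.
pose E := \max_(m <- ms) L m.
have leE m : m \in ms -> (L m <= E)%N by move=> s_m; apply: leq_bigmax_seq.
exists (fun m => [multinom (if v == o then E - L m else m v)%N | v < n]), (b o ^+ E); split.
- move=> m m' s_m s_m' /mnmP eq_m.
  have eq_v v : v != o -> m v = m' v by move=> /negPf ne; have := eq_m v; rewrite !mnmE ne.
  apply/mnmP => v; have [-> | /eq_v //] := eqVneq v o.
  have := eq_m o; rewrite !mnmE eqxx => eq_L.
  have : L m = L m' by move: (leE _ s_m) (leE _ s_m') eq_L; clear; lia.
  rewrite /L (eq_bigr (fun v => M v * m' v)%N) => [|v' /eq_v -> //]; exact: addIn.
- by move=> m v s_m Sv; rewrite mnmE; case: eqP => [eq_v | _]; [rewrite -eq_v Sv in nSo | apply: free].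
move=> m s_m; rewrite (bigD1 o) //= [in RHS](bigD1 o) //= mnmE eqxx.
rewrite (eq_bigr (fun v => b o ^+ (M v * m v) * a v ^+ m v)) => [|v ne_v]; last first.
  by rewrite mnmE (negPf ne_v) bv // exprMn exprM.
rewrite big_split /= -expr_sum !mulrA; congr (_ * _).
rewrite -[in RHS](subnK (leE m s_m)) exprD /L exprD -!mulrA; congr (_ * _).
rewrite [in RHS]mulrC -!mulrA -exprMn bo mulfV // expr1n mulr1.
done.
Qed.

End MonomialChange.

Lemma wlt_mmap1 n (S : idomainType) (wt : 'I_n -> nat) (s : 'I_n -> {mpoly S[n]}) m :
  (forall v, wlt wt (wt v).+1 (s v)) -> wlt wt (mwt wt m).+1 (mmap1 s m).
Proof.
move=> Hs; have H1 : wlt wt 1 (1 : {mpoly S[n]}) by rewrite -mpolyC1; apply: wltC.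
rewrite /mmap1 /mwt; elim/big_rec2: _ => [// | v D x _ IH]; rewrite -addnS; apply: wltM IH.
elim: (m v) => [|k IHk]; first by rewrite expr0.
by rewrite exprS mulSn -addnS; apply: wltM.
Qed.

Lemma finite_bounded_multinom n (W : 'I_n -> nat) D : (forall v, (0 < W v)%N) ->
  exists s : seq 'X_{1..n}, uniq s /\ forall m, (m \in s) = (mwt W m <= D)%N.
Proof.
move=> W_gt0; exists [seq m <- [seq val m | m <- enum {: 'X_{1..n < D.+1}}] | (mwt W m <= D)%N].
split; first by rewrite filter_uniq // map_inj_uniq ?enum_uniq //; apply: val_inj.
move=> m; rewrite mem_filter andbC; case: leqP => [le_m | _]; last by rewrite andbF.
rewrite andbT; have lt_m : (mdeg m < D.+1)%N.
  rewrite ltnS mdegE; apply: leq_trans le_m; apply: leq_sum => v _; exact: leq_pmulr.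
by apply/mapP; exists (BMultinom lt_m); rewrite ?mem_enum.
Qed.

Lemma pOver_divX (C : fieldType) (F : C -> Prop) (sF : is_subfield F) c (r s : {poly C}) :
  F c -> r = ('X - c%:P) * s -> pOver F r -> pOver F s.
Proof.
move=> Fc defr Fr; have step i : F s`_i.+1 -> F s`_i.
  move=> Fs; have := congr1 (fun t : {poly C} => t`_i.+1) defr.
  rewrite mulrBl coefB coefXM /= coefCM => /eqP; rewrite eq_sym subr_eq => /eqP ->.
  by apply: (sfD sF) => //; apply: (sfM sF).
suff H k i : (size s <= i + k)%N -> F s`_i by move=> i; apply: (H (size s)); rewrite leq_addl.
elim: k i => [|k IHk] i; first by rewrite addn0 => le_i; rewrite nth_default //; apply: (sf0 sF).
by rewrite addnS -addSn => /IHk /step.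
Qed.

(** * From values to functions and back *)

Section Values.
Variables (C : closedFieldType) (R : realFieldType) (abs : C -> R).
Hypothesis Habs : nonarch_abs abs.
Variables (p e : nat) (chC : p \in [pchar C]) (e_gt0 : (0 < e)%N).
Local Notation q := (p ^ e)%N.
Variables (theta : C) (Htheta : 1 < abs theta).
Local Notation Th := (abs theta).
Local Notation tw := (tw e chC 1).
Local Notation Kbar := (in_Kbar q theta).
Local Notation sK := (Kbar_subfield e chC theta).
Local Notation Th_gt0 := (Th_gt0 Htheta).
Hypothesis Hcof : forall B : R, exists n, B <= Th ^+ n.

Section Specialize.
Variables (n : nat) (w : 'I_n -> pser C) (val : 'I_n -> C).
Hypothesis ev_w : forall v, evat abs Th theta (w v) (val v).

(** Specialised at [theta], a relation between the functions becomes one between the values, so all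
    its coefficients vanish at [theta]. Division by [X - theta] gives a relation with coefficients
    of smaller size. *)
Lemma indep_lift (S : pred 'I_n) P : indep Kbar S val -> mOver Kbar P ->
  mmap (@of_poly C) w P = 0 -> (forall v, S v -> mfree P v) -> P = 0.
Proof.
move=> ind; have [N] : exists N, forall m, (size P@_m <= N)%N.
  exists (\max_(m <- msupp P) size P@_m)%N => m.
  case: (boolP (m \in msupp P)) => [Pm | /memN_msupp_eq0 ->]; last by rewrite size_poly0.
  exact: (leq_bigmax_seq (F := fun m => size P@_m)).
elim: N P => [|N IHN] P leN KP evP freeP.
  by apply/mpolyP => m; apply/eqP; rewrite mcoeff0 -size_poly_leq0.
have valP : (map_mpoly (horner_eval theta) P).@[val] = 0.
  have := evat_mmap Habs Th_gt0 P ev_w; rewrite evP => /(evat0_eq Habs Th_gt0 (lexx _)) <-.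
  pose hev : {rmorphism {poly C} -> C} := horner_eval theta.
  apply: (@mpoly_rmorph_ext n {poly C} C (meval val \o map_mpoly hev) (mmap hev val)) => [c | v] /=.
    by rewrite map_mpolyC mevalC mmapC.
  by rewrite map_mpolyX mevalXU mmapX mmap1U.
have coef0 m : (P@_m).[theta] = 0.
  have : map_mpoly (horner_eval theta) P = 0.
    apply: ind valP => [k | v Sv k]; first by rewrite mcoeff_map_mpoly; apply: (pOver_horner sK) (KP k) (theta_Kbar e chC theta).
    rewrite mcoeff_msupp mcoeff_map_mpoly => nz; apply: (freeP v Sv); rewrite mcoeff_msupp.
    by apply: contra nz => /eqP ->; rewrite raddf0.
  by move/(congr1 (mcoeff m)); rewrite mcoeff_map_mpoly mcoeff0.
have exg m : exists r, P@_m = ('X - theta%:P) * r.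
  by have /factor_theorem [s ->] := introT eqP (coef0 m); exists s; rewrite mulrC.
have [g Hg] := choice exg.
pose Q := \sum_(m <- msupp P) g m *: 'X_[m].
have nzX : 'X - theta%:P != 0 by rewrite polyXsubC_eq0.
have QE m : Q@_m = g m.
  case: (boolP (m \in msupp P)) => [Pm | nPm].
    by rewrite (mcoeff_sumX_inj (h := id)) ?msupp_uniq.
  have -> : g m = 0.
    by have := Hg m; rewrite (memN_msupp_eq0 nPm) => /esym/eqP; rewrite mulf_eq0 (negPf nzX) => /eqP.
  rewrite mcoeff_sumX big_seq big1 // => k Pk; case: eqP => [eq_k | _]; last by rewrite mulr0.
  by rewrite -eq_k Pk in nPm.
have defP : P = ('X - theta%:P)%:MP * Q by apply/mpolyP => m; rewrite mcoeffCM QE.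
rewrite defP (IHN Q) ?mulr0 //.
- move=> m; rewrite QE; have [-> | nz_g] := eqVneq (g m) 0; first by rewrite size_poly0.
  by have := leN m; rewrite Hg mulrC size_Mmonic ?monicXsubC // size_XsubC addn2.
- by move=> m; rewrite QE; apply: (pOver_divX sK (theta_Kbar e chC theta) (Hg m)).
- have := evP; rewrite defP rmorphM /= mmapC => /ps_mulf_eq0 [/eqP |//].
  by rewrite (negPf (of_poly_neq0 nzX)).
- move=> v Sv m; rewrite mcoeff_msupp QE => nz_g; apply: (freeP v Sv); rewrite mcoeff_msupp Hg.
  by rewrite mulf_neq0.
Qed.
End Specialize.

Variables (n d : nat) (o : 'I_n) (idx : nat -> nat -> 'I_n) (lab : 'I_n -> nat * nat).
Hypothesis lab_o : lab o = (0, 0)%N.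
Hypothesis idxK : forall i j, valid d i j -> lab (idx i j) = (i, j).
Hypothesis labP : forall v, v != o -> valid d (lab v).1 (lab v).2 /\ v = idx (lab v).1 (lab v).2.
Variables (nn : nat -> nat) (u : nat -> {poly C}).
Hypothesis nn_gt0 : forall k, (1 <= k <= d)%N -> (0 < nn k)%N.
Hypothesis Ku : forall k, (1 <= k <= d)%N -> pOver Kbar (u k).
Local Notation sig := (sig p e theta d o idx lab nn u).
Local Notation hat := (hat C d idx).
Local Notation wt := (wt lab).
Variables (w : 'I_n -> pser C) (val : 'I_n -> C).
Hypothesis w_eq : forall v, w v = mmap (@of_poly C) (tw \o w) (sig v).
Hypothesis conv_w : forall v, conv abs Th (w v).
Hypothesis nz_wo : w o != 0.
Hypothesis ev_w : forall v, evat abs Th theta (w v) (val v).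
Hypothesis base : indep Kbar (fun v => (2 <= wt v)%N) val.
Local Notation ev := (mmap (@of_poly C) w).

Let ev_inj P : mOver Kbar P -> ev P = 0 -> P = 0.
Proof.
move=> KPP evP.
have conv1 v : conv abs 1 (w v).
  by apply: (conv_mono Habs) (conv_w v); rewrite ?ler01 // ltW.
have H := @ostrowski _ _ _ Habs _ _ chC e_gt0 _ _ _ _ _ _ lab_o idxK labP _ _ Ku _ w_eq conv1 nz_wo.
apply: H KPP evP => Q KQ evQ freeQ.
exact: (indep_lift ev_w base KQ evQ freeQ).
Qed.

(* The grading for which every [sig v] is homogeneous. *)
Let W v := if v == o then 1%N else (\sum_((lab v).2 <= k < (lab v).1) nn k)%N.

Let W_gt0 v : (0 < W v)%N.
Proof.
rewrite /W; case: eqP => // /eqP /labP [/andP[/andP[j_gt0 lt_ji] le_i] _].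
by rewrite big_ltn // addn_gt0 nn_gt0 // j_gt0 -ltnS (leq_trans lt_ji).
Qed.

Let W_hat i j : (j <= i)%N -> wlt W (\sum_(j <= k < i) nn k)%N.+1 (hat i j).
Proof.
move=> le_ji; rewrite /hat; case: ifP => [vij | _].
  have -> : (\sum_(j <= k < i) nn k)%N = W (idx i j) by rewrite /W (negPf (idx_neq_o lab_o idxK vij)) idxK.
  exact: wltX.
apply: (@wlt_mono _ _ _ 1) => //; case: (i == j); last exact: wlt0.
rewrite -mpolyC1; exact: wltC.
Qed.

Let W_sig v : wlt W (W v).+1 (sig v).
Proof.
rewrite /sig; case: ifP => [/eqP -> | ne_v]; first by apply: wltCM; apply: wltX.
apply: wltD; first exact: wltX.
have [/andP[/andP[j_gt0 lt_ji] le_i] _] := labP (negbT ne_v).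
rewrite /W ne_v; move: lt_ji; case: (lab v).1 => // i; rewrite ltnS => le_ji /=.
rewrite big_nat_recr //= addnC -addnS; apply: wltM; last exact: W_hat.
apply: wltCM; elim: (nn i) => [|k IHk]; first by rewrite expr0 -mpolyC1; apply: wltC.
have Wo : W o = 1%N by rewrite /W eqxx.
by rewrite exprS; apply: (@wltM _ _ _ 1 k.+1) IHk; apply: (@wlt_mono _ _ _ (W o).+1); [rewrite Wo | apply: wltX].
Qed.

(** Ordered by [wt], the matrix of [sig] on monomials is triangular with powers of [X - theta^q] on
    the diagonal, which is the nondegeneracy that the criterion asks for. *)
Let sigX_top m m' : (mwt wt m' <= mwt wt m)%N ->
  (msub sig 'X_[m'])@_m = (m' == m)%:R * ('X - (theta ^+ q)%:P) ^+ m o.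
Proof.
move=> le_m; have wX : wlt wt (mwt wt m).+1 ('X_[m'] : {mpoly {poly C}[n]}).
  by move=> k /mem_msuppXP <-; rewrite ltnS.
have [_ ->] // := msub_top (sigE p e theta d o idx lab nn u)
  (fun v => @sig_wlt _ _ _ chC e_gt0 _ _ _ _ _ _ lab_o idxK labP nn u v) wX.
rewrite mcoeffX (bigD1 o) //= eqxx big1 ?mulr1 // => v ne_vo.
by rewrite (negPf ne_vo) expr1n.
Qed.

(** Two gradings cooperate: [W] selects finitely many monomials with span stable under [sig], which
    gives the system for the criterion, and [wt] makes its matrix triangular. The relation between
    functions that the criterion returns is excluded by [ev_inj]. *)
Lemma values_indep : indep Kbar xpred0 val.
Proof.
move=> P0 KP0 _ valP0; apply: contrapT => /eqP nzP0.
have [s [uniq_s mem_s]] := finite_bounded_multinom (\max_(m <- msupp P0) mwt W m)%N W_gt0.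
pose l := size s; pose mon (i : 'I_l) := tnth (in_tuple s) i.
have inj_mon : injective mon by apply/tuple_uniqP.
have mon_s i : mon i \in s by apply: mem_tnth.
have supp_s (S : nzRingType) (Q : {mpoly S[n]}) : (forall m, m \in msupp Q -> m \in s) ->
    Q = \sum_i Q@_(mon i) *: 'X_[mon i].
  move=> Qs; rewrite -(big_tnth _ _ _ xpredT (fun m => Q@_m *: 'X_[m])); apply/mpolyP => k.
  case: (boolP (k \in s)) => [s_k | ns_k]; first by rewrite (mcoeff_sumX_inj (h := id)).
  rewrite memN_msupp_eq0; last by apply: contra ns_k; apply: Qs.
  rewrite mcoeff_sumX big_seq big1 // => m s_m; case: eqP => [eq_m | _]; last by rewrite mulr0.
  by rewrite -eq_m s_m in ns_k.
pose B : 'M[{poly C}]_l := \matrix_(i, j) (msub sig 'X_[mon i])@_(mon j).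
pose psi : 'cV[pser C]_l := \col_i ev 'X_[mon i].
pose vals (i : 'I_l) := \prod_v val v ^+ mon i v.
pose rho i := P0@_(mon i).
have cpsi i : conv abs Th (psi i 0) by rewrite mxE; apply: (conv_mmap Habs Th_gt0).
have psi_eq : psi = map_mx (@of_poly C) B *m map_mx tw psi.
  apply/matrixP => i j; rewrite !mxE -(ev_sig w_eq).
  rewrite [msub _ _]supp_s => [|m]; last first.
    rewrite /msub mmapX => /(wlt_mmap1 W_sig); rewrite ltnS mem_s => /leq_trans; apply.
    by rewrite -mem_s.
  rewrite rmorph_sum; apply: eq_bigr => k _ /=; rewrite mmapZ !mxE; congr (_ * _).
  by rewrite !mmapX /mmap1 rmorph_prod; apply: eq_bigr => v _; rewrite rmorphXn.
have B_inj z : z != theta ^+ q -> forall r : 'rV[C]_l, r *m map_mx (horner_eval z) B = 0 -> r = 0.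
  move=> nz r rB0; apply/rowP => i; rewrite mxE; apply/eqP; apply: contrapT => /negP nz_ri.
  (* Among the nonzero entries of [r], take one whose monomial has greatest weight: its column
     receives the diagonal contribution only. *)
  have [i1 nz_i1 max_i1] := @arg_maxnP _ i (fun i => r 0 i != 0) (fun i => mwt wt (mon i)) nz_ri.
  have := congr1 (fun A : 'rV_l => A 0 i1) rB0; rewrite !mxE (bigD1 i1) //= big1 => [|k ne_k].
    rewrite !mxE sigX_top // eqxx mul1r addr0 /horner_eval !hornerE => /eqP.
    by rewrite mulf_eq0 (negPf nz_i1) expf_eq0 subr_eq0 (negPf nz) andbF.
  have [-> | nz_k] := eqVneq (r 0 k) 0; first by rewrite mul0r.
  rewrite !mxE sigX_top; last exact: max_i1.
  by rewrite (inj_eq inj_mon) (negPf ne_k) mul0r /horner_eval horner0 mulr0.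
have KB i j k : Kbar (B i j)`_k.
  have := @mOver_sig _ _ _ chC e_gt0 _ _ _ _ _ _ labP nn u Ku w nz_wo _ (@mOverX n _ _ sK (mon i)) (mon j) k.
  by rewrite mxE.
have evals i : evat abs Th theta (psi i 0) (vals i).
  rewrite mxE mmapX; apply: (evat_prod Habs Th_gt0) => v _; exact: (evatX Habs Th_gt0).
have P0s : P0 = \sum_i rho i *: 'X_[mon i].
  by apply: supp_s => m P0m; rewrite mem_s; apply: (leq_bigmax_seq (F := fun m => mwt W m)).
have [i0 nz_rho] : exists i, rho i != 0.
  apply: contrapT => no; case/eqP: nzP0; rewrite P0s big1 // => i _.
  have [-> | nz_i] := eqVneq (rho i) 0; first by rewrite scale0r.
  by case: no; exists i.
have sum_rho : \sum_i rho i * vals i = 0.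
  transitivity P0.@[val] => //; rewrite [in RHS]P0s [RHS]raddf_sum.
  by apply: eq_bigr => i _; rewrite /= mevalZ mevalX.
have [g [Kg [i1 nz_g] sum_g]] := abp_criterion Habs e_gt0 Htheta Hcof cpsi psi_eq B_inj KB evals
  (fun i => KP0 (mon i)) (ex_intro _ i0 nz_rho) sum_rho.
have P0' : \sum_i g i *: 'X_[mon i] = 0 :> {mpoly {poly C}[n]}.
  apply: ev_inj => [m | ].
    rewrite mcoeff_sumX; apply: (pOver_sum sK) => i _; apply: (pOverM sK); first exact: Kg.
    by case: (_ == _); [apply: (pOver1 sK) | apply: (pOver0 sK)].
  by rewrite -[RHS]sum_g rmorph_sum; apply: eq_bigr => i _ /=; rewrite mmapZ mxE.
case/eqP: nz_g.
have := mcoeff_sumX_inj g (index_enum_uniq _) (mem_index_enum i1) (in2W inj_mon).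
by rewrite P0' mcoeff0.
Qed.

End Values.

Lemma wlt_exp n (S : idomainType) (wt : 'I_n -> nat) D (P : {mpoly S[n]}) k :
  wlt wt D.+1 P -> wlt wt (k * D).+1 (P ^+ k).
Proof.
move=> wP; elim: k => [|k IHk]; first by rewrite expr0 -mpolyC1; apply: wltC.
by rewrite exprS mulSn -addnS; apply: wltM.
Qed.

Lemma wlt_prod n (S : idomainType) (wt : 'I_n -> nat) (I : Type) (r : seq I) (D : I -> nat)
    (P : I -> {mpoly S[n]}) :
  (forall i, wlt wt (D i).+1 (P i)) -> wlt wt (\sum_(i <- r) D i)%N.+1 (\prod_(i <- r) P i).
Proof.
move=> wP; elim: r => [|i r IHr]; first by rewrite !big_nil -mpolyC1; apply: wltC.
by rewrite !big_cons -addnS; apply: wltM.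
Qed.

(** * Transcendence degree *)

Section TranscendenceDegree.
Variables (C : closedFieldType) (F : C -> Prop) (sF : is_subfield F).

Lemma mcoeffM_in n (P Q : {mpoly C[n]}) : (forall m, F P@_m) -> (forall m, F Q@_m) ->
  forall m, F (P * Q)@_m.
Proof.
move=> FP FQ m; rewrite mcoeffM; apply: (sf_sum sF) => k _; exact: (sfM sF).
Qed.

Lemma mcoeffX_in n m k : F ('X_[m] : {mpoly C[n]})@_k.
Proof. by rewrite mcoeffX; case: (m == k); [apply: (sf1 sF) | apply: (sf0 sF)]. Qed.

Lemma mcoeff1_in n k : F (1 : {mpoly C[n]})@_k.
Proof. by rewrite -mpolyX0; apply: mcoeffX_in. Qed.

Lemma mcoeff_exp_in n (P : {mpoly C[n]}) k : (forall m, F P@_m) -> forall m, F (P ^+ k)@_m.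
Proof.
move=> FP; elim: k => [|k IHk] m; first by rewrite expr0; apply: mcoeff1_in.
by rewrite exprS; apply: mcoeffM_in.
Qed.

Lemma mcoeff_prod_in n (I : Type) (r : seq I) (A : pred I) (P : I -> {mpoly C[n]}) :
  (forall i, A i -> forall m, F (P i)@_m) -> forall m, F (\prod_(i <- r | A i) P i)@_m.
Proof.
move=> FP; elim/big_rec: _ => [|i Q Ai IH]; first exact: mcoeff1_in.
exact: mcoeffM_in (FP i Ai) IH.
Qed.

Lemma common_fraction (s t : seq C) : (forall y, y \in t -> in_gen_field F s y) ->
  exists (D : {mpoly C[size s]}) (N : 'I_(size t) -> {mpoly C[size s]}),
  [/\ forall m, F D@_m, forall i m, F (N i)@_m, D.@[fun i : 'I_(size s) => s`_i] != 0 &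
      forall i, (N i).@[fun i : 'I_(size s) => s`_i] = D.@[fun i : 'I_(size s) => s`_i] * t`_i].
Proof.
move=> Ht; have H (i : 'I_(size t)) := Ht _ (mem_nth 0 (ltn_ord i)).
have [P HP] := choice H; have [Q HQ] := choice HP.
exists (\prod_i Q i), (fun i => P i * \prod_(j | j != i) Q j); split=> [m | i m | | i].
- by apply: mcoeff_prod_in => i _; case: (HQ i) => _ [].
- apply: mcoeffM_in; first by case: (HQ i).
  by apply: mcoeff_prod_in => j _; case: (HQ j) => _ [].
- by rewrite rmorph_prod prodf_seq_neq0; apply/allP => i _; case: (HQ i) => _ [_ []].
have [_ [_ [nzQ ->]]] := HQ i; rewrite rmorphM [in RHS](bigD1 i) //= [in RHS]rmorphM /=.
by move: nzQ; set a := (P i).@[_]; set b := (Q i).@[_]; set c := (\prod_(j | _) _).@[_] => nzb; field.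
Qed.

(* For [D] large there are more monomials in [t] with exponents [< D] than monomials in [s] available
   to express them after clearing denominators. *)
Lemma indep_size_le (s t : seq C) : (forall y, y \in t -> in_gen_field F s y) -> alg_indep F t ->
  (size t <= size s)%N.
Proof.
move=> Ht indt; rewrite leqNgt; apply/negP => lt_st.
set n := size s; set k := size t; have [Den [N [FD FN nzD HN]]] := common_fraction Ht.
pose sv (i : 'I_n) := s`_i; pose one (i : 'I_n) := 1%N.
have bounded (P : {mpoly C[n]}) : exists c, wlt one c.+1 P.
  exists (\max_(m <- msupp P) mwt one m)%N => m Pm; rewrite ltnS.
  exact: (leq_bigmax_seq (F := mwt one)).
have [cN HcN] := choice (fun i => bounded (N i)); have [cD HcD] := bounded Den.
pose c := maxn cD (\max_i cN i).
have wN i : wlt one c.+1 (N i).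
  apply: (@wlt_mono _ _ _ (cN i).+1); last exact: HcN.
  by rewrite ltnS leq_max (leq_bigmax i) orbT.
have wD : wlt one c.+1 Den by apply: (@wlt_mono _ _ _ cD.+1); rewrite ?ltnS ?leq_maxl.
(* Since [E <= (c * k).+1 * D], there are at most [(c * k).+1 ^ n * D ^ n < D ^ n.+1 <= D ^ k]
   monomials in [s], against [D ^ k] in [t]. *)
pose D := ((c * k).+1 ^ n).+1; pose E := (c * (k * D)).+1.
have lt_card : (#|{ffun 'I_n -> 'I_E}| < #|{ffun 'I_k -> 'I_D}|)%N.
  rewrite !card_ffun !card_ord; apply: (@leq_trans (D ^ n.+1)); last by rewrite leq_pexp2l.
  rewrite expnS; apply: (@leq_ltn_trans ((c * k).+1 ^ n * D ^ n)).
    have le_E : (E <= (c * k).+1 * D)%N by rewrite /E mulnA mulSn addnC -addn1 leq_add2l.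
    by rewrite -expnMn; case: (n) => // n'; rewrite leq_exp2r.
  by rewrite ltn_mul2r expn_gt0 /= ltnSn.
pose deg (a : {ffun 'I_k -> 'I_D}) := (\sum_i a i)%N.
have deg_le a : (deg a <= k * D)%N.
  rewrite -[k in (k * D)%N]card_ord -sum_nat_const; apply: leq_sum => i _; exact: ltnW.
(* Padding with powers of [Den] gives all monomials in [t] the same denominator. *)
pose G (a : {ffun 'I_k -> 'I_D}) := Den ^+ (k * D - deg a) * \prod_i N i ^+ a i.
have FG a m : F (G a)@_m.
  apply: mcoeffM_in; first exact: mcoeff_exp_in.
  by apply: mcoeff_prod_in => i _; apply: mcoeff_exp_in.
have wG a : wlt one E (G a).
  have -> : E = ((k * D - deg a) * c + (\sum_i a i * c).+1)%N.
    by rewrite -big_distrl /= -/(deg a) addnS -mulnDl subnK // mulnC.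
  by apply: wltM; [apply: wlt_exp | apply: wlt_prod => i; apply: wlt_exp].
have G_s a : (G a).@[sv] = Den.@[sv] ^+ (k * D) * \prod_(i < k) t`_i ^+ a i.
  rewrite rmorphM rmorphXn rmorph_prod /= (eq_bigr (fun i : 'I_k => Den.@[sv] ^+ a i * t`_i ^+ a i)) => [|i _].
    by rewrite big_split /= -expr_sum mulrA -exprD subnK.
  by rewrite rmorphXn /= HN exprMn.
pose mon (b : {ffun 'I_n -> 'I_E}) := [multinom (b i : nat) | i < n].
have [v [Fv [[a0 nz_v] v0]]] := subfield_kernel sF (fun a b => FG a (mon b)) lt_card.
have sumG : \sum_a v a *: G a = 0.
  apply/mpolyP => m; rewrite raddf_sum mcoeff0 /=; case: (ltnP (mwt one m) E) => [lt_m | le_m].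
    have lt_mi i : (m i < E)%N.
      by apply: leq_ltn_trans lt_m; rewrite /mwt (bigD1 i) //= muln1 leq_addr.
    rewrite -[RHS](v0 [ffun i => Ordinal (lt_mi i)]); apply: eq_bigr => a _; rewrite mcoeffZ.
    by congr (_ * _@__); apply/mnmP => i; rewrite mnmE ffunE.
  by rewrite big1 // => a _; rewrite mcoeffZ (wlt_coef (wG a) le_m) mulr0.
pose mont (a : {ffun 'I_k -> 'I_D}) := [multinom (a i : nat) | i < k].
pose P : {mpoly C[k]} := \sum_a v a *: 'X_[mont a].
have P0 : P = 0.
  apply: indt => [m|].
    rewrite mcoeff_sumX; apply: (sf_sum sF) => a _; apply: (sfM sF) => //.
    by case: (_ == _); [apply: (sf1 sF) | apply: (sf0 sF)].
  apply: (mulfI (expf_neq0 (k * D) nzD)); rewrite mulr0.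
  have sG : \sum_a v a * (G a).@[sv] = 0.
    transitivity (meval sv (\sum_a v a *: G a)); last by rewrite sumG meval0.
    rewrite [RHS]raddf_sum.
    by apply: eq_bigr => a _; rewrite /= mevalZ.
  rewrite -[RHS]sG [P.@[_]]raddf_sum mulr_sumr.
  apply: eq_bigr => a _ /=; rewrite !mevalZ mevalX G_s mulrCA; congr (_ * (_ * _)).
  by apply: eq_bigr => i _; rewrite mnmE.
case/eqP: nz_v.
have inj_mont : injective mont.
  by move=> a a' /mnmP E1; apply/ffunP => i; apply/val_inj; have := E1 i; rewrite !mnmE.
have := mcoeff_sumX_inj v (index_enum_uniq _) (mem_index_enum a0) (in2W inj_mont).
by rewrite -/P P0 mcoeff0.
Qed.

End TranscendenceDegree.

Lemma card_Idset d : #|Idset d| = (d * d.+1 %/ 2)%N.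
Proof.
rewrite /Idset cardsE -sum1_card.
rewrite -(pair_big_dep xpredT (fun i j : 'I_d.+2 => (0 < j)%N && (j < i)%N) (fun _ _ => 1%N)) /=.
rewrite (eq_bigr (fun i : 'I_d.+2 => i.-1)) => [|i _].
  rewrite big_ord_recl /= (eq_bigr (fun i : 'I_d.+1 => nat_of_ord i)) // add0n.
  by rewrite -(big_mkord xpredT id) bin2_sum bin2 mulnC -divn2.
rewrite (eq_bigl (fun j : 'I_d.+2 => (0 < j)%N && (j < i)%N)) //.
rewrite -(big_ord_widen_cond d.+2 (fun j => (0 < j)%N) (fun=> 1%N)); last exact: ltnW.
case: (nat_of_ord i) => [|k]; first by rewrite big_ord0.
by rewrite big_mkcond big_ord_recl /= add0n sum1_card card_ord.
Qed.

Definition index_pairs d : seq (nat * nat) :=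
  [seq (nat_of_ord ij.1, nat_of_ord ij.2) | ij <- enum (Idset d)].

Lemma mem_pairs d i j : ((i, j) \in index_pairs d) = valid d i j.
Proof.
apply/mapP/andP => [[[i' j']] | [/andP[j_gt0 lt_ji] le_i]].
  by rewrite mem_enum inE => /= Hij [-> ->]; rewrite Hij -ltnS ltn_ord.
have lt_i : (i < d.+2)%N by [].
by exists (Ordinal lt_i, Ordinal (ltn_trans lt_ji lt_i)) => //; rewrite mem_enum inE /= j_gt0.
Qed.

Lemma uniq_labels d : uniq ((0, 0)%N :: index_pairs d).
Proof.
rewrite /= mem_pairs /= map_inj_uniq ?enum_uniq // => -[i j] [i' j'] [/val_inj -> /val_inj ->].
by [].
Qed.

Lemma alg_indep_indep (C : closedFieldType) (F : C -> Prop) s :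
  alg_indep F s -> indep F xpred0 (fun i : 'I_(size s) => s`_i).
Proof. by move=> ind P FP _; apply: ind. Qed.

Theorem theorem4p3
  (p e q : nat) (C : closedFieldType) (R : realFieldType) (abs : C -> R)
  (Habs : nonarch_abs abs) (Hcompl : complete_abs abs)
  (Hp : prime p) (Hchar : p \in [pchar C]) (He : (0 < e)%N) (Hq : q = (p ^ e)%N)
  (theta : C) (Htheta : 1 < abs theta)
  (zeta : C) (Hzeta : zeta ^+ (q - 1) = - theta)
  (pt : C) (Hpt : IsPiTilde abs q theta zeta pt)
  (d : nat) (n : nat -> nat) (u : nat -> {poly C})
  (Hn : forall k, (1 <= k <= d)%N -> (0 < n k)%N)
  (HuK : forall k, (1 <= k <= d)%N -> forall j, in_Kbar q theta (u k)`_j)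
  (Hubd : forall k, (1 <= k <= d)%N -> forall j,
            abs (u k)`_j ^+ (q - 1) < abs theta ^+ (n k * q))
  (x : nat -> nat -> C)
  (Hx : forall i j, (1 <= j)%N -> (j < i <= d.+1)%N ->
          IsL abs q theta (subseq_ij u i j) (subseq_ij n i j) (x i j))
  (Hind : alg_indep (in_Kbar q theta) (pt :: [seq x k.+1 k | k <- iota 1 d])) :
  trdeg_eq (in_Kbar q theta)
    (pt :: [seq x (nat_of_ord ij.1) (nat_of_ord ij.2) | ij <- enum (Idset d)])
    (1 + #|Idset d|)
  /\ (1 + #|Idset d| = 1 + d * d.+1 %/ 2)%N.
Proof.
split; last by rewrite card_Idset.
rewrite Hq in Hzeta Hpt HuK Hubd Hx Hind *; clear q Hq Hp.
have sK := Kbar_subfield e Hchar theta.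
set s := pt :: _; have size_s : size s = (1 + #|Idset d|)%N by rewrite /= size_map -cardE.
suff inds : alg_indep (in_Kbar (p ^ e) theta) s.
  split; last by move=> t Ht indt; rewrite -size_s; apply: (indep_size_le sK Ht indt).
  exists s; split=> //; split=> // y s_y.
  pose i := Ordinal (etrans (index_mem y s) s_y).
  exists 'X_i, 1; split; first exact: mcoeffX_in; split; first exact: mcoeff1_in.
  by rewrite meval1 oner_neq0 divr1 mevalXU nth_index.
have Hcof := Th_cofinal Habs Hchar He Htheta Hzeta Hpt.
have nz_pt := pi_tilde_neq0 Habs Hchar He Htheta Hzeta Hpt.
have [Om [cOm bOm Om_eq eOm nzOm]] := Omega_exists Habs Hcompl Hchar He Htheta Hzeta Hpt.
have [Y [cY Y1 Y_eq eY]] := Y_exists Habs Hcompl He Htheta Hzeta Hcof cOm bOm Om_eq eOm HuK Hubd.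
(* Position 0 of [s] holds [pt] and receives the dummy label [(0, 0)], which is no valid pair; the
   default [o] in [idx] is met only for invalid pairs. *)
pose labs := (0, 0)%N :: index_pairs d; have size_labs : size labs = size s by rewrite /= !size_map.
pose N := size s; pose o : 'I_N := Ordinal (ltn0Sn _).
pose lab (v : 'I_N) := nth (0, 0)%N labs v.
pose idx i j : 'I_N := insubd o (index (i, j) labs).
have idx_val i j : valid d i j -> idx i j = index (i, j) labs :> nat.
  move=> vij; have lt_i : (index (i, j) labs < N)%N by rewrite /N -size_labs index_mem inE mem_pairs vij orbT.
  by rewrite val_insubd lt_i.
have lab_o : lab o = (0, 0)%N by [].
have idxK i j : valid d i j -> lab (idx i j) = (i, j).
  by move=> vij; rewrite /lab idx_val // nth_index // inE mem_pairs vij orbT.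
have lab_mem v : v != o -> lab v \in index_pairs d.
  case: v => [[|v] lt_v] // _; rewrite /lab /=; apply: mem_nth.
  by move: lt_v; rewrite /N -size_labs.
have labP v : v != o -> valid d (lab v).1 (lab v).2 /\ v = idx (lab v).1 (lab v).2.
  move=> ne_v; have vv : valid d (lab v).1 (lab v).2 by rewrite -mem_pairs -surjective_pairing lab_mem.
  split=> //; apply/val_inj; rewrite [RHS]idx_val // -surjective_pairing index_uniq ?uniq_labels //.
  by rewrite size_labs.
pose a (v : 'I_N) := s`_v.
have aE v : v != o -> a v = x (lab v).1 (lab v).2.
  have sE : s = pt :: [seq x ij.1 ij.2 | ij <- index_pairs d] by rewrite /s /index_pairs -map_comp.
  move=> ne_v; have lt_v : (v < size labs)%N by rewrite size_labs.
  move: ne_v lt_v; rewrite /a /lab sE; case: v => [[|v] lt_v] // _ /=; rewrite ltnS => lt_v'.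
  by rewrite (nth_map (0, 0)%N).
pose M v := (\sum_((lab v).2 <= k < (lab v).1) n k)%N.
(* The values at [theta] of the series: [pt^-1] for Omega and a power of [pt^-1] times [x i j] for
   [Y i j]. *)
pose b v := if v == o then pt^-1 else pt^-1 ^+ M v * a v.
have bo : b o = pt^-1 by rewrite /b eqxx.
have bv v : v != o -> b v = pt^-1 ^+ M v * a v by rewrite /b => /negPf ->.
have ao : a o = pt by [].
suff ind_a : indep (in_Kbar (p ^ e) theta) xpred0 a by move=> P FP; apply: ind_a.
(* The torus change of variables is used twice: here to reduce from [a] to [b], where functional
   equations are available, and below to carry the depth one hypothesis from [a] to [b]. *)
apply: (@indep_torus _ _ sK N xpred0 o M a b); rewrite ?ao ?bo //.
have inda : indep (in_Kbar (p ^ e) theta) (fun v => (2 <= wt lab v)%N) a.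
  have size_t : (size [seq x k.+1 k | k <- iota 1 d]).+1 = d.+1 by rewrite size_map size_iota.
  (* In the list of the hypothesis, [pt] has position 0 and [x k.+1 k] has position [k], the second
     component of its label. *)
  pose j v : 'I_(size (pt :: [seq x k.+1 k | k <- iota 1 d])) := insubd ord0 (if v == o then 0%N else (lab v).2).
  have lab_free v : v != o -> ~~ (2 <= wt lab v)%N -> lab v = ((lab v).2.+1, (lab v).2) /\ (0 < (lab v).2 <= d)%N.
    move=> /labP [/andP[/andP[j_gt0 lt_ji] le_i] _]; rewrite /wt -ltnNge ltnS => le1.
    move: j_gt0 lt_ji le_i le1; case: (lab v) => i k /= k_gt0 lt_ki le_i le1.
    by have <- : i = k.+1 by [move: lt_ki le1; clear; lia]; rewrite k_gt0 -ltnS (leq_trans lt_ki).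
  have j_val v : ~~ (2 <= wt lab v)%N -> j v = (if v == o then 0%N else (lab v).2) :> nat.
    move=> free_v; rewrite val_insubd [X in if X then _ else _](_ : _ = true) //=.
    rewrite size_map size_iota; case: eqP => // /eqP ne_v.
    by have [_ /andP[_]] := lab_free v ne_v free_v.
  apply: (@indep_reindex _ _ sK _ _ _ j a _ _ _ (alg_indep_indep Hind)) => [v v' free_v free_v' | v free_v].
    move/(congr1 (fun i => nat_of_ord i)); rewrite !j_val //; case: eqP => [-> | /eqP ne_v]; case: eqP => [-> | /eqP ne_v'] //.
    - by have [_ /andP[+ _]] := lab_free v' ne_v' free_v'; move=> /[swap] <-.
    - by have [_ /andP[+ _]] := lab_free v ne_v free_v; move=> /[swap] ->.
    have [E1 _] := lab_free v ne_v free_v; have [E2 _] := lab_free v' ne_v' free_v'.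
    have [_ Ev] := labP v ne_v; have [_ Ev'] := labP v' ne_v' => eq_k.
    by rewrite Ev Ev' E1 E2 /= eq_k.
  rewrite j_val //; case: eqP => [-> | /eqP ne_v]; first by rewrite ao.
  have [E1 /andP[k_gt0 le_k]] := lab_free v ne_v free_v.
  rewrite aE // E1 /=; case: (lab v).2 k_gt0 le_k => // k _ le_k /=.
  by rewrite (nth_map 0%N) ?size_iota // nth_iota.
have indb : indep (in_Kbar (p ^ e) theta) (fun v => (2 <= wt lab v)%N) b.
  apply: (@indep_torus _ _ sK N _ o M b a); rewrite ?bo ?ao ?invr_eq0 ?invrK //.
  by move=> v ne_v; rewrite bv // exprVn mulrA mulfV ?mul1r // expf_neq0.
pose w v := if v == o then Om else Y (lab v).1 (lab v).2.
have wo : w o = Om by rewrite /w eqxx.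
have wv v : v != o -> w v = Y (lab v).1 (lab v).2 by rewrite /w => /negPf ->.
have valid_lab v : v != o -> [/\ (0 < (lab v).2 < (lab v).1)%N, (0 < (lab v).2 <= (lab v).1)%N & ((lab v).1 <= d.+1)%N].
  by move=> /labP [/andP[/andP[j_gt0 lt_ji] le_i] _]; split; rewrite ?j_gt0 ?(ltnW lt_ji).
pose evt : {rmorphism {mpoly {poly C}[N]} -> pser C} := mmap (@of_poly C) (tw e Hchar 1 \o w).
have evtX v : evt 'X_v = tw e Hchar 1 (w v) by rewrite /evt /= mmapX mmap1U.
have evtC (c : {poly C}) : evt c%:MP = of_poly c := mmapC _ _ c.
have evt_fcoef k : evt (fcoef p e theta o n u k) = of_poly (u k) * Om ^+ n k.
  transitivity (evt (u k * ('X - (theta ^+ (p ^ e))%:P) ^+ n k)%:MP * evt 'X_o ^+ n k).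
    by rewrite -rmorphXn -rmorphM.
  rewrite evtX wo evtC rmorphM rmorphXn -mulrA.
  by rewrite -exprMn -Om_eq.
have evt_hat i j : (0 < j <= i)%N -> (i <= d.+1)%N -> evt (hat C d idx i j) = tw e Hchar 1 (Y i j).
  move=> /andP[j_gt0 le_ji] le_i; rewrite /hat; case: ifPn => [vij | nvij].
    by rewrite evtX wv ?(idx_neq_o lab_o idxK) // idxK.
  have eq_ij : i = j.
    by apply/eqP; rewrite eqn_leq le_ji andbT leqNgt; apply: contra nvij => lt_ji; rewrite /valid j_gt0 lt_ji.
  by rewrite eq_ij eqxx Y1 ?j_gt0 -?eq_ij // !rmorph1.
apply: (values_indep Habs He Htheta Hcof lab_o idxK labP Hn HuK (w := w)) indb.
- move=> v; have [-> | ne_v] := eqVneq v o.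
    by rewrite wo {1}Om_eq /sig eqxx rmorphM /= mmapC mmapX mmap1U /= wo.
  have [Hj _ Hi] := valid_lab v ne_v; rewrite wv // Y_eq // /sig (negPf ne_v).
  rewrite -[mmap _ _ _]/(evt _) rmorphD rmorphM evtX evt_fcoef evt_hat ?wv //.
    by case/andP: Hj => -> /=; case: (lab v).1.
  exact: leq_trans (leq_pred _) Hi.
- move=> v; have [-> | ne_v] := eqVneq v o; first by rewrite wo.
  by have [_ Hj Hi] := valid_lab v ne_v; rewrite wv //; apply: cY.
- by rewrite wo.
move=> v; have [-> | ne_v] := eqVneq v o; first by rewrite wo bo.
have [Hj _ Hi] := valid_lab v ne_v; rewrite wv // bv // aE //; apply: eY => //.
by case/andP: Hj => j_gt0 lt_ji; apply: Hx; rewrite ?lt_ji.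
Qed.
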